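(* The weighted cylinder transform $\mathcal{C}$ is a Fourier integral operator of order $-1$ with canonical relation $$C=\{((s,\alpha,\beta),(\sigma,2\sigma(x\cdot\theta_\alpha)(x\cdot\theta),2\sigma(x\cdot\theta_\beta)(x\cdot\theta));\,x,2\sigma(x-(x\cdot\theta)\theta)): x\in B^3_{\alpha_1,\alpha_2},\ s\in(0,1),\ \sigma\in\mathbb{R}\setminus 0,\ \theta\in S^2,\ |x|^2-(x\cdot\theta)^2-s=0\},$$ where $(\alpha,\beta)\in\mathbb{R}^2$ provide a local parameterization of $\theta\in S^2$, $\theta_\alpha=\partial_\alpha\theta$ and $\theta_\beta=\partial_\beta\theta$.
   Context: Fix $0<\epsilon_1<\epsilon_2<1$ and put $\alpha_i=2\epsilon_i/(1-\epsilon_i^2)$, $i=1,2$. Let $B^3_{a,b}=\{x\in\mathbb{R}^3: a<|x|<b\}$. Define $v(x)=\left(\sqrt{1+\frac{1}{|x|^2}}-\frac{1}{|x|}\right)\frac{x}{|x|}$, a diffeomorphism $B^3_{\alpha_1,\alpha_2}\to B^3_{\epsilon_1,\epsilon_2}$. For $y\in B^3_{\epsilon_1,\epsilon_2}$, $\theta\in S^2$, let $h(s,y,\theta)=\frac{4|y\times\theta|^2}{(1-|y|^2)^2}-s$; its gradient in $y$, $\nabla_y h(s,y,\theta)=8\frac{y-(y\cdot\theta)\theta}{(1-|y|^2)^2}+16\frac{|y\times\theta|^2y}{(1-|y|^2)^3}$, does not depend on $s$. The weighted cylinder transform $\mathcal{C}:C_0^\infty(B^3_{\alpha_1,\alpha_2})\to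 C^\infty((0,1)\times S^2)$ is $$\mathcal{C}f(s,\theta)=\int_{B^3_{\alpha_1,\alpha_2}}\frac{\delta\left(|x|^2-(x\cdot\theta)^2-s\right)}{|(\nabla_y h)(s,v(x),\theta)|}f(x)\,dx,$$ where $\delta(G)$ is the pullback of the Dirac delta (surface measure on $\{G=0\}$ divided by $|\nabla_xG|$). An FIO from $X\subset\mathbb{R}^{n_x}$ to $Y\subset\mathbb{R}^{n_y}$ of order $m+N/2-(n_x+n_y)/4$ is (locally, in coordinates) an operator $Af(y)$ with Schwartz kernel given by an oscillatory integral $\int_{\mathbb{R}^N}e^{i\phi(x,y,\xi)}a(x,y,\xi)\,d\xi$, where $\phi$ is a phase function (smooth for $\xi\neq0$, positively homogeneous of degree 1 in $\xi$, $d\phi\ne0$) and $a$ is a symbol of order $m$ (here of type $\rho=1$: $|\partial_{x,y}^\beta\partial_\xi^\alpha a|\le C(1+|\xi|)^{m-|\alpha|}$ locally uniformly in $(x,y)$). Its canonical relation is $\{((y,\eta),(x,\omega)): d_\xi\phi(x,y,\xi)=0,\ \omega=-d_x\phi(x,y,\xi),\ \eta=d_y\phi(x,y,\xi),\ \omega,\eta\ne0\}$. In $C$, covectors $(\hat s,\hat\alpha,\hat\beta)$ are dual to $(s,\alpha,\beta)$. *)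

(* Defs.v *)
From HB Require Import structures.
From mathcomp Require Import all_boot all_order all_algebra.
From mathcomp Require Import all_classical all_reals all_analysis.
From mathcomp Require Import measurable_realfun complex.
Set Implicit Arguments.
Unset Strict Implicit.
Unset Printing Implicit Defensive.
Import Order.TTheory GRing.Theory Num.Theory.
Import numFieldNormedType.Exports.
Local Open Scope classical_set_scope.
Local Open Scope ring_scope.
Local Open Scope complex_scope.

(* The sigma-algebra generated by the coordinates, i.e. the Borel sigma-algebra
   of R^n. *)
Section measurable_rV.
Context {R : realType} {n : nat}.

Definition rV_coords (i : 'I_n) (x : 'rV[R]_n) : R := x 0 i.

Let rV_set0 : g_sigma_preimage rV_coords set0.
Proof. exact: sigma_algebra0. Qed.

Let rV_setC A : g_sigma_preimage rV_coords A -> g_sigma_preimage rV_coords (~` A).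
Proof. exact: sigma_algebraC. Qed.

Let rV_bigcup (F : (set 'rV[R]_n)^nat) :
  (forall i, g_sigma_preimage rV_coords (F i)) ->
  g_sigma_preimage rV_coords (\bigcup_i (F i)).
Proof. exact: sigma_algebra_bigcup. Qed.

HB.instance Definition _ := @isMeasurable.Build default_measure_display
  'rV[R]_n (g_sigma_preimage rV_coords) rV_set0 rV_setC rV_bigcup.

End measurable_rV.

Lemma sigma_finite_product_measure1 d1 d2 (T1 : measurableType d1)
    (T2 : measurableType d2) (R : realType)
    (m1 : {sigma_finite_measure set T1 -> \bar R})
    (m2 : {sigma_finite_measure set T2 -> \bar R}) :
  sigma_finite setT (m1 \x m2)%E.
Proof.
have /sigma_finiteP[F [TF ndF Foo]] := sigma_finiteT m1.
have /sigma_finiteP[G [TG ndG Goo]] := sigma_finiteT m2.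
exists (fun n => F n `*` G n).
  rewrite -setXTT TF TG predeqE => -[x y]; split.
    move=> [/= [n _ Fnx] [k _ Gky]]; exists (maxn n k) => //; split.
    - by move: x Fnx; exact/subsetPset/ndF/leq_maxl.
    - by move: y Gky; exact/subsetPset/ndG/leq_maxr.
  by move=> [n _ []/= ? ?]; split; exists n.
move=> k; have [? ?] := Foo k; have [? ?] := Goo k.
split; first exact: measurableX.
by rewrite product_measure1E// lte_mul_pinfty// ge0_fin_numE.
Qed.

Section lebesgue_rV.
Context {R : realType}.

Definition rV_cons n (p : measurableTypeR R * 'rV[R]_n) : 'rV[R]_n.+1 :=
  row_mx (p.1%:M : 'rV_1) p.2.

Lemma measurable_rV_coord n (i : 'I_n) :
  measurable_fun [set: 'rV[R]_n] (@rV_coords R n i).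
Proof.
move=> _ Y mY; rewrite setTI; apply: sub_sigma_algebra => /=.
rewrite -bigcup_seq/=; exists i => /=; first by rewrite mem_index_enum.
by exists Y => //; rewrite setTI.
Qed.

Lemma measurable_fun_rVP d (T : measurableType d) n (f : T -> 'rV[R]_n) :
  measurable_fun [set: T] f <->
  forall i, measurable_fun [set: T] (@rV_coords R n i \o f).
Proof.
split=> [mf i|mf].
  by apply: measurableT_comp => //; exact: measurable_rV_coord.
move=> _ A mA; rewrite setTI.
have : preimage_set_system [set: T] f (@measurable _ 'rV[R]_n) `<=` measurable.
  rewrite /measurable/= -/(measurable) -(g_sigma_preimage_comp (@rV_coords R n)).
  apply: smallest_sub; first exact: sigma_algebra_measurable.
  case: n f mf A mA => [|n] f mf A mA; first by rewrite big_ord0.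
  rewrite -bigcup_mkord_ord; apply: bigcup_sub => i Ii.
  by move=> B [C mC <-]; exact: mf.
by apply; exists A => //; rewrite setTI.
Qed.

Lemma measurable_rV_cons n : measurable_fun setT (@rV_cons n).
Proof.
apply/measurable_fun_rVP => i.
case: (@split_ordP 1 n i) => j ij.
- rewrite (_ : _ \o _ = fst) //.
  apply/funext => p /=; rewrite /rV_coords /rV_cons ij.
  by rewrite [LHS]row_mxEl ord1 !mxE.
- rewrite (_ : _ \o _ = @rV_coords R n j \o snd).
    by apply: measurableT_comp => //; exact: measurable_rV_coord.
  by apply/funext => p /=; rewrite /rV_coords /rV_cons ij [LHS]row_mxEr.
Qed.

HB.instance Definition _ n :=
  isMeasurableFun.Build _ _ _ _ (@rV_cons n) (@measurable_rV_cons n).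

Definition rV_uncons n (x : 'rV[R]_n.+1) : measurableTypeR R * 'rV[R]_n :=
  (x 0 ord0, rsubmx (x : 'rV_(1 + n))).

Lemma rV_consK n : cancel (@rV_cons n) (@rV_uncons n).
Proof.
move=> [a u]; rewrite /rV_uncons /rV_cons /= row_mxKr; congr pair.
rewrite (_ : ord0 = lshift n (0 : 'I_1)); last exact/val_inj.
by rewrite [LHS]row_mxEl mxE.
Qed.

Lemma measurable_rV_uncons n : measurable_fun setT (@rV_uncons n).
Proof.
apply/measurable_fun_pairP; split; first exact: measurable_rV_coord.
apply/measurable_fun_rVP => i.
rewrite (_ : _ \o _ = @rV_coords R n.+1 (rshift 1 i)).
  exact: measurable_rV_coord.
by apply/funext => x /=; rewrite /rV_coords mxE.
Qed.

Section lebesgue_rV_step.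
Variables (n : nat) (m : {sigma_finite_measure set 'rV[R]_n -> \bar R}).

Definition lebesgue_rVS : set 'rV[R]_n.+1 -> \bar R :=
  pushforward (lebesgue_measure \x m)%E (@rV_cons n).

Let preim_measurable A :
  measurable A -> measurable (@rV_cons n @^-1` A).
Proof. by move=> mA; rewrite -[X in measurable X]setTI; exact: measurable_rV_cons. Qed.

Let lebesgue_rVS0 : lebesgue_rVS set0 = 0%E.
Proof. by rewrite /lebesgue_rVS /pushforward preimage_set0 measure0. Qed.

Let lebesgue_rVS_ge0 A : (0 <= lebesgue_rVS A)%E.
Proof. exact: measure_ge0. Qed.

Let lebesgue_rVS_sigma_additive : semi_sigma_additive lebesgue_rVS.
Proof.
move=> F mF tF mUF; rewrite /lebesgue_rVS /pushforward preimage_bigcup.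
apply: measure_semi_sigma_additive.
- by move=> k; exact: preim_measurable.
- apply/trivIsetP => /= i j _ _ ij; rewrite -preimage_setI.
  by move/trivIsetP : tF => /(_ _ _ _ _ ij) ->//; rewrite preimage_set0.
- by rewrite -preimage_bigcup; exact: preim_measurable.
Qed.

HB.instance Definition _ := isMeasure.Build _ _ _ lebesgue_rVS
  lebesgue_rVS0 lebesgue_rVS_ge0 lebesgue_rVS_sigma_additive.

Let lebesgue_rVS_sigma_finite : sigma_finite setT lebesgue_rVS.
Proof.
have [F FT Foo] : sigma_finite setT (lebesgue_measure \x m)%E.
  exact: sigma_finite_product_measure1.
exists (fun k => @rV_uncons n @^-1` F k).
  by rewrite -preimage_bigcup -FT preimage_setT.
move=> k; have [mF Fk] := Foo k; split.
  by rewrite -[X in measurable X]setTI; exact: measurable_rV_uncons.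
rewrite /lebesgue_rVS /pushforward -comp_preimage.
by rewrite (_ : _ \o _ = id) //; apply/funext => p /=; rewrite rV_consK.
Qed.

HB.instance Definition _ :=
  Measure_isSigmaFinite.Build _ _ _ lebesgue_rVS lebesgue_rVS_sigma_finite.

End lebesgue_rV_step.

(* Lebesgue measure on R^n: Dirac mass on the point R^0, then product with
   Lebesgue measure on R for each further coordinate. *)
Fixpoint lebesgue_rV (n : nat) : {sigma_finite_measure set 'rV[R]_n -> \bar R} :=
  match n with
  | 0%N => dirac (0 : 'rV[R]_0)
  | n'.+1 => lebesgue_rVS (lebesgue_rV n')
  end.

End lebesgue_rV.
Arguments lebesgue_rV R n : clear implicits.

Section euclidean.
Context {R : realType}.

(* The library norm `|x| on 'rV[R]_n is the max norm, hence enorm. *)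
Definition dotp n (x y : 'rV[R]_n) : R := \sum_(i < n) x 0 i * y 0 i.
Definition enorm n (x : 'rV[R]_n) : R := Num.sqrt (dotp x x).

Definition vec2 (a b : R) : 'rV[R]_2 := \row_(j < 2) nth 0 [:: a; b] j.
Definition vec3 (a b c : R) : 'rV[R]_3 := \row_(j < 3) nth 0 [:: a; b; c] j.

(* Indices are taken modulo 3. *)
Definition crossp (x y : 'rV[R]_3) : 'rV[R]_3 :=
  \row_(k < 3) (x 0 (k + 1) * y 0 (k + 2) - x 0 (k + 2) * y 0 (k + 1)).

Definition grad n (f : 'rV[R]_n -> R) (x : 'rV[R]_n) : 'rV[R]_n :=
  \row_(j < n) 'D_(delta_mx 0 j) f x.

End euclidean.

Section smooth.
Context {R : realType} {V W : normedModType R}.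

Definition iter_derive (vs : seq V) (f : V -> W) : V -> W :=
  foldr (fun v g => fun x => 'D_v g x) f vs.

(* C^infinity on A, for an open set A. *)
Definition smooth_on (A : set V) (f : V -> W) : Prop :=
  forall (vs : seq V) (x : V), A x ->
    {for x, continuous (iter_derive vs f)} /\
    forall v, derivable (iter_derive vs f) x v.

End smooth.

Section complex_valued.
Context {R : realType}.

Definition cexpi (t : R) : R[i] := cos t +i* sin t.

Definition csmooth_on (V : normedModType R) (A : set V) (f : V -> R[i]) : Prop :=
  smooth_on A (fun x => complex.Re (f x)) /\
  smooth_on A (fun x => complex.Im (f x)).

Definition cintegral d (T : measurableType d) (mu : {measure set T -> \bar R})
    (D : set T) (f : T -> R[i]) : R[i] :=
  (\int[mu]_(x in D) complex.Re (f x)) +i* (\int[mu]_(x in D) complex.Im (f x)).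

Definition cintegrable d (T : measurableType d) (mu : {measure set T -> \bar R})
    (D : set T) (f : T -> R[i]) : Prop :=
  mu.-integrable D (fun x => (complex.Re (f x))%:E) /\
  mu.-integrable D (fun x => (complex.Im (f x))%:E).

Definition ccvg_to (F : set_system R) (f : R -> R[i]) (l : R[i]) : Prop :=
  (complex.Re (f t) @[t --> F] --> complex.Re l) /\
  (complex.Im (f t) @[t --> F] --> complex.Im l).

(* C_0^infinity(A), extended by zero to the whole space. *)
Definition test_function (V : normedModType R) (A : set V) (f : V -> R[i]) : Prop :=
  csmooth_on setT f /\
  exists K : set V, [/\ compact K, K `<=` A & forall x, ~ K x -> f x = 0].

End complex_valued.

Section fourier_integral_operators.
Context {R : realType}.

Section phase_and_symbol.
Variables (nx ny N : nat) (X : set 'rV[R]_nx) (Y : set 'rV[R]_ny).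

Definition phase_function
    (phi : 'rV[R]_nx * 'rV[R]_ny * 'rV[R]_N -> R) : Prop :=
  [/\ smooth_on (X `*` Y `*` [set xi | xi != 0]) phi,
      (forall x y xi t, X x -> Y y -> xi != 0 -> 0 < t ->
         phi (x, y, t *: xi) = t * phi (x, y, xi)) &
      (forall x y xi, X x -> Y y -> xi != 0 ->
         exists v, 'D_v phi (x, y, xi) != 0)].

(* Symbols of order m and type rho = 1. Partial derivatives of order beta in
   (x, y) and alpha in xi are replaced by iterated directional derivatives
   along arbitrary vectors; by multilinearity this is the same condition. *)
Definition symbol (m : R)
    (a : 'rV[R]_nx * 'rV[R]_ny * 'rV[R]_N -> R[i]) : Prop :=
  csmooth_on (X `*` Y `*` setT) a /\
  forall K : set ('rV[R]_nx * 'rV[R]_ny), compact K -> K `<=` X `*` Y ->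
  forall (vs : seq ('rV[R]_nx * 'rV[R]_ny)) (ws : seq 'rV[R]_N),
  let dirs := [seq (v, 0) | v <- vs] ++ [seq (0, w) | w <- ws] in
  exists C : R, forall p xi, K p ->
    let bound := C * (1 + enorm xi) `^ (m - (size ws)%:R) in
    `|iter_derive dirs (fun z => complex.Re (a z)) (p, xi)| <= bound /\
    `|iter_derive dirs (fun z => complex.Im (a z)) (p, xi)| <= bound.

(* The Schwartz kernel of A on X x Y is the oscillatory integral
     int e^{i phi(x,y,xi)} a(x,y,xi) dxi,
   paired with f (x) g and regularized by an arbitrary cutoff chi(eps xi) with
   chi(0) = 1. For eps > 0 the integrand is bounded with bounded support, so
   that the order of integration is immaterial. *)
Definition has_oscillatory_kernel
    (A : ('rV[R]_nx -> R[i]) -> 'rV[R]_ny -> R[i])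
    (phi : 'rV[R]_nx * 'rV[R]_ny * 'rV[R]_N -> R)
    (a : 'rV[R]_nx * 'rV[R]_ny * 'rV[R]_N -> R[i]) : Prop :=
  forall f, test_function X f ->
    (forall K, compact K -> K `<=` Y -> cintegrable (lebesgue_rV R ny) K (A f)) /\
    forall g chi, test_function Y g ->
      test_function [set: 'rV[R]_N] chi -> chi 0 = 1 ->
      ccvg_to 0^'+
        (fun eps =>
          cintegral (lebesgue_rV R N) setT (fun xi =>
          cintegral (lebesgue_rV R ny) setT (fun y =>
          cintegral (lebesgue_rV R nx) setT (fun x =>
            cexpi (phi (x, y, xi)) * a (x, y, xi) * chi (eps *: xi)
              * f x * g y))))
        (cintegral (lebesgue_rV R ny) setT (fun y => A f y * g y)).

(* Elements are ((y, eta), (x, omega)). *)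
Definition canonical_relation
    (phi : 'rV[R]_nx * 'rV[R]_ny * 'rV[R]_N -> R) :
    set (('rV[R]_ny * 'rV[R]_ny) * ('rV[R]_nx * 'rV[R]_nx)) :=
  [set p | exists x y xi,
     let omega := - grad (fun z => phi (z, y, xi)) x in
     let eta := grad (fun z => phi (x, z, xi)) y in
     [/\ X x, Y y, xi != 0 & grad (fun z => phi (x, y, z)) xi = 0] /\
     [/\ omega != 0, eta != 0 & p = ((y, eta), (x, omega))]].

End phase_and_symbol.

(* X and Y are open sets; one phase and one amplitude are required to represent
   A on all of X x Y. *)
Definition is_FIO nx ny (X : set 'rV[R]_nx) (Y : set 'rV[R]_ny)
    (A : ('rV[R]_nx -> R[i]) -> 'rV[R]_ny -> R[i]) (order : R)
    (Lambda : set (('rV[R]_ny * 'rV[R]_ny) * ('rV[R]_nx * 'rV[R]_nx))) : Prop :=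
  exists (N : nat) (m : R)
      (phi : 'rV[R]_nx * 'rV[R]_ny * 'rV[R]_N -> R)
      (a : 'rV[R]_nx * 'rV[R]_ny * 'rV[R]_N -> R[i]),
    [/\ (0 < N)%N & order = m + N%:R / 2 - (nx + ny)%:R / 4] /\
    [/\ phase_function X Y phi, symbol X Y m a,
        has_oscillatory_kernel X Y A phi a & Lambda = canonical_relation X Y phi].

End fourier_integral_operators.

Section surfaces.
Context {R : realType}.

Definition dpar1 (psi : 'rV[R]_2 -> 'rV[R]_3) (u : 'rV[R]_2) : 'rV[R]_3 :=
  'D_(vec2 1 0) psi u.
Definition dpar2 (psi : 'rV[R]_2 -> 'rV[R]_3) (u : 'rV[R]_2) : 'rV[R]_3 :=
  'D_(vec2 0 1) psi u.

(* Local parameterizations psi : U -> S of an embedded surface S of R^3: smooth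
   injective immersions of an open set U of R^2. Since S has dimension 2, such a
   psi is a diffeomorphism onto an open subset of S. *)
Definition local_parameterization (S : set 'rV[R]_3) (U : set 'rV[R]_2)
    (psi : 'rV[R]_2 -> 'rV[R]_3) : Prop :=
  [/\ open U, smooth_on U psi,
      (forall u w, U u -> U w -> psi u = psi w -> u = w),
      (forall u, U u -> S (psi u)) &
      (forall u, U u -> crossp (dpar1 psi u) (dpar2 psi u) != 0)].

(* mu is the surface measure of the embedded surface S, as a measure on R^3.
   The local formula determines mu on S, which is covered by countably many
   parameterized pieces. *)
Definition is_surface_measure (S : set 'rV[R]_3)
    (mu : {measure set 'rV[R]_3 -> \bar R}) : Prop :=
  mu (~` S) = 0%E /\
  forall U psi, local_parameterization S U psi ->
  forall F : 'rV[R]_3 -> \bar R, measurable_fun setT F ->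
    (forall x, 0 <= F x)%E ->
    (\int[mu]_(x in psi @` U) F x =
     \int[lebesgue_rV R 2]_(u in U)
       (F (psi u) * (enorm (crossp (dpar1 psi u) (dpar2 psi u)))%:E))%E.

(* int_D delta(G(x)) F(x) dx, where mu is the surface measure of {G = 0}. *)
Definition delta_integral (mu : {measure set 'rV[R]_3 -> \bar R})
    (G : 'rV[R]_3 -> R) (D : set 'rV[R]_3) (F : 'rV[R]_3 -> R[i]) : R[i] :=
  cintegral mu (D `&` [set x | G x = 0])
    (fun x => F x * ((enorm (grad G x))^-1)%:C).

Definition sphere2 : set 'rV[R]_3 := [set t | enorm t = 1].

End surfaces.

Section cylinder_transform.
Context {R : realType}.

Definition shell (a b : R) : set 'rV[R]_3 := [set x | a < enorm x < b].

Definition alpha_of (eps : R) : R := 2 * eps / (1 - eps ^+ 2).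

Definition vmap (x : 'rV[R]_3) : 'rV[R]_3 :=
  (Num.sqrt (1 + 1 / enorm x ^+ 2) - 1 / enorm x) *: ((enorm x)^-1 *: x).

Definition hfun (s : R) (y theta : 'rV[R]_3) : R :=
  4 * enorm (crossp y theta) ^+ 2 / (1 - enorm y ^+ 2) ^+ 2 - s.

Definition cylinder_eq (s : R) (theta x : 'rV[R]_3) : R :=
  enorm x ^+ 2 - dotp x theta ^+ 2 - s.

(* sigma s theta is meant to be the surface measure of the cylinder
   {x | |x|^2 - (x . theta)^2 = s}. *)
Definition cylinder_transform
    (sigma : R -> 'rV[R]_3 -> {measure set 'rV[R]_3 -> \bar R})
    (eps1 eps2 : R) (f : 'rV[R]_3 -> R[i]) (s : R) (theta : 'rV[R]_3) : R[i] :=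
  delta_integral (sigma s theta) (cylinder_eq s theta)
    (shell (alpha_of eps1) (alpha_of eps2))
    (fun x => ((enorm (grad (fun y => hfun s y theta) (vmap x)))^-1)%:C * f x).

(* The coordinates (s, alpha, beta) on (0,1) x S^2 induced by a local
   parameterization theta : U -> S^2. *)
Definition coord_domain (U : set 'rV[R]_2) : set 'rV[R]_3 :=
  [set y | 0 < y 0 0 < 1 /\ U (vec2 (y 0 1) (y 0 2))].

Definition cylinder_transform_coord
    (sigma : R -> 'rV[R]_3 -> {measure set 'rV[R]_3 -> \bar R})
    (eps1 eps2 : R) (theta : 'rV[R]_2 -> 'rV[R]_3)
    (f : 'rV[R]_3 -> R[i]) (y : 'rV[R]_3) : R[i] :=
  cylinder_transform sigma eps1 eps2 f (y 0 0) (theta (vec2 (y 0 1) (y 0 2))).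

Definition cylinder_relation (eps1 eps2 : R) (U : set 'rV[R]_2)
    (theta : 'rV[R]_2 -> 'rV[R]_3) :
    set (('rV[R]_3 * 'rV[R]_3) * ('rV[R]_3 * 'rV[R]_3)) :=
  [set p | exists (s alpha beta sigma : R) (x : 'rV[R]_3),
     let t := theta (vec2 alpha beta) in
     let t_alpha := dpar1 theta (vec2 alpha beta) in
     let t_beta := dpar2 theta (vec2 alpha beta) in
     [/\ shell (alpha_of eps1) (alpha_of eps2) x, 0 < s < 1, sigma != 0,
         U (vec2 alpha beta) & enorm x ^+ 2 - dotp x t ^+ 2 - s = 0] /\
     p = ((vec3 s alpha beta,
           vec3 sigma (2 * sigma * dotp x t_alpha * dotp x t)
                      (2 * sigma * dotp x t_beta * dotp x t)),
          (x, (2 * sigma) *: (x - dotp x t *: t)))].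

End cylinder_transform.

(* Main.v *)
(* On the cylinder {|x|^2 - (x . theta)^2 = s} the weight is a product:
   1 / |grad h (v x)| = b(x) c(s) with b(x) = 1 / (2 (sqrt (1 + |x|^2) + 1)) and
   c(s) = 1 / sqrt (s (1 + s)).  Inserting delta(p) = (2 pi)^-1 int e^{i xi p} dxi,
   the kernel of the transform is formally an oscillatory integral in one frequency
   variable, with phase xi (|x|^2 - (x . theta)^2 - s) and amplitude
   b(x) c(s) / (2 pi) of order 0, whence the order 0 + 1/2 - 6/4 = -1.

   After pairing with f (x) g, two integrations by parts in s bound the integrand
   by C / (1 + xi^2), so that cutoffs can be removed by dominated convergence.
   Fourier inversion in s then evaluates the xi-integral for fixed x and theta, and
   the coarea formula
     int k(s) (int_{cylinder s} Phi / |grad|) ds = int Phi(x) k(|x|^2 - (x . theta)^2) dx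
   identifies the result.  Surface measures are accessible only through charts: a
   rational chart of the cylinder gives measurability and bounds in (s, theta); a
   chart as a graph over the last two coordinates, available when theta is not a
   pole +-e_1, reduces the coarea formula to one-variable substitutions.  As theta
   is an injective function of (alpha, beta), the poles only cost a null set. *)
Require Import Defs.
From mathcomp Require Import all_boot all_order all_algebra.
From mathcomp Require Import all_classical all_reals all_analysis.
From mathcomp Require Import measurable_realfun complex.
From mathcomp Require Import ring lra.
Set Implicit Arguments.
Unset Strict Implicit.
Unset Printing Implicit Defensive.
Import Order.TTheory GRing.Theory Num.Theory.
Import numFieldNormedType.Exports.
Local Open Scope classical_set_scope.
Local Open Scope ring_scope.

(** * Smooth functions *)

(** The map [vmap] is adapted to the weight: it carries the cylinder of parameter [s] into the zero
    set of [hfun s], and this is why the norm of the gradient of [hfun] factors there into a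
    function of [x] and a function of [s]. The factor in [x] joins the test function [f] and the
    factor in [s] joins [g]; the amplitude depends neither on the frequency nor on the direction, so
    that its symbol estimates are immediate. Neither chart of the cylinder does both jobs. The
    rational one lives on the whole plane for every axis, and its area element divided by the norm
    of the gradient is the integrable [(1 + v1^2)^-1], the same for all [s] and all axes; but in it
    the coarea formula would be a change of variables in three dimensions. In the graph chart the
    last two coordinates are those of [x] itself, so that only [x0] is exchanged for [s]; the price
    is a density that is singular where the two sheets meet. The analysis is done for real
    functions: a shift [d] of the phase of a cosine covers both parts of the exponential, and
    complex products are expanded into real ones only at the end. *)

Section smoothness.
Context {R : realType}.

(** In [iter_derive] a new direction acts outermost, whereas the rules for sums, products and
    composites differentiate the given function, that is innermost. Recursing on ['D_v f] turns each
    of those rules into an induction on [n] over all functions. Continuity is carried along because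
    derivability in every direction does not imply it. *)
Fixpoint Cn (V W : normedModType R) (n : nat) (A : set V) (f : V -> W) : Prop :=
  if n is k.+1 then
    (forall x, A x -> {for x, continuous f} /\ forall v, derivable f x v) /\
    forall v, Cn k A ('D_v f)
  else forall x, A x -> {for x, continuous f}.

Lemma iter_derive_rcons (V W : normedModType R) vs v (f : V -> W) :
  iter_derive (rcons vs v) f = iter_derive vs ('D_v f).
Proof. by rewrite /iter_derive -cats1 foldr_cat. Qed.

Lemma smooth_onP (V W : normedModType R) (A : set V) (f : V -> W) :
  smooth_on A f <-> forall n, Cn n A f.
Proof.
split=> [sf n|].
  elim: n f sf => [|n IH] f sf /=; first by move=> x /(sf [::])[].
  split; first by move=> x /(sf [::]).
  by move=> v; apply: IH => vs x Ax; rewrite -iter_derive_rcons; exact: sf.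
move=> + vs; elim/last_ind: vs f => [|vs v IH] f Cf x Ax.
  by have [/(_ _ Ax)] := Cf 1%N.
rewrite iter_derive_rcons; apply: IH => // n.
by have [_] := Cf n.+1; exact.
Qed.

Lemma Cn_cts (V W : normedModType R) n (A : set V) (f : V -> W) x :
  Cn n A f -> A x -> {for x, continuous f}.
Proof. by case: n => [|n] /=; [exact|move=> [+ _] => /[apply] -[]]. Qed.

Lemma CnW (V W : normedModType R) n (A : set V) (f : V -> W) :
  Cn n.+1 A f -> Cn n A f.
Proof.
elim: n f => [|n IH] f; first by move=> [+ _] x Ax => /(_ _ Ax)[].
by move=> [cf df]; split=> // v; apply/IH/df.
Qed.

Lemma near_eq_open (V : normedModType R) (W : Type) (A : set V) (f g : V -> W) x :
  open A -> A x -> {in A, f =1 g} -> {near x, f =1 g}.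
Proof.
move=> oA Ax fg; near=> z; apply/fg/mem_set.
by near: z; exact: open_nbhs_nbhs.
Unshelve. all: by end_near. Qed.

Lemma near_eq_cts (V W : normedModType R) (f g : V -> W) x :
  {near x, f =1 g} -> {for x, continuous f} -> {for x, continuous g}.
Proof.
move=> fg; rewrite /prop_for /continuous_at -(nbhs_singleton fg).
by apply: cvg_trans; exact: near_eq_cvg.
Qed.

(** Differentiation rules are identities on [A] only. Since [A] is open, derivatives at its points
    see only values taken in [A], so such an identity may replace the function under [Cn]. *)
Lemma eq_Cn (V W : normedModType R) n (A : set V) (f g : V -> W) :
  open A -> {in A, f =1 g} -> Cn n A f -> Cn n A g.
Proof.
move=> oA; elim: n f g => [|n IH] f g fg /=.
  by move=> cf x Ax; apply: (near_eq_cts (near_eq_open oA Ax fg)); exact: cf.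
move=> [cf df]; split.
  move=> x Ax; have nfg := near_eq_open oA Ax fg.
  have [cfx dfx] := cf x Ax; split; first exact: (near_eq_cts nfg).
  by move=> v; exact: (near_eq_derivable nfg).
move=> v; apply: IH (df v) => x /[!inE] Ax; exact: near_eq_derive (near_eq_open oA Ax fg).
Qed.

Lemma eq_smooth_on (V W : normedModType R) (A : set V) (f g : V -> W) :
  open A -> {in A, f =1 g} -> smooth_on A f -> smooth_on A g.
Proof.
by move=> oA fg /smooth_onP sf; apply/smooth_onP => n; exact: eq_Cn (sf n).
Qed.

Lemma sub_smooth_on (V W : normedModType R) (A B : set V) (f : V -> W) :
  A `<=` B -> smooth_on B f -> smooth_on A f.
Proof. by move=> AB sf vs x /AB; exact: sf. Qed.

Lemma smooth_on_cts (V W : normedModType R) (A : set V) (f : V -> W) x :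
  smooth_on A f -> A x -> {for x, continuous f}.
Proof. by move=> /(_ [::] x) sf /sf[]. Qed.

Lemma smooth_on_derivable (V W : normedModType R) (A : set V) (f : V -> W) x v :
  smooth_on A f -> A x -> derivable f x v.
Proof. by move=> /(_ [::] x) sf /sf[_]; exact. Qed.

Lemma smooth_on_derive (V W : normedModType R) (A : set V) (f : V -> W) v :
  smooth_on A f -> smooth_on A ('D_v f).
Proof.
by move=> /smooth_onP sf; apply/smooth_onP => n; have [_] := sf n.+1; exact.
Qed.

Lemma derive_cstE (V W : normedModType R) (c : W) v : 'D_v (cst c : V -> W) = cst 0.
Proof. by apply/funext => x; rewrite derive_cst. Qed.

Lemma smooth_on_cst (V W : normedModType R) (A : set V) (c : W) :
  smooth_on A (cst c).
Proof.
apply/smooth_onP => n; elim: n c => [|n IH] c /=.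
  by move=> x _; exact: cst_continuous.
split; first by move=> x _; split=> [|v]; [exact: cst_continuous|exact: derivable_cst].
by move=> v; rewrite derive_cstE; exact: IH.
Qed.

(** The difference quotient is constant. Only the line through [x] along [v] matters, so this also
    serves for maps that are nonlinear elsewhere, such as the phase in the direction of [s]. *)
Lemma is_derive_affine (V W : normedModType R) (f : V -> W) (l : W) x v :
  (forall t : R, f (t *: v + x) = t *: l + f x) -> is_derive x v f l.
Proof.
move=> fl.
have cvl : h^-1 *: ((f \o shift x) (h *: v) - f x) @[h --> (0 : R)^'] --> l.
  apply: (@cvg_trans _ ((cst l : R -> W) @ (0 : R)^')); last exact: cvg_cst.
  apply: near_eq_cvg; near=> h; rewrite /= fl addrK scalerA mulVf ?scale1r//.
  by near: h; exact: nbhs_dnbhs_neq.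
split; first by apply/cvg_ex; exists l.
exact: cvg_lim cvl.
Unshelve. all: by end_near. Qed.

Lemma smooth_on_affine (V W : normedModType R) (A : set V) (f : V -> W)
    (l : V -> W) : continuous f ->
  (forall x v (t : R), f (t *: v + x) = t *: l v + f x) -> smooth_on A f.
Proof.
move=> cf fl; have Df x v := is_derive_affine (fl x v).
apply/smooth_onP => -[|n] /=; first by move=> x _; exact: cf.
split; first by move=> x _; split=> [|v]; [exact: cf|exact: (@ex_derive _ _ _ _ _ _ _ (Df x v))].
move=> v; have -> : 'D_v f = cst (l v) by apply/funext => x; rewrite derive_val.
by have /smooth_onP := @smooth_on_cst V W A (l v); exact.
Qed.

Lemma is_derive_comp_lin (V V' W : normedModType R) (L : V' -> V)
    (f : V -> W) x v df :
  (forall (t : R) y z, L (t *: y + z) = t *: L y + L z) ->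
  is_derive (L x) (L v) f df -> is_derive x v (f \o L) df.
Proof.
move=> LP [fx <-]; suff E : (fun h : R => h^-1 *: (((f \o L) \o shift x) (h *: v) - (f \o L) x))
   = (fun h : R => h^-1 *: ((f \o shift (L x)) (h *: L v) - f (L x))).
  by split; rewrite /derivable /derive E.
by apply/funext => h /=; rewrite LP.
Qed.

(** Both sides are limits of the very same difference quotient, so the identity holds at every
    point, differentiable or not, and iterated derivatives can be rewritten as functions on the
    whole space. *)
Lemma derive_comp_lin (V V' W : normedModType R) (L : V' -> V)
    (f : V -> W) x v :
  (forall (t : R) y z, L (t *: y + z) = t *: L y + L z) ->
  'D_v (f \o L) x = 'D_(L v) f (L x).
Proof.
move=> LP; rewrite /derive; set F := (X in lim (X @ _)); set G := (X in _ = lim (X @ _)).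
suff -> : F = G by [].
by apply/funext => h; rewrite /F /G /= LP.
Qed.

Lemma smooth_on_comp_lin (V V' W : normedModType R) (A : set V) (A' : set V')
    (L : V' -> V) (f : V -> W) :
  (forall (t : R) y z, L (t *: y + z) = t *: L y + L z) -> continuous L -> (forall x, A' x -> A (L x)) ->
  smooth_on A f -> smooth_on A' (f \o L).
Proof.
move=> LP cL AA' /smooth_onP sf; apply/smooth_onP => n.
elim: n f sf => [|n IH] f sf /=.
  move=> x A'x; apply: continuous_comp; first exact: cL.
  by apply: (Cn_cts (sf 0%N)); exact: AA'.
split.
  move=> x /AA' ALx; have [/(_ _ ALx)[cf df] _] := sf 1%N; split.
    by apply: continuous_comp => //; exact: cL.
  by move=> v; have [] := is_derive_comp_lin LP (derivableP (df (L v))).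
move=> v; have -> : 'D_v (f \o L) = 'D_(L v) f \o L.
  by apply/funext => x; exact: derive_comp_lin.
by apply: IH => k; have [_] := sf k.+1; exact.
Qed.

Lemma CnD (V W : normedModType R) n (A : set V) (f g : V -> W) : open A ->
  Cn n A f -> Cn n A g -> Cn n A (fun x => f x + g x).
Proof.
move=> oA; elim: n f g => [|n IH] f g /=.
  by move=> cf cg x Ax; apply: continuousD; [exact: cf|exact: cg].
move=> [cf df] [cg dg]; split.
  move=> x Ax; have [? ?] := cf x Ax; have [? ?] := cg x Ax.
  by split=> [|v]; [exact: continuousD|exact: derivableD].
move=> v; apply: (@eq_Cn _ _ _ _ (fun x => 'D_v f x + 'D_v g x)) => //.
  move=> x /[!inE] Ax; have [_ fx] := cf x Ax; have [_ gx] := cg x Ax.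
  by rewrite -deriveD.
by apply: IH; [exact: df|exact: dg].
Qed.

Lemma CnM (V : normedModType R) n (A : set V) (f g : V -> R) : open A ->
  Cn n A f -> Cn n A g -> Cn n A (fun x => f x * g x).
Proof.
move=> oA; elim: n f g => [|n IH] f g.
  by move=> cf cg x Ax; apply: (@continuousM _ _ f g); [exact: cf|exact: cg].
move=> Cf Cg; have [/= cf df] := Cf; have [/= cg dg] := Cg; split.
  move=> x Ax; have [? ?] := cf x Ax; have [? ?] := cg x Ax.
  by split=> [|v]; [exact: (@continuousM _ _ f g)|exact: (@derivableM _ _ f g)].
move=> v; apply: (@eq_Cn _ _ _ _ (fun x => f x * 'D_v g x + g x * 'D_v f x)) => //.
  move=> x /[!inE] Ax; have [_ fx] := cf x Ax; have [_ gx] := cg x Ax.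
  by rewrite (@deriveM _ _ f g).
apply: CnD => //.
  by apply: IH; [exact: CnW Cf|exact: dg].
by apply: IH; [exact: CnW Cg|exact: df].
Qed.

Lemma smooth_onD (V W : normedModType R) (A : set V) (f g : V -> W) : open A ->
  smooth_on A f -> smooth_on A g -> smooth_on A (fun x => f x + g x).
Proof.
by move=> oA /smooth_onP sf /smooth_onP sg; apply/smooth_onP => n; exact: CnD.
Qed.

Lemma smooth_onM (V : normedModType R) (A : set V) (f g : V -> R) : open A ->
  smooth_on A f -> smooth_on A g -> smooth_on A (fun x => f x * g x).
Proof.
by move=> oA /smooth_onP sf /smooth_onP sg; apply/smooth_onP => n; exact: CnM.
Qed.

Lemma smooth_on_sum (V W : normedModType R) (A : set V) (I : Type) (s : seq I)
    (f : I -> V -> W) : open A ->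
  (forall i, smooth_on A (f i)) -> smooth_on A (fun x => \sum_(i <- s) f i x).
Proof.
move=> oA sf; elim: s => [|i s IH].
  rewrite (_ : (fun _ => _) = cst 0); first exact: smooth_on_cst.
  by apply/funext => x; rewrite big_nil.
rewrite (_ : (fun _ => _) = fun x => f i x + \sum_(i <- s) f i x).
  exact: smooth_onD.
by apply/funext => x; rewrite big_cons.
Qed.

(** Restricting [f] to the line through [x] along [v] gives a function [k] of one variable, to which
    the one-dimensional chain rule applies. *)
Lemma is_derive_comp1 (V : normedModType R) (h : R -> R) (f : V -> R) x v dh df :
  is_derive (f x) 1 h dh -> is_derive x v f df ->
  is_derive x v (h \o f) (dh * df).
Proof.
move=> hP [fx <-].
pose k t := f (t *: v + x).
have k0 : k 0 = f x by rewrite /k scale0r add0r.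
have Dk : is_derive (0 : R) 1 k ('D_v f x).
  split; first exact: (iffLR (derivable1P f x v) fx).
  rewrite /derive; set F := (X in lim (X @ _)); set G := (X in _ = lim (X @ _)).
  suff -> : F = G by [].
  by apply/funext => t; rewrite /F /G /k /= addr0 scale0r add0r [_%:A]mulr1.
have hk : is_derive (0 : R) 1 (h \o k) (dh * 'D_v f x).
  by apply: is_derive1_comp; rewrite k0.
have [ex val] := hk; split; first exact: (iffRL (derivable1P (h \o f) x v) ex).
rewrite -val /derive; set F := (X in lim (X @ _)); set G := (X in _ = lim (X @ _)).
suff -> : F = G by [].
by apply/funext => t; rewrite /F /G /k /= addr0 scale0r add0r [_%:A]mulr1.
Qed.

Lemma smooth_on_comp1 (V : normedModType R) (A : set V) (B : set R) (h : R -> R)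
    (f : V -> R) : open A -> open B -> (forall x, A x -> B (f x)) ->
  smooth_on B h -> smooth_on A f -> smooth_on A (h \o f).
Proof.
move=> oA oB AB sh sf; apply/smooth_onP => n; elim: n h sh => [|n IH] h sh.
  move=> x Ax; apply: continuous_comp; first exact: smooth_on_cts Ax.
  by apply: smooth_on_cts sh _; exact: AB.
have D x v : A x -> is_derive x v (h \o f) ('D_1 h (f x) * 'D_v f x).
  move=> Ax; apply: is_derive_comp1; apply/derivableP.
    by apply: smooth_on_derivable sh _; exact: AB.
  exact: smooth_on_derivable sf Ax.
split.
  move=> x Ax; split=> [|v]; last by have [] := D x v Ax.
  apply: continuous_comp; first exact: smooth_on_cts Ax.
  by apply: smooth_on_cts sh _; exact: AB.
move=> v; apply: (@eq_Cn _ _ _ _ (fun x => ('D_1 h \o f) x * 'D_v f x)) => //.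
  by move=> x /[!inE] Ax; have [_ ->] := D x v Ax.
apply: CnM => //; last by have /smooth_onP := smooth_on_derive v sf; exact.
by apply: IH; exact: smooth_on_derive.
Qed.

Lemma is_derive_lin_comp (V W W' : normedModType R) (L : W -> W')
    (f : V -> W) x v df :
  (forall (t : R) y z, L (t *: y + z) = t *: L y + L z) -> continuous L ->
  is_derive x v f df -> is_derive x v (L \o f) (L df).
Proof.
move=> LP cL [fx <-].
have L0 : L 0 = 0 by have := LP (-1) 0 0; rewrite scaler0 addr0 scaleN1r addNr.
have LB a b : L (a - b) = L a - L b.
  by rewrite addrC -scaleN1r LP scaleN1r addrC.
have LZ (t : R) a : L (t *: a) = t *: L a by rewrite -[t *: a]addr0 LP L0 addr0.
have cv : h^-1 *: (((L \o f) \o shift x) (h *: v) - (L \o f) x) @[h --> (0 : R)^']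
    --> L ('D_v f x).
  under eq_fun do rewrite /= -LB -LZ.
  exact: (@cvg_comp _ _ _ (fun h : R => h^-1 *: ((f \o shift x) (h *: v) - f x)) L
    _ (nbhs ('D_v f x)) _ fx (cL _)).
split; first by apply/cvg_ex; exists (L ('D_v f x)).
exact: cvg_lim cv.
Qed.

Lemma smooth_on_lin_comp (V W W' : normedModType R) (A : set V) (L : W -> W')
    (f : V -> W) :
  (forall (t : R) y z, L (t *: y + z) = t *: L y + L z) -> continuous L ->
  open A -> smooth_on A f -> smooth_on A (L \o f).
Proof.
move=> LP cL oA sf; apply/smooth_onP => n; elim: n f sf => [|n IH] f sf.
  by move=> x Ax; apply: continuous_comp; [exact: smooth_on_cts sf Ax|exact: cL].
split.
  move=> x Ax; split; first by apply: continuous_comp; [exact: smooth_on_cts sf Ax|exact: cL].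
  by move=> v; case: (is_derive_lin_comp LP cL (derivableP (@smooth_on_derivable _ _ _ _ _ v sf Ax))).
move=> v; apply: (@eq_Cn _ _ _ _ (L \o 'D_v f)) => //.
  move=> x /[!inE] Ax.
  by case: (is_derive_lin_comp LP cL (derivableP (@smooth_on_derivable _ _ _ _ _ v sf Ax))).
exact: IH (smooth_on_derive v sf).
Qed.

Lemma continuous_coord m n (i : 'I_m) (j : 'I_n) : continuous (fun M : 'M[R]_(m, n) => M i j).
Proof. by move=> M; exact: coord_continuous. Qed.

Lemma smooth_on_coord n (A : set 'rV[R]_n) (i : 'I_1) (j : 'I_n) :
  smooth_on A (fun x : 'rV[R]_n => x i j).
Proof.
apply: (@smooth_on_affine 'rV[R]_n R A _ (fun v => v i j)).
  exact: continuous_coord.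
by move=> x v t; rewrite !mxE.
Qed.

Lemma smooth_on_coord_comp (V : normedModType R) n (A : set V) (f : V -> 'rV[R]_n)
    (i : 'I_1) (j : 'I_n) : open A ->
  smooth_on A f -> smooth_on A (fun x => f x i j).
Proof.
apply: (@smooth_on_lin_comp _ _ _ _ (fun x : 'rV[R]_n => x i j)).
- by move=> t y z; rewrite !mxE.
- exact: continuous_coord.
Qed.

Lemma smooth_on_rV (V : normedModType R) n (A : set V) (f : V -> 'rV[R]_n) :
  open A -> (forall i, smooth_on A (fun x => f x 0 i)) -> smooth_on A f.
Proof.
move=> oA sf; rewrite (_ : f = fun x => \sum_(i < n) f x 0 i *: delta_mx 0 i); last first.
  by apply/funext => x; rewrite -row_sum_delta.
apply: smooth_on_sum => // i.
apply: (@smooth_on_lin_comp _ _ _ _ (fun a : R => a *: (delta_mx 0 i : 'rV[R]_n)) _ _ _ oA (sf i)).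
- by move=> t y z; rewrite scalerDl scalerA.
- by move=> a; exact: scalel_continuous.
Qed.

Lemma smooth_onZ (V : normedModType R) (A : set V) (k : R) (f : V -> R) : open A ->
  smooth_on A f -> smooth_on A (fun x => k * f x).
Proof. move=> oA sf; exact (smooth_onM oA (@smooth_on_cst V R A k) sf). Qed.

Lemma smooth_onN (V : normedModType R) (A : set V) (f : V -> R) : open A ->
  smooth_on A f -> smooth_on A (fun x => - f x).
Proof.
move=> oA sf; rewrite (_ : (fun x => _) = fun x => -1 * f x).
  exact (smooth_onZ (-1) oA sf).
by apply/funext => x; rewrite mulN1r.
Qed.

Lemma smooth_onB (V : normedModType R) (A : set V) (f g : V -> R) : open A ->
  smooth_on A f -> smooth_on A g -> smooth_on A (fun x => f x - g x).
Proof. move=> oA sf sg; exact (smooth_onD oA sf (smooth_onN oA sg)). Qed.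

Lemma smooth_onX (V : normedModType R) (A : set V) (n : nat) (f : V -> R) : open A ->
  smooth_on A f -> smooth_on A (fun x => f x ^+ n).
Proof.
move=> oA sf; elim: n => [|n IH].
  exact (@smooth_on_cst V R A 1).
rewrite (_ : (fun x => _) = fun x => f x * f x ^+ n).
  exact (smooth_onM oA sf IH).
by apply/funext => x; rewrite exprS.
Qed.

Lemma open_pos : open [set x : R | 0 < x].
Proof. exact: open_gt. Qed.

(** Powers are stable under differentiation up to a constant factor, so the induction runs over all
    exponents at once. Inverses and square roots are the exponents [-1] and [2^-1]. *)
Lemma smooth_on_powR (a : R) : smooth_on [set x : R | 0 < x] (fun x => x `^ a).
Proof.
apply/smooth_onP => n; elim: n a => [|n IH] a.
  move=> x x0; apply/differentiable_continuous/derivable1_diffP.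
  exact: (@ex_derive _ _ _ _ _ _ _ (is_derive1_powR a x0)).
have D (x v : R) : 0 < x -> is_derive x v (fun x => x `^ a) (v * (a * x `^ (a - 1))).
  move=> x0; have := @is_derive_comp1 R (fun x => x `^ a) id x v _ v (is_derive1_powR a x0) (is_derive_id _ _).
  by rewrite mulrC; exact.
split.
  move=> x x0; split; last by move=> v; case: (D x v x0).
  apply/differentiable_continuous/derivable1_diffP.
  exact: (@ex_derive _ _ _ _ _ _ _ (is_derive1_powR a x0)).
move=> v; apply: (@eq_Cn _ _ _ _ (fun x : R => v * (a * x `^ (a - 1)))).
- exact open_pos.
- by move=> x /[!inE] x0; case: (D x v x0).
- have Ck (k : R) (f : R -> R) m : Cn m [set x : R | 0 < x] f -> Cn m [set x : R | 0 < x] (fun x => k * f x).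
    move=> Cf; apply: (@CnM _ _ _ (cst k) f); [exact open_pos| |exact Cf].
    by have /smooth_onP := @smooth_on_cst R R [set x : R | 0 < x] k; exact.
  by apply: (Ck v (fun x => a * x `^ (a - 1))); apply: (Ck a (fun x => x `^ (a - 1))); exact: IH.
Qed.

Lemma smooth_on_powR_comp (V : normedModType R) (A : set V) (f : V -> R) (a : R) :
  open A -> (forall x, A x -> 0 < f x) -> smooth_on A f ->
  smooth_on A (fun x => f x `^ a).
Proof.
move=> oA f0 sf.
exact: (smooth_on_comp1 oA open_pos f0 (smooth_on_powR a) sf).
Qed.

Lemma smooth_onV (V : normedModType R) (A : set V) (f : V -> R) :
  open A -> (forall x, A x -> 0 < f x) -> smooth_on A f ->
  smooth_on A (fun x => (f x)^-1).
Proof.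
move=> oA f0 sf; apply: (eq_smooth_on oA _ (smooth_on_powR_comp (-1) oA f0 sf)).
by move=> x /[!inE] Ax; rewrite powRN powRr1 ?ltW ?f0.
Qed.

Lemma smooth_on_sqrt (V : normedModType R) (A : set V) (f : V -> R) :
  open A -> (forall x, A x -> 0 < f x) -> smooth_on A f ->
  smooth_on A (fun x => Num.sqrt (f x)).
Proof.
move=> oA f0 sf; apply: (eq_smooth_on oA _ (smooth_on_powR_comp 2^-1 oA f0 sf)).
by move=> x /[!inE] Ax; rewrite powR12_sqrt// ltW ?f0.
Qed.

End smoothness.

(** * Product integrals and Lebesgue measure on row vectors *)

Section integrable_EFin.
Context d (T : measurableType d) (R : realType) (m : {measure set T -> \bar R}).

Lemma integrable_EFinZl (D : set T) (f : T -> R) (k : R) : measurable D ->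
  m.-integrable D (EFin \o f) -> m.-integrable D (fun x => (k * f x)%:E).
Proof.
move=> mD fi; have := integrableZl mD k fi.
by apply: eq_integrable => // x _; rewrite /= EFinM.
Qed.

Lemma integrable_EFinZr (D : set T) (f : T -> R) (k : R) : measurable D ->
  m.-integrable D (EFin \o f) -> m.-integrable D (fun x => (f x * k)%:E).
Proof.
move=> mD fi; have := integrable_EFinZl k mD fi.
by apply: eq_integrable => // x _; rewrite /= mulrC.
Qed.

End integrable_EFin.

(** * Fubini's theorem under a majorant in product form *)

Section fubini_majorant.
Context d1 d2 (T1 : measurableType d1) (T2 : measurableType d2) (R : realType).
Variables (m1 : {sigma_finite_measure set T1 -> \bar R})
  (m2 : {sigma_finite_measure set T2 -> \bar R}).

(** Tonelli's theorem gives the measurability of the integrals of the positive and of the negative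
    part, whether finite or not, and [fine] is measurable. *)
Lemma measurable_Rintegral_snd (h : T1 * T2 -> R) : measurable_fun setT h ->
  measurable_fun setT (fun x => \int[m2]_y h (x, y)).
Proof.
move=> mh; have mH : measurable_fun setT (EFin \o h) by exact/measurable_EFinP.
apply: (measurableT_comp (fine_measurable measurableT)).
rewrite (_ : (fun x => _) = (fun x => (\int[m2]_y (EFin \o h)^\+ (x, y))%E -
    \int[m2]_y (EFin \o h)^\- (x, y))%E); last first.
  apply/funext => x; rewrite [LHS]integralE.
  by congr (_ - _)%E; apply: eq_integral => y _; rewrite ?funeposE ?funenegE.
apply: emeasurable_funB.
  apply: (measurable_fun_fubini_tonelli_F ((EFin \o h)^\+)%E) => //.
  exact: measurable_funepos.
apply: (measurable_fun_fubini_tonelli_F ((EFin \o h)^\-)%E) => //.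
exact: measurable_funeneg.
Qed.

Variables (h : T1 * T2 -> R) (h1 : T1 -> R) (h2 : T2 -> R).
Hypotheses (mh : measurable_fun setT h)
  (ih1 : m1.-integrable setT (EFin \o h1)) (ih2 : m2.-integrable setT (EFin \o h2))
  (hh : forall x y, `|h (x, y)| <= h1 x * h2 y).

Lemma majorant_integrable_snd x : m2.-integrable setT (fun y => (h (x, y))%:E).
Proof.
apply: (@le_integrable _ _ _ m2 setT measurableT _ (fun y => ((h1 x) * (h2 y))%:E)) => //.
- by apply/measurable_EFinP; apply: measurableT_comp => //; exact: pair1_measurable.
- by move=> y _; rewrite /= lee_fin (le_trans (hh x y))// ler_norm.
- exact: integrable_EFinZl.
Qed.

Lemma majorant_Rintegral_le x :
  `|\int[m2]_y h (x, y)| <= h1 x * \int[m2]_y h2 y.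
Proof.
rewrite -RintegralZl//; apply: (le_trans (le_normr_Rintegral _ _)) => //.
  exact: majorant_integrable_snd.
apply: le_Rintegral => //.
  have := majorant_integrable_snd x => /integrable_abse.
  by apply: eq_integrable.
exact: integrable_EFinZl.
Qed.

Lemma majorant_integrable_Rintegral :
  m1.-integrable setT (fun x => (\int[m2]_y h (x, y))%:E).
Proof.
apply: (@le_integrable _ _ _ m1 setT measurableT _
  (fun x => (h1 x * \int[m2]_y h2 y)%:E)) => //.
- exact/measurable_EFinP/measurable_Rintegral_snd.
- by move=> x _; rewrite /= lee_fin (le_trans (majorant_Rintegral_le x))// ler_norm.
- exact: integrable_EFinZr.
Qed.

(** Only the product [h1 x * h2 y] is known to be nonnegative, the factors may both be negative;
    hence the passage to absolute values before the double integral is separated by Tonelli. *)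
Lemma majorant_integrable_prod : (m1 \x m2)%E.-integrable setT (EFin \o h).
Proof.
apply/integrable12ltyP; first exact/measurable_EFinP.
have i1 := integrable_abse ih1; have i2 := integrable_abse ih2.
apply: (@le_lt_trans _ _ (\int[m1]_x (`|h1 x| * \int[m2]_y `|h2 y|)%:E)%E).
  apply: ge0_le_integral => //.
  - by move=> x _; exact: integral_ge0.
  - apply: (measurable_fun_fubini_tonelli_F (abse \o EFin \o h)) => //.
      by apply: measurableT_comp => //; exact/measurable_EFinP.
    by move=> x /=.
  - apply/measurable_EFinP; apply: measurable_funM => //.
    by apply: measurableT_comp => //; exact/measurable_EFinP/(measurable_int _ ih1).
  - move=> x _; rewrite EFinM /Rintegral fineK; last exact: (integrable_fin_num measurableT i2).
    rewrite -ge0_integralZl//; last by apply: (measurable_int _ i2).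
    apply: ge0_le_integral => //.
    + apply: measurableT_comp => //; apply/measurable_EFinP.
      by apply: measurableT_comp => //; exact: pair1_measurable.
    + by apply: emeasurable_funM => //; exact: (measurable_int _ i2).
    + move=> y _; rewrite /= lee_fin (le_trans (hh x y))//.
      by rewrite -normrM ler_norm.
rewrite (_ : (fun x => _) = (fun x => (\int[m2]_y `|h2 y|)%:E * `|(h1 x)%:E|)%E).
  rewrite ge0_integralZl//; last 2 first.
  - exact: (measurable_int _ i1).
  - by rewrite lee_fin Rintegral_ge0.
  by rewrite lte_mul_pinfty// ?lee_fin ?Rintegral_ge0//; case/integrableP: ih1.
by apply/funext => x; rewrite EFinM muleC.
Qed.

End fubini_majorant.

Section fubini_Rintegral.
Context d1 d2 (T1 : measurableType d1) (T2 : measurableType d2) (R : realType).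
Variables (m1 : {sigma_finite_measure set T1 -> \bar R})
  (m2 : {sigma_finite_measure set T2 -> \bar R}).

Lemma measurable_swapE (h : T1 * T2 -> R) : measurable_fun setT h ->
  measurable_fun setT (fun z : T2 * T1 => h (z.2, z.1)).
Proof. by move=> mh; apply: measurableT_comp mh _; exact: measurable_swap. Qed.

Lemma Rintegral_fubini (h : T1 * T2 -> R) (h1 : T1 -> R) (h2 : T2 -> R) :
  measurable_fun setT h ->
  m1.-integrable setT (EFin \o h1) -> m2.-integrable setT (EFin \o h2) ->
  (forall x y, `|h (x, y)| <= h1 x * h2 y) ->
  \int[m1]_x \int[m2]_y h (x, y) = \int[m2]_y \int[m1]_x h (x, y).
Proof.
move=> mh ih1 ih2 hh.
have := @Fubini _ _ _ _ _ m1 m2 (EFin \o h) (majorant_integrable_prod mh ih1 ih2 hh).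
rewrite {1 3}/Rintegral => E; congr fine; rewrite [in LHS]/Rintegral.
transitivity (\int[m1]_x \int[m2]_y (EFin \o h) (x, y))%E.
  apply: eq_integral => x _; rewrite /= fineK//.
  apply: (integrable_fin_num measurableT).
  exact (majorant_integrable_snd mh ih2 hh x).
rewrite E; apply: eq_integral => y _; rewrite /Rintegral fineK//.
apply: (integrable_fin_num measurableT).
apply: (majorant_integrable_snd (measurable_swapE mh) ih1) => ? ? /=.
by rewrite mulrC; exact: hh.
Qed.

End fubini_Rintegral.

(** * Borel sets, iterated integrals and boxes in the space of row vectors *)

Section measurable_rV_theory.
Context {R : realType}.

Lemma measurable_coord n (i : 'I_n) (j : 'I_1) :
  measurable_fun [set: 'rV[R]_n] (fun x => x j i).
Proof. rewrite (ord1 j); exact: measurable_rV_coord. Qed.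

Lemma rV_ball_measurable n (c : 'rV[R]_n) (r : R) : measurable (ball c r).
Proof.
case: (ltP 0 r) => r0; last first.
  rewrite (_ : ball c r = set0); first exact: measurable0.
  by apply/seteqP; split=> y // -[]; rewrite ltNge r0.
rewrite (_ : ball c r = \bigcap_(i in [set: 'I_n]) [set y | `|c 0 i - y 0 i| < r]).
  apply: fin_bigcap_measurable => // i _.
  change (measurable [set y : 'rV[R]_n | `|c 0 i - y 0 i| < r]).
  rewrite (_ : [set _ | _] = setT `&` (fun y : 'rV[R]_n => `|c 0 i - y 0 i|) @^-1` `]-oo, r[%classic); last first.
    by rewrite setTI; apply/seteqP; split=> y; rewrite /= in_itv.
  have : measurable_fun setT (fun y : 'rV[R]_n => `|c 0 i - y 0 i|).
    apply: measurableT_comp => //; apply: measurable_funB => //.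
    exact: measurable_coord.
  by apply.
apply/seteqP; split=> y; first by move=> [_ H] i _; exact: H.
by move=> H; split => // i j; rewrite (ord1 i); exact: H.
Qed.

(** The sigma-algebra was generated by the coordinates. It contains the open sets because an open
    set is the countable union of those max-norm balls with rational centre and radius [(k + 1)^-1]
    that it contains. *)
Lemma open_rV_measurable n (A : set 'rV[R]_n) : open A -> measurable A.
Proof.
move=> oA; pose B (qk : 'rV[rat]_n * nat) : set 'rV[R]_n :=
  ball (map_mx ratr qk.1 : 'rV[R]_n) (qk.2.+1%:R^-1 : R).
rewrite (_ : A = \bigcup_qk (if `[< B qk `<=` A >] then B qk else set0)).
  apply: countable_bigcupT_measurable => // qk.
  by case: ifP => // _; exact: rV_ball_measurable.
apply/seteqP; split=> [x Ax|x [qk _]]; last by case: ifPn => // /asboolP; exact.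
have /nbhs_ballP[r /= r0 xrA] : nbhs x A by exact: open_nbhs_nbhs.
have [k kr] : exists k : nat, k.+1%:R^-1 < r / 2.
  have r20 : 0 < r / 2 by rewrite divr_gt0.
  have [k _ /(_ k (leqnn k))] := near_infty_natSinv_lt (PosNum r20).
  by exists k.
have k0 : 0 < k.+1%:R^-1 :> R by rewrite invr_gt0.
have qP i : exists q : rat, `|ratr q - x 0 i| < k.+1%:R^-1.
  have : x 0 i - k.+1%:R^-1 < x 0 i + k.+1%:R^-1 by rewrite ltrD2l gtrN.
  move=> /rat_in_itvoo[q]; rewrite in_itv/= => /andP[q1 q2]; exists q.
  by rewrite ltr_distl q1 q2.
pose q : 'rV[rat]_n := \row_i (sval (cid (qP i))).
have xq : B (q, k) x.
  by split => // i j; rewrite !mxE (ord1 i) /ball /=; case: cid.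
exists (q, k) => //; rewrite asboolT// => y [_ qy]; apply: xrA; split=> // i j.
have [_ /(_ i j)] := xq; have := qy i j; rewrite /ball /= => yq qx.
rewrite (_ : x i j - y i j = (x i j - map_mx ratr q i j) + (map_mx ratr q i j - y i j)); last by ring.
apply: le_lt_trans (ler_normD _ _) _; rewrite (distrC (x i j)).
apply: lt_trans (ltrD qx yq) _.
by move: kr; move: (k.+1%:R^-1) => e; lra.
Qed.

Lemma continuous_rV_measurable n (f : 'rV[R]_n -> R) :
  continuous f -> measurable_fun setT f.
Proof.
move=> /continuousP cf; apply: (measurability _ (RGenOpens.measurableE R)).
move=> _ [_ [a [b ->]] <-]; rewrite setTI.
have oab : open (`]a, b[%classic : set R) by exact: interval_open.
exact: (@open_rV_measurable n (f @^-1` _) (cf _ oab)).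
Qed.

Lemma open_continuous_rV_measurable n (A : set 'rV[R]_n) (f : 'rV[R]_n -> R) :
  open A -> {in A, continuous f} -> measurable_fun A f.
Proof.
move=> oA; rewrite -(continuous_open_subspace f oA) => /continuousP cf.
apply: (measurability _ (RGenOpens.measurableE R)).
move=> _ [_ [a [b ->]] <-].
have oab : open (`]a, b[%classic : set R) by exact: interval_open.
have /open_subspaceP[C oC CA] := cf _ oab.
by rewrite setIC -CA; apply: measurableI; exact: open_rV_measurable.
Qed.

Lemma compact_rV_measurable n (A : set 'rV[R]_n) : compact A -> measurable A.
Proof.
move=> /compact_closed cA; rewrite -(setCK A); apply: measurableC.
have {}cA : closed A by apply: cA; exact: norm_hausdorff.
exact: open_rV_measurable (closed_openC cA).
Qed.

Lemma ge0_integral_rVS n (F : 'rV[R]_n.+1 -> \bar R) :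
  measurable_fun setT F -> (forall x, 0 <= F x)%E ->
  (\int[lebesgue_rV R n.+1]_x F x =
   \int[lebesgue_measure]_s \int[lebesgue_rV R n]_u F (rV_cons (s, u)))%E.
Proof.
move=> mF F0; rewrite /lebesgue_rV -/(lebesgue_rV R n).
rewrite [LHS](ge0_integral_pushforward (@measurable_rV_cons R n))//.
rewrite preimage_setT (fubini_tonelli1 (F \o @rV_cons R n))//.
  exact: measurableT_comp (@measurable_rV_cons R n).
by move=> x; exact: F0.
Qed.

Lemma integral_rVS n (F : 'rV[R]_n.+1 -> \bar R) :
  measurable_fun setT F ->
  (\int[lebesgue_rV R n.+1]_x F x =
   \int[lebesgue_measure \x lebesgue_rV R n]_z F (rV_cons z))%E.
Proof.
move=> mF; rewrite integralE [RHS]integralE; congr (_ - _)%E.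
  rewrite [LHS](ge0_integral_pushforward (@measurable_rV_cons R n))//=.
  - by rewrite preimage_setT; apply: eq_integral => z _; rewrite /= !funeposE.
  - exact: measurable_funepos.
rewrite [LHS](ge0_integral_pushforward (@measurable_rV_cons R n))//=.
- by rewrite preimage_setT; apply: eq_integral => z _; rewrite /= !funenegE.
- exact: measurable_funeneg.
Qed.

Lemma rV_cons0 n (p : R * 'rV[R]_n) (j : 'I_1) : rV_cons p j ord0 = p.1.
Proof. by have := congr1 fst (rV_consK p); rewrite /rV_uncons (ord1 j). Qed.

Lemma rV_consS n (p : R * 'rV[R]_n) (i : 'I_n) (j : 'I_1) :
  rV_cons p j (lift ord0 i) = p.2 j i.
Proof.
rewrite /rV_cons (_ : lift ord0 i = rshift 1 i); last exact/val_inj.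
by rewrite [LHS]row_mxEr.
Qed.

Lemma rV_consE n (x : 'rV[R]_n.+1) :
  x = rV_cons (x 0 ord0, \row_(i < n) x 0 (lift ord0 i)).
Proof.
apply/rowP => i; case: (unliftP ord0 i) => [j ->|->].
  by rewrite rV_consS mxE.
by rewrite rV_cons0.
Qed.

Lemma ge0_integral_rV1 (F : 'rV[R]_1 -> \bar R) :
  measurable_fun setT F -> (forall x, 0 <= F x)%E ->
  (\int[lebesgue_rV R 1]_x F x =
   \int[lebesgue_measure]_t F (rV_cons (t, 0%R : 'rV[R]_0)))%E.
Proof.
move=> mF F0; rewrite ge0_integral_rVS//; apply: eq_integral => t _ /=.
rewrite integral_dirac//= ?diracT ?mul1e//.
apply: measurableT_comp mF _; apply: measurableT_comp (@measurable_rV_cons R 0) _.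
exact: pair1_measurable.
Qed.

Lemma integral_rV1 (F : 'rV[R]_1 -> \bar R) : measurable_fun setT F ->
  (\int[lebesgue_rV R 1]_x F x =
   \int[lebesgue_measure]_t F (rV_cons (t, 0%R : 'rV[R]_0)))%E.
Proof.
move=> mF; rewrite integralE [RHS]integralE; congr (_ - _)%E.
  rewrite ge0_integral_rV1//; last exact: measurable_funepos.
  by apply: eq_integral => t _; rewrite !funeposE.
rewrite ge0_integral_rV1//; last exact: measurable_funeneg.
by apply: eq_integral => t _; rewrite !funenegE.
Qed.

(** Written coordinatewise so that it splits as an interval times a box along [rV_cons]. Indicators
    of boxes are the majorants of all compactly supported functions below. *)
Definition box n (M : R) : set 'rV[R]_n := [set x | forall i, `|x 0 i| <= M].
Arguments box : clear implicits.

Lemma box_measurable n M : measurable (box n M).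
Proof.
rewrite (_ : box n M = \bigcap_(i in [set: 'I_n]) [set y | `|y 0 i| <= M]).
  apply: fin_bigcap_measurable => // i _.
  change (measurable [set y : 'rV[R]_n | `|y 0 i| <= M]).
  rewrite (_ : [set _ | _] = setT `&` (fun y : 'rV[R]_n => `|y 0 i|) @^-1` `]-oo, M]%classic); last first.
    by rewrite setTI; apply/seteqP; split=> y; rewrite /= in_itv.
  have : measurable_fun setT (fun y : 'rV[R]_n => `|y 0 i|).
    by apply: measurableT_comp => //; exact: measurable_coord.
  by apply.
by apply/seteqP; split=> y H i; [move=> _; exact: H|exact: H].
Qed.

Lemma lebesgue_rV_box n M : (lebesgue_rV R n (box n M) < +oo)%E.
Proof.
elim: n => [|n IH] /=; first by rewrite diracE ltry.
rewrite /lebesgue_rVS /pushforward (_ : _ @^-1` _ = `[- M, M]%classic `*` box n M).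
  rewrite product_measure1E//; last exact: box_measurable.
  apply: lte_mul_pinfty => //.
  change ((@lebesgue_measure R `[- M, M]%classic) \is a fin_num).
  by rewrite lebesgue_measure_itv /=; case: ifP.
apply/seteqP; split=> -[a u].
  move=> H; split; first by have := H ord0; rewrite rV_cons0 /= in_itv/= ler_norml.
  by move=> i; have := H (lift ord0 i); rewrite rV_consS.
move=> [/=]; rewrite in_itv/= -ler_norml => aM uM i.
by case: (unliftP ord0 i) => [j ->|->]; rewrite ?rV_consS ?rV_cons0//; exact: uM.
Qed.

Lemma integrable_box n M : (lebesgue_rV R n).-integrable setT (EFin \o \1_(box n M)).
Proof.
apply/integrableP; split.
  by apply/measurable_EFinP; apply: measurable_indic; exact: box_measurable.
under eq_integral do rewrite /= ger0_norm//.
by rewrite integral_indic// ?setIT; [exact: lebesgue_rV_box|exact: box_measurable].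
Qed.

Lemma compact_sub_box n (K : set 'rV[R]_n) : compact K -> exists M, K `<=` box n M.
Proof.
move=> /compact_bounded [M [_ MK]]; exists (M + 1) => x Kx i.
have := MK (M + 1); rewrite ltrDl ltr01 => /(_ isT _ Kx); apply: le_trans.
rewrite [`|x|](_ : _ = mx_norm x)// mx_normrE.
exact: (le_bigmax _ (fun ij => `|x ij.1 ij.2|) (0, i)).
Qed.

End measurable_rV_theory.
Arguments box {R} n M _.

(** * Fourier inversion for compactly supported functions *)

Lemma Rintegral_dominated d (T : measurableType d) (R : realType)
    (m : {measure set T -> \bar R}) (D : set T) (f_ : nat -> T -> R) (f g : T -> R) :
  measurable D -> (forall n, measurable_fun D (f_ n)) ->
  (forall x, D x -> f_ n x @[n --> \oo] --> f x) ->
  m.-integrable D (EFin \o g) -> (forall n x, D x -> `|f_ n x| <= g x) ->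
  \int[m]_(x in D) f_ n x @[n --> \oo] --> \int[m]_(x in D) f x.
Proof.
move=> mD mf ff ig fg.
have mfE n : measurable_fun D (EFin \o f_ n) by exact/measurable_EFinP.
have ffE x : D x -> (EFin \o f_ n) x @[n --> \oo] --> (EFin \o f) x.
  by move=> Dx; apply/fine_cvgP; split; [exact: nearW|exact: ff].
have fgE n x : D x -> (`|(EFin \o f_ n) x| <= (EFin \o g) x)%E.
  by move=> Dx; rewrite lee_fin; exact: fg.
have mfl : measurable_fun D (EFin \o f) by exact: emeasurable_fun_cvg mfE ffE.
have [i_f _ cv] := @dominated_convergence _ _ _ m D mD (fun n => EFin \o f_ n)
  (EFin \o f) (EFin \o g) mfE mfl (aeW _ ffE) ig (aeW _ (fun x n => fgE n x)).
by apply: fine_cvg; rewrite fineK//; exact: integrable_fin_num i_f.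
Qed.

Section fourier_inversion.
Context {R : realType}.
Local Notation mu := (@lebesgue_measure R).

Lemma is_derive_LRcontinuous (F f : R -> R) (a b : R) :
  (forall x, is_derive x (1 : R) F (f x)) -> derivable_oo_LRcontinuous F a b.
Proof.
move=> dF; have cF : continuous F.
  by move=> x; apply/differentiable_continuous/derivable1_diffP; case: (dF x).
split; first by move=> x _; case: (dF x).
  exact/cvg_at_right_filter/cF.
exact/cvg_at_left_filter/cF.
Qed.

Lemma is_derive_continuous (F f : R -> R) :
  (forall x, is_derive x (1 : R) F (f x)) -> continuous F.
Proof.
by move=> dF x; apply/differentiable_continuous/derivable1_diffP; case: (dF x).
Qed.

Lemma Rintegral_parts (F f G g : R -> R) (a b : R) : a < b ->
  (forall x, is_derive x (1 : R) F (f x)) -> continuous f ->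
  (forall x, is_derive x (1 : R) G (g x)) -> continuous g ->
  F a = 0 -> F b = 0 ->
  \int[mu]_(x in `[a, b]) (F x * g x) = - \int[mu]_(x in `[a, b]) (f x * G x).
Proof.
move=> ab dF cf dG cg Fa Fb.
rewrite (@Rintegration_by_parts _ F G f g a b)//.
- by rewrite Fa Fb !mul0r subrr sub0r.
- exact: continuous_subspaceT.
- exact: is_derive_LRcontinuous.
- by move=> x _; rewrite derive1E; case: (dF x).
- exact: continuous_subspaceT.
- exact: is_derive_LRcontinuous.
- by move=> x _; rewrite derive1E; case: (dG x).
Qed.

Lemma Rintegral_supp (f : R -> R) (M : R) :
  (forall s, M <= `|s| -> f s = 0) ->
  \int[mu]_s f s = \int[mu]_(s in `[- M, M]) f s.
Proof.
move=> f0; rewrite [RHS]Rintegral_mkcond; congr Rintegral; apply/funext => s.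
rewrite patchE; case: ifPn => // /negP sM; apply: f0; rewrite leNgt.
by apply/negP => Ms; apply: sM; rewrite inE/= in_itv/= -ler_norml ltW.
Qed.

(* The phase shifts [d = 0] and [d = - pi / 2] give the real and imaginary parts
   of [e^{i xi (p - s)}]. *)
Definition phase_cos (p d xi s : R) := cos (xi * (p - s) + d).

Lemma is_derive_phase_cos p d xi s : is_derive s (1 : R) (phase_cos p d xi)
  (xi * sin (xi * (p - s) + d)).
Proof.
rewrite /phase_cos; apply: is_derive_eq.
by rewrite /GRing.scale /=; ring.
Qed.

Lemma is_derive_phase_sin p d xi s : is_derive s (1 : R) (fun s => sin (xi * (p - s) + d))
  (- xi * phase_cos p d xi s).
Proof.
rewrite /phase_cos; apply: is_derive_eq.
by rewrite /GRing.scale /=; ring.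
Qed.

Lemma continuous_phase_cos p d xi : continuous (phase_cos p d xi).
Proof. exact: is_derive_continuous (is_derive_phase_cos p d xi). Qed.

Lemma continuous_phase_cos_freq p s d : continuous (fun xi => phase_cos p d xi s).
Proof.
have dk xi : is_derive xi (1 : R) (fun xi => phase_cos p d xi s)
    (- (p - s) * sin (xi * (p - s) + d)).
  by rewrite /phase_cos; apply: is_derive_eq; rewrite /GRing.scale /=; ring.
exact: is_derive_continuous dk.
Qed.

(** * Decay in the frequency for a C^2 function with compact support *)

Section compact_support.
Variables (G G1 G2 : R -> R) (M C : R).
Hypotheses (M0 : 0 < M) (dG : forall s, is_derive s (1 : R) G (G1 s))
  (dG1 : forall s, is_derive s (1 : R) G1 (G2 s)) (cG2 : continuous G2)
  (G0 : forall s, M <= `|s| -> G s = 0) (G10 : forall s, M <= `|s| -> G1 s = 0)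
  (GC : forall s, `|G s| <= C) (G2C : forall s, `|G2 s| <= C).

Let cG : continuous G. Proof. exact: is_derive_continuous dG. Qed.
Let cG1 : continuous G1. Proof. exact: is_derive_continuous dG1. Qed.
Let MM : - M < M. Proof. by rewrite gtrN. Qed.
Let M1 : M <= `|M|. Proof. exact: ler_norm. Qed.
Let M2 : M <= `|- M|. Proof. by rewrite normrN. Qed.

Lemma phase_integral_parts p d xi : xi != 0 ->
  xi ^+ 2 * \int[mu]_s (phase_cos p d xi s * G s) =
  - \int[mu]_(s in `[- M, M]) (G2 s * phase_cos p d xi s).
Proof.
move=> xi0.
rewrite (@Rintegral_supp _ M); last by move=> s /G0 ->; rewrite mulr0.
(* [K1] and [K2] are successive antiderivatives of the phase in [s]; each brings a factor [xi^-1].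
   The boundary terms vanish because [G] and [G1] do at [M] and [- M]. *)
pose K1 s := - (xi^-1 * sin (xi * (p - s) + d)).
pose K2 s := - (xi ^- 2 * phase_cos p d xi s).
have dK1 s : is_derive s (1 : R) K1 (phase_cos p d xi s).
  have := is_derive_phase_sin p d xi s => h.
  by apply: is_derive_eq; rewrite /GRing.scale /=; field.
have dK2 s : is_derive s (1 : R) K2 (K1 s).
  have := is_derive_phase_cos p d xi s => h.
  by apply: is_derive_eq; rewrite /K1 /GRing.scale /=; field.
under eq_Rintegral do rewrite mulrC.
rewrite (Rintegral_parts MM dG cG1 dK1)//; last 3 first.
- exact: continuous_phase_cos.
- by apply: G0.
- by apply: G0.
rewrite (Rintegral_parts MM dG1 cG2 dK2)//; last 3 first.
- exact: is_derive_continuous dK1.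
- by apply: G10.
- by apply: G10.
rewrite opprK -RintegralZl//; last first.
  apply: continuous_compact_integrable; first exact: segment_compact.
  apply: continuous_subspaceT => s; apply: (@continuousM _ _ G2 K2); first exact: cG2.
  exact: (is_derive_continuous dK2).
rewrite -[RHS]mulN1r -[RHS]RintegralZl//; last first.
  apply: continuous_compact_integrable; first exact: segment_compact.
  apply: continuous_subspaceT => s; apply: (@continuousM _ _ G2 (phase_cos p d xi)); first exact: cG2.
  exact: continuous_phase_cos.
by apply: eq_Rintegral => s _; rewrite /K2; field.
Qed.

Lemma itv_integral_bound (f : R -> R) (D : R) : continuous f ->
  (forall s, `|f s| <= D) -> `|\int[mu]_(s in `[- M, M]) f s| <= 2 * M * D.
Proof.
move=> cf fD; apply: (le_trans (le_normr_Rintegral _ _)) => //.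
  by apply: continuous_compact_integrable;
    [exact: segment_compact|exact: continuous_subspaceT].
apply: (@le_trans _ _ (\int[mu]_(s in `[- M, M]) D)).
  apply: le_Rintegral => //.
  - apply: continuous_compact_integrable; first exact: segment_compact.
    by apply: continuous_subspaceT => s; apply: continuous_comp (cf s) _; exact: norm_continuous.
  - apply: continuous_compact_integrable; first exact: segment_compact.
    by apply: continuous_subspaceT => s; exact: cst_continuous.
have E : fine (mu `[- M, M]%classic) = M + M.
  by rewrite lebesgue_measure_itv/= lte_fin MM -EFinB/= opprK.
by rewrite Rintegral_cst//; change (D * fine (mu `[- M, M]%classic) <= 2 * M * D); rewrite E; lra.
Qed.

(** The sum of two bounds by [2 * M * C]: the trivial one for the integral, and the one after two
    integrations by parts for [xi^2] times the integral. The constant depends neither on [p] nor on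
    [d], which later gives bounds uniform in [x] and in the angles. *)
Lemma phase_integral_bound p d xi :
  `|\int[mu]_s (phase_cos p d xi s * G s)| <= (4 * M * C) * (1 + xi ^+ 2)^-1.
Proof.
have C0 : 0 <= C by exact: le_trans (normr_ge0 _) (GC 0).
have kle s (D x : R) : `|x| <= D -> `|phase_cos p d xi s * x| <= D.
  move=> xD; rewrite normrM -[leRHS]mul1r ler_pM//.
  by rewrite ler_norml cos_geN1 cos_le1.
have b1 : `|\int[mu]_s (phase_cos p d xi s * G s)| <= 2 * M * C.
  rewrite (@Rintegral_supp _ M); last by move=> s /G0 ->; rewrite mulr0.
  apply: itv_integral_bound => [s|s]; last exact: kle.
  by apply: (@continuousM _ _ (phase_cos p d xi) G); [exact: continuous_phase_cos|exact: cG].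
have b2 : xi ^+ 2 * `|\int[mu]_s (phase_cos p d xi s * G s)| <= 2 * M * C.
  have [->|xi0] := eqVneq xi 0; first by rewrite expr0n/= mul0r !mulr_ge0// ltW.
  rewrite -[X in X * _](@ger0_norm _ (xi ^+ 2)) ?sqr_ge0// -normrM.
  rewrite phase_integral_parts// normrN; apply: itv_integral_bound => [s|s].
    by apply: (@continuousM _ _ G2 (phase_cos p d xi)); [exact: cG2|exact: continuous_phase_cos].
  by rewrite mulrC; exact: kle.
rewrite ler_pdivlMr; last by rewrite ltr_pwDl// sqr_ge0.
by rewrite mulrDr mulr1 [X in _ + X]mulrC; lra.
Qed.

End compact_support.

Lemma integrable_oneDsqrV : mu.-integrable setT (fun x => ((1 + x ^+ 2)^-1)%:E).
Proof.
have cf : continuous (fun x : R => (1 + x ^+ 2)^-1).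
  exact: (@continuous_oneDsqrV R).
have f0 x : 0 <= (1 + x ^+ 2)^-1 :> R by rewrite invr_ge0 addr_ge0// sqr_ge0.
apply/integrableP; split; first by apply/measurable_EFinP; exact (continuous_measurable_fun cf).
under eq_integral do rewrite /= ger0_norm//.
rewrite (@ge0_symfun_integralT _ (fun x : R => (1 + x ^+ 2)^-1))//; last first.
  by move=> x; rewrite /= sqrrN.
by rewrite -set_itvcy (@integral0y_oneDsqr R) -EFinM ltry.
Qed.

(** * The Fourier transform of the Abel factor [expR (- (e * |x|))] *)

Section poisson_kernel.
Variables (e : R) (e0 : 0 < e).

Let e2t (t : R) : e ^+ 2 + t ^+ 2 != 0.
Proof. by rewrite gt_eqF// ltr_pwDl ?sqr_ge0 ?exprn_gt0. Qed.

(** The summand [1] makes the integrand nonnegative, as the fundamental theorem on a half-line used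
    here demands. Its contribution [e^-1] is subtracted in [Rintegral_exp_phase]. *)
Lemma integral_exp_cos_half t d :
  (\int[mu]_(x in `[0%R, +oo[) (expR (- (e * x)) * (1 + cos (x * t + d)))%:E =
   (e^-1 + (e * cos d - t * sin d) / (e ^+ 2 + t ^+ 2))%:E)%E.
Proof.
pose F x := - (e^-1 * expR (- (e * x))) + expR (- (e * x)) *
  (t * sin (x * t + d) - e * cos (x * t + d)) / (e ^+ 2 + t ^+ 2).
have dF (x : R) : is_derive x (1 : R) F (expR (- (e * x)) * (1 + cos (x * t + d))).
  apply: is_derive_eq; rewrite /GRing.scale /=; field.
  by rewrite e2t gt_eqF.
have cf : continuous (fun x => expR (- (e * x)) * (1 + cos (x * t + d))).
  have dc x : is_derive x (1 : R) (fun x => expR (- (e * x)) * (1 + cos (x * t + d)))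
    (- e * expR (- (e * x)) * (1 + cos (x * t + d)) - t * expR (- (e * x)) * sin (x * t + d)).
    by apply: is_derive_eq; rewrite /GRing.scale /=; ring.
  exact: is_derive_continuous dc.
have cvE : expR (- (e * x)) @[x --> +oo] --> (0 : R).
  apply: (@cvg_comp _ _ _ (fun x => e * x) (fun x => expR (- x)) _ (pinfty_nbhs R)); last exact: cvgr_expR.
  exact: gt0_cvgMry.
pose K := e^-1 + (`|t| + e) / (e ^+ 2 + t ^+ 2).
have p2t : 0 < e ^+ 2 + t ^+ 2 by rewrite ltr_pwDl ?sqr_ge0 ?exprn_gt0.
have FK x : `|F x| <= K * expR (- (e * x)).
  rewrite /F /K mulrDl; apply: le_trans (ler_normD _ _) _; apply: lerD.
    by rewrite normrN ger0_norm// mulr_ge0 ?expR_ge0// invr_ge0 ltW.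
  rewrite -mulrA mulrC normrM [X in _ * X]ger0_norm ?expR_ge0// ler_wpM2r ?expR_ge0//.
  rewrite normrM [X in _ * X]gtr0_norm ?invr_gt0// ler_wpM2r ?invr_ge0 ?(ltW p2t)//.
  apply: le_trans (ler_normB _ _) _; apply: lerD; rewrite normrM.
    by rewrite ler_piMr// ler_norml sin_geN1 sin_le1.
  by rewrite gtr0_norm// (ler_piMr (ltW e0))// ler_norml cos_geN1 cos_le1.
have cvF : F x @[x --> +oo] --> (0 : R).
  have cvK : K * expR (- (e * x)) @[x --> +oo] --> (0 : R).
    by rewrite -(mulr0 K); exact: cvgMr.
  apply: (@squeeze_cvgr _ _ _ _ (fun x => - (K * expR (- (e * x)))) (fun x => K * expR (- (e * x)))) => //.
    by near=> x; rewrite -ler_norml.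
  by rewrite -oppr0; exact: cvgN.
rewrite (@ge0_continuous_FTC2y _ (fun x => expR (- (e * x)) * (1 + cos (x * t + d))) F 0 0)//.
- rewrite -[LHS]/((0 - F 0)%:E); congr EFin; rewrite /F mulr0 oppr0 expR0 mul0r !add0r; field.
  by rewrite e2t gt_eqF.
- exact: continuous_subspaceT.
- exact/cvg_at_right_filter/(is_derive_continuous dF).
- by move=> x _; rewrite derive1E; case: (dF x).
Unshelve. all: by end_near. Qed.

Lemma integral_exp_cos t d :
  (\int[mu]_x (expR (- (e * `|x|)) * (1 + cos (x * t + d)))%:E =
   (2 * e^-1 + 2 * e * cos d / (e ^+ 2 + t ^+ 2))%:E)%E.
Proof.
have cf a : continuous (fun x => expR (- (e * x)) * (1 + cos (x * a + d))).
  have dc x : is_derive x (1 : R) (fun x => expR (- (e * x)) * (1 + cos (x * a + d)))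
    (- e * expR (- (e * x)) * (1 + cos (x * a + d)) - a * expR (- (e * x)) * sin (x * a + d)).
    by apply: is_derive_eq; rewrite /GRing.scale /=; ring.
  exact: is_derive_continuous dc.
pose f (x : R) := expR (- (e * `|x|)) * (1 + cos (x * t + d)).
have cfT : continuous f.
  move=> x; apply: (@continuousM _ _ (fun x : R => expR (- (e * `|x|))) (fun x => 1 + cos (x * t + d))).
    apply: (@continuous_comp _ _ _ (fun x : R => - (e * `|x|)) (@expR R)); last exact: continuous_expR.
    apply: (@continuousN _ _ _ (fun x : R => e * `|x|)).
    apply: (@continuousM _ _ (cst e) (fun x : R => `|x|)); first exact: cst_continuous.
    exact: norm_continuous.
  have dc y : is_derive y (1 : R) (fun x => 1 + cos (x * t + d)) (- t * sin (y * t + d)).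
    by apply: is_derive_eq; rewrite /GRing.scale /=; ring.
  exact: (is_derive_continuous dc).
have f0 x : 0 <= f x.
  by rewrite mulr_ge0 ?expR_ge0// addrC -lerBlDr sub0r cos_geN1.
have mf : measurable_fun setT f by exact: continuous_measurable_fun.
have mfE (D : set R) : measurable_fun D (EFin \o f).
  by apply/measurable_EFinP; exact: measurable_funTS.
have H : (\int[mu]_(x in `[0%R, +oo[) (f x)%:E = (e^-1 + (e * cos d - t * sin d) / (e ^+ 2 + t ^+ 2))%:E)%E.
  rewrite -integral_exp_cos_half; apply: eq_integral => x; rewrite inE/= in_itv/= andbT => x0.
  by rewrite /f ger0_norm.
have H' : (\int[mu]_(x in `]-oo, 0%R]) (f x)%:E = (e^-1 + (e * cos d + t * sin d) / (e ^+ 2 + t ^+ 2))%:E)%E.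
  rewrite -[X in `]-oo, X] ]oppr0 ge0_integration_by_substitutionNy; last 2 first.
  - exact: continuous_subspaceT.
  - by move=> x _; exact: f0.
  have := integral_exp_cos_half (- t) d; rewrite sqrrN mulNr opprK => <-.
  apply: eq_integral => x; rewrite inE/= in_itv/= andbT => x0.
  by rewrite /f /= normrN ger0_norm// mulNr mulrN.
rewrite -(setUv `]-oo, 0%R]%classic) ge0_integral_setU//=; last 3 first.
- exact: measurableC.
- exact: mfE.
- exact/disj_setPCl.
rewrite setCitvl integral_itv_obnd_cbnd// H H' -EFinD; congr EFin; field.
by rewrite e2t gt_eqF.
Qed.

Lemma integrable_exp_norm : mu.-integrable setT (fun x => (expR (- (e * `|x|)))%:E).
Proof.
(* At frequency [0] and shift [pi / 2] the cosine vanishes, so that the formula is the mass [2 / e]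
   of the exponential alone. *)
have := integral_exp_cos 0 (pi / 2); rewrite cos_pihalf mulr0 mul0r addr0 => H.
apply/integrableP; split.
  apply/measurable_EFinP; apply: measurableT_comp => //.
  by apply: measurableT_comp => //; apply: measurable_funM => //; exact: measurableT_comp.
under eq_integral do rewrite /= ger0_norm ?expR_ge0//.
suff -> : (\int[mu]_x (expR (- (e * `|x|)))%:E = (2 * e^-1)%:E)%E by rewrite ltry.
by rewrite -H; apply: eq_integral => x _; rewrite mulr0 add0r cos_pihalf addr0 mulr1.
Qed.

(** The right-hand side is [2 * pi * cos d] times the Poisson kernel of width [e] centred at [p];
    the part of the cosine that is odd in [x] integrates to zero. *)
Lemma Rintegral_exp_phase p s d :
  \int[mu]_x (expR (- (e * `|x|)) * phase_cos p d x s) =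
  2 * e * cos d / (e ^+ 2 + (s - p) ^+ 2).
Proof.
have := integral_exp_cos (p - s) d => H.
have H0 := integral_exp_cos 0 (pi / 2).
have i1 := integrable_exp_norm.
have mE : measurable_fun setT (fun x : R => expR (- (e * `|x|))).
  by apply/measurable_EFinP; exact: measurable_int i1.
have mP : measurable_fun setT (fun x : R => phase_cos p d x s).
  exact (continuous_measurable_fun (@continuous_phase_cos_freq p s d)).
have i2 : mu.-integrable setT (fun x => (expR (- (e * `|x|)) * phase_cos p d x s)%:E).
  apply: le_integrable i1 => //.
    by apply/measurable_EFinP; apply: measurable_funM.
  move=> x _; rewrite /= lee_fin normrM ler_piMr// ler_norml.
  by rewrite cos_geN1 cos_le1.
have : \int[mu]_x (expR (- (e * `|x|)) + expR (- (e * `|x|)) * phase_cos p d x s) =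
   2 * e^-1 + 2 * e * cos d / (e ^+ 2 + (p - s) ^+ 2).
  rewrite /Rintegral; have -> : 2 * e^-1 + 2 * e * cos d / (e ^+ 2 + (p - s) ^+ 2) =
    fine (2 * e^-1 + 2 * e * cos d / (e ^+ 2 + (p - s) ^+ 2))%:E by [].
  rewrite -H; congr fine; apply: eq_integral => x _.
  by rewrite mulrDr mulr1.
rewrite RintegralD// => E.
have E1 : \int[mu]_x expR (- (e * `|x|)) = 2 * e^-1.
  rewrite /Rintegral; have -> : 2 * e^-1 = fine (2 * e^-1 + 2 * e * cos (pi / 2) / (e ^+ 2 + 0 ^+ 2))%:E.
    by rewrite /= cos_pihalf mulr0 mul0r addr0.
  rewrite -H0; congr fine; apply: eq_integral => x _.
  by rewrite mulr0 add0r cos_pihalf addr0 mulr1.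
have -> : (s - p) ^+ 2 = (p - s) ^+ 2 by ring.
by move: E; rewrite E1 => /addrI.
Qed.

End poisson_kernel.

Lemma continuous_integrable_itv (f : R -> R) (a b : R) : continuous f ->
  mu.-integrable `[a, b] (EFin \o f).
Proof.
move=> cf; apply: continuous_compact_integrable; first exact: segment_compact.
exact: continuous_subspaceT.
Qed.

Lemma Rintegral_FTC2 (F f : R -> R) (a b : R) : a < b ->
  (forall x, is_derive x (1 : R) F (f x)) -> continuous f ->
  \int[mu]_(x in `[a, b]) f x = F b - F a.
Proof.
move=> ab dF cf; rewrite /Rintegral (@continuous_FTC2 _ f F)//.
- exact: continuous_subspaceT.
- exact: is_derive_LRcontinuous.
- by move=> x _; rewrite derive1E; case: (dF x).
Qed.

Lemma cvg_atan_sg (x : R) :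
  2 * atan (x * n.+1%:R) @[n --> \oo] --> pi * Num.sg x.
Proof.
have pos (y : R) : 0 < y -> 2 * atan (y * n.+1%:R) @[n --> \oo] --> pi.
  move=> y0; have -> : pi = 2 * (pi / 2) :> R by field.
  apply: cvgMr; apply: (@cvg_comp _ _ _ (fun n => y * n.+1%:R) (@atan R) _ (pinfty_nbhs R)); last exact: cvgy_atan.
  apply/cvgryPge => B; near=> n.
  rewrite mulrC -ler_pdivrMr// (@le_trans _ _ n%:R)// ?ler_nat//.
  by near: n; exact: nbhs_infty_ger.
have [x0|x0|->] := ltgtP x 0.
- rewrite ltr0_sg// mulrN1.
  rewrite (_ : (fun n => _) = (fun n => - (2 * atan ((- x) * n.+1%:R)))).
    by apply: cvgN; apply: pos; rewrite oppr_gt0.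
  by apply/funext => n; rewrite mulNr atanN mulrN opprK.
- by rewrite gtr0_sg// mulr1; exact: pos.
- rewrite sgr0 mulr0 (_ : (fun n => _) = cst 0); first exact: cvg_cst.
  by apply/funext => n; rewrite mul0r atan0 mulr0.
Unshelve. all: by end_near. Qed.

Lemma continuous_poisson (h : R) (q : R) : 0 < h ->
  continuous (fun s => 2 * h / (h ^+ 2 + (s - q) ^+ 2)).
Proof.
move=> h0 s; apply: (@continuousM _ _ (cst (2 * h)) (fun s => (h ^+ 2 + (s - q) ^+ 2)^-1)); first exact: cst_continuous.
have hs : h ^+ 2 + (s - q) ^+ 2 != 0 by rewrite gt_eqF// ltr_pwDl ?sqr_ge0// exprn_gt0.
apply: (@continuousV _ _ (fun s => h ^+ 2 + (s - q) ^+ 2)) => //.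
have dd x : is_derive x (1 : R) (fun s => h ^+ 2 + (s - q) ^+ 2) (2 * (x - q)).
  by apply: is_derive_eq; rewrite /GRing.scale /=; ring.
exact: (is_derive_continuous dd).
Qed.

(** * Fourier inversion at a point by Abel summation *)

Section inversion.
Variables (G G1 G2 : R -> R) (M C p : R).
Hypotheses (pM : `|p| < M) (dG : forall s, is_derive s (1 : R) G (G1 s))
  (dG1 : forall s, is_derive s (1 : R) G1 (G2 s)) (cG2 : continuous G2)
  (G0 : forall s, M <= `|s| -> G s = 0) (G10 : forall s, M <= `|s| -> G1 s = 0)
  (GC : forall s, `|G s| <= C) (G2C : forall s, `|G2 s| <= C).

Let M0 : 0 < M. Proof. exact: le_lt_trans (normr_ge0 _) pM. Qed.
Let cG : continuous G. Proof. exact: is_derive_continuous dG. Qed.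
Let cG1 : continuous G1. Proof. exact: is_derive_continuous dG1. Qed.
Let e (n : nat) : R := n.+1%:R^-1.
Let GM : G M = 0. Proof. by apply: G0; exact: ler_norm. Qed.
Let GNM : G (- M) = 0. Proof. by apply: G0; rewrite normrN; exact: ler_norm. Qed.

(** The limit form of [poisson_cvg] after an integration by parts: on either side of [p] the sign is
    constant, and the fundamental theorem yields [- pi * G p] twice. *)
Lemma Rintegral_sg :
  \int[mu]_(s in `[- M, M]) (G1 s * (pi * Num.sg (s - p))) = - (2 * pi * G p).
Proof.
have [Mp pM'] : - M < p /\ p < M by apply/andP; rewrite -ltr_norml.
have msg : measurable_fun setT (fun s : R => Num.sg (s - p)).
  rewrite (_ : (fun s => _) = (fun s => \1_(`]p, +oo[%classic) s - \1_(`]-oo, p[%classic) s)).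
    by apply: measurable_funB.
  apply/funext => s; rewrite !indicE !mem_setE !in_itv/= andbT.
  have [h|h|->] := ltgtP s p.
  - by rewrite ltr0_sg ?subr_lt0// sub0r.
  - by rewrite gtr0_sg ?subr_gt0// subr0.
  - by rewrite !subrr sgr0.
have ig : mu.-integrable `[- M, M] (EFin \o (fun s => G1 s * (pi * Num.sg (s - p)))).
  have i1 : mu.-integrable `[- M, M] (EFin \o (fun s => G1 s * pi)).
    apply: continuous_integrable_itv => s.
    by apply: (@continuousM _ _ G1 (cst pi)); [exact: cG1|exact: cst_continuous].
  apply: le_integrable i1 => //.
    apply/measurable_EFinP; apply: measurable_funTS; apply: measurable_funM.
      exact (continuous_measurable_fun cG1).
    exact: measurable_funM.
  move=> s _; rewrite /= lee_fin mulrA normrM ler_piMr//.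
  by rewrite normr_sg; case: (_ != _).
have iL : mu.-integrable `[- M, p] (EFin \o (fun s => G1 s * - pi)).
  apply: continuous_integrable_itv => s.
  by apply: (@continuousM _ _ G1 (cst (- pi))); [exact: cG1|exact: cst_continuous].
have iR : mu.-integrable `[p, M] (EFin \o (fun s => G1 s * pi)).
  apply: continuous_integrable_itv => s.
  by apply: (@continuousM _ _ G1 (cst pi)); [exact: cG1|exact: cst_continuous].
have -> : `[- M, M]%classic = `[- M, p]%classic `|` `]p, M]%classic.
  apply/seteqP; split=> s /=; rewrite !in_itv/=; first by case: leP => sp; move=> /andP[-> ->]; [left|right].
  by case=> /andP[h1 h2]; rewrite ?h1 ?h2 ?andbT/= ?(le_trans h2)// ?ltW// ?(lt_trans Mp).
rewrite Rintegral_setU//; last 2 first.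
- rewrite (_ : _ `|` _ = `[- M, M]%classic)//.
  apply/seteqP; split=> s /=; rewrite !in_itv/=; last by case: leP => sp; move=> /andP[-> ->]; [left|right].
  by case=> /andP[h1 h2]; rewrite ?h1 ?h2 ?andbT/= ?(le_trans h2)// ?ltW// ?(lt_trans Mp).
- by apply/disj_setPS => s /=; rewrite !in_itv/= => -[/andP[_ h1] /andP[h2 _]]; have := lt_le_trans h2 h1; rewrite ltxx.
have -> : \int[mu]_(x in `[- M, p]) (G1 x * (pi * Num.sg (x - p))) = - pi * G p.
  rewrite -Rintegral_itv_bndo_bndc; last first.
    apply: integrableS ig => // s /=; rewrite !in_itv/= => /andP[-> sp].
    by rewrite (ltW (lt_trans sp pM')).
  transitivity (\int[mu]_(x in `[- M, p[) (G1 x * - pi)).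
    apply: eq_Rintegral => s; rewrite inE/= in_itv/= => /andP[_ sp].
    by rewrite ltr0_sg ?subr_lt0// mulrN1.
  rewrite Rintegral_itv_bndo_bndc//; last first.
    by apply: integrableS iL => // s /=; rewrite !in_itv/= => /andP[-> /ltW].
  rewrite RintegralZr//; last exact: continuous_integrable_itv.
  by rewrite (Rintegral_FTC2 Mp dG cG1) GNM subr0 mulrC.
have -> : \int[mu]_(x in `]p, M]) (G1 x * (pi * Num.sg (x - p))) = - pi * G p.
  transitivity (\int[mu]_(x in `]p, M]) (G1 x * pi)).
    apply: eq_Rintegral => s; rewrite inE/= in_itv/= => /andP[sp _].
    by rewrite gtr0_sg ?subr_gt0// mulr1.
  rewrite Rintegral_itv_obnd_cbnd//; last first.
    by apply: integrableS iR => // s /=; rewrite !in_itv/= => /andP[/ltW -> ->].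
  rewrite RintegralZr//; last exact: continuous_integrable_itv.
  by rewrite (Rintegral_FTC2 pM' dG cG1) GM sub0r mulNr mulrC mulNr.
by ring.
Qed.

(** The kernel is the derivative of [2 * atan ((s - p) / e n)]. An integration by parts moves the
    derivative to [G]; what remains is bounded by [pi] and tends to [pi] times the sign of [s - p],
    so dominated convergence replaces an approximate-identity estimate. *)
Lemma poisson_cvg :
  \int[mu]_s (G s * (2 * e n / (e n ^+ 2 + (s - p) ^+ 2))) @[n --> \oo] --> 2 * pi * G p.
Proof.
pose A n (s : R) := 2 * atan ((s - p) * n.+1%:R).
have dA n s : is_derive s (1 : R) (A n) (2 * e n / (e n ^+ 2 + (s - p) ^+ 2)).
  apply: is_derive_eq; rewrite /GRing.scale /= /e.
  have : n.+1%:R != 0 :> R by rewrite pnatr_eq0.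
  move: (n.+1%:R) => N N0.
  have h : 1 + ((s - p) * N) ^+ 2 != 0 by rewrite gt_eqF// ltr_pwDl// sqr_ge0.
  field; rewrite N0 /=; move: h; apply: contra => /eqP h; apply/eqP.
  by rewrite -[RHS]h; ring.
have e0 n : 0 < e n by rewrite invr_gt0.
have cA n : continuous (fun s => 2 * e n / (e n ^+ 2 + (s - p) ^+ 2)).
  exact: continuous_poisson.
have E n : \int[mu]_s (G s * (2 * e n / (e n ^+ 2 + (s - p) ^+ 2))) =
    - \int[mu]_(s in `[- M, M]) (G1 s * A n s).
  rewrite (@Rintegral_supp _ M); last by move=> s /G0 ->; rewrite mul0r.
  by rewrite (@Rintegral_parts G G1 (A n) (fun s => 2 * e n / (e n ^+ 2 + (s - p) ^+ 2)))// gtrN.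
rewrite (_ : (fun n => _) = (fun n => - \int[mu]_(s in `[- M, M]) (G1 s * A n s))); last exact/funext.
rewrite -[2 * pi * _]opprK -Rintegral_sg; apply: cvgN.
have mG1 : measurable_fun setT G1 by exact: continuous_measurable_fun.
have mA n : measurable_fun setT (A n).
  exact (continuous_measurable_fun (is_derive_continuous (dA n))).
apply: (@Rintegral_dominated _ _ _ mu _ (fun n s => G1 s * A n s) _ (fun s => `|G1 s| * pi)) => //.
- by move=> n; exact (measurable_funTS (measurable_funM mG1 (mA n))).
- by move=> s _; apply: cvgMr; exact: cvg_atan_sg.
- apply: continuous_integrable_itv => s.
  apply: (@continuousM _ _ (fun s => `|G1 s|) (cst pi)); last exact: cst_continuous.
  by apply: continuous_comp; [exact: cG1|exact: norm_continuous].
- move=> n s _; rewrite normrM ler_wpM2l// /A normrM gtr0_norm//.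
  have h1 := atan_gtNpi2 ((s - p) * n.+1%:R); have h2 := atan_ltpi2 ((s - p) * n.+1%:R).
  have : `|atan ((s - p) * n.+1%:R)| <= pi / 2 by rewrite ler_norml !ltW.
  by lra.
Qed.

Let J (d xi : R) := \int[mu]_s (phase_cos p d xi s * G s).

Let mG : measurable_fun setT G. Proof. exact: continuous_measurable_fun. Qed.

Lemma measurable_phase_cos2 (d : R) :
  measurable_fun setT (fun z : R * R => phase_cos p d z.1 z.2).
Proof.
have mz : measurable_fun setT (fun z : R * R => z.1 * (p - z.2) + d).
  by apply: measurable_funD => //; apply: measurable_funM => //; exact: measurable_funB.
exact: (measurableT_comp (continuous_measurable_fun (@continuous_cos R)) mz).
Qed.

Let iG : mu.-integrable setT (EFin \o G).
Proof.
have := @continuous_integrable_itv G (- M) M cG.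
rewrite integrable_mkcond//; apply: eq_integrable => // s _.
rewrite patchE /=; case: ifPn => // sM; rewrite G0// leNgt.
by apply: contra sM => sM; rewrite mem_setE in_itv/= -ler_norml ltW.
Qed.

Let mJ d : measurable_fun setT (J d).
Proof.
apply: (@measurable_Rintegral_snd _ _ _ _ _ mu (fun z : R * R => phase_cos p d z.1 z.2 * G z.2)).
apply: measurable_funM; first exact: measurable_phase_cos2.
exact: measurableT_comp.
Qed.

Lemma fourier_inversion_integrable d : mu.-integrable setT (EFin \o J d).
Proof.
have i0 := integrable_EFinZl (4 * M * C) measurableT integrable_oneDsqrV.
apply: le_integrable i0 => //; first by apply/measurable_EFinP; exact (mJ d).
move=> xi _; rewrite /= lee_fin; apply: le_trans (ler_norm _).
exact: (phase_integral_bound M0 dG dG1 cG2 G0 G10 GC G2C).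
Qed.

(** The integrals damped by [expR (- (e n * |xi|))] have two limits. The decay of [J] lets the
    damping be removed under the integral ([l1]); Fubini, legitimate thanks to the damping, turns
    them into integrals against the Poisson kernel ([l2]), which tend to [2 * pi * G p]. *)
Lemma fourier_inversion d : \int[mu]_xi J d xi = 2 * pi * cos d * G p.
Proof.
have l1 : \int[mu]_xi (expR (- (e n * `|xi|)) * J d xi) @[n --> \oo] --> \int[mu]_xi J d xi.
  have i0 := integrable_EFinZl (4 * M * C) measurableT integrable_oneDsqrV.
  apply: (@Rintegral_dominated _ _ _ mu _ (fun n xi => expR (- (e n * `|xi|)) * J d xi) _
    (fun xi => (4 * M * C) * (1 + xi ^+ 2)^-1)) => //.
  - move=> n; have en0 : 0 < e n by rewrite invr_gt0.
    have mE : measurable_fun setT (fun x : R => expR (- (e n * `|x|))).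
      by apply/measurable_EFinP; exact: measurable_int (integrable_exp_norm en0).
    exact (measurable_funM mE (mJ d)).
  - move=> xi _; rewrite -[X in _ --> X]mul1r; apply: cvgMl.
    rewrite -expR0; apply: (@cvg_comp _ _ _ (fun n => - (e n * `|xi|)) (@expR R) _ (nbhs (0 : R))); last exact: continuous_expR.
    rewrite -oppr0 -(mul0r `|xi|); apply: cvgN; apply: cvgMl.
    exact: cvg_harmonic.
  - move=> n xi _; apply: le_trans (phase_integral_bound M0 dG dG1 cG2 G0 G10 GC G2C p d xi).
    rewrite normrM ger0_norm ?expR_ge0// ler_piMl// -expR0 ler_expR oppr_le0 mulr_ge0//.
    by rewrite invr_ge0.
have l2 n : \int[mu]_xi (expR (- (e n * `|xi|)) * J d xi) =
    cos d * \int[mu]_s (G s * (2 * e n / (e n ^+ 2 + (s - p) ^+ 2))).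
  have en0 : 0 < e n by rewrite invr_gt0.
  have iE := integrable_exp_norm en0.
  transitivity (\int[mu]_xi \int[mu]_s (expR (- (e n * `|xi|)) * (phase_cos p d xi s * G s))).
    apply: eq_Rintegral => xi _; rewrite RintegralZl//.
    apply: le_integrable iG => //.
      apply/measurable_EFinP; apply: measurable_funM => //.
      exact (continuous_measurable_fun (@continuous_phase_cos p d xi)).
    move=> s _; rewrite /= lee_fin normrM ler_piMl//.
    by rewrite ler_norml cos_geN1 cos_le1.
  rewrite (@Rintegral_fubini _ _ _ _ _ mu mu (fun z : R * R =>
    expR (- (e n * `|z.1|)) * (phase_cos p d z.1 z.2 * G z.2))
    (fun xi => expR (- (e n * `|xi|))) (fun s => `|G s|))//; last 3 first.
  - apply: measurable_funM.
      have mE : measurable_fun setT (fun x : R => expR (- (e n * `|x|))).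
        by apply/measurable_EFinP; exact: measurable_int iE.
      exact: measurableT_comp mE _.
    by apply: measurable_funM; [exact: measurable_phase_cos2|exact: measurableT_comp].
  - by have := integrable_abse iG; apply: eq_integrable.
  - move=> xi s; rewrite !normrM (ger0_norm (expR_ge0 _)) ler_wpM2l ?expR_ge0//.
    by rewrite ler_piMl// ler_norml cos_geN1 cos_le1.
  transitivity (\int[mu]_s (cos d * (G s * (2 * e n / (e n ^+ 2 + (s - p) ^+ 2))))).
    apply: eq_Rintegral => s _.
    transitivity (\int[mu]_xi (G s * (expR (- (e n * `|xi|)) * phase_cos p d xi s))).
      by apply: eq_Rintegral => xi _; ring.
    rewrite RintegralZl//; last first.
      apply: le_integrable iE => //.
        apply/measurable_EFinP; apply: measurable_funM.
          by apply/measurable_EFinP; exact: measurable_int (integrable_exp_norm en0).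
        exact (continuous_measurable_fun (@continuous_phase_cos_freq p s d)).
      move=> x _; rewrite /= lee_fin normrM ler_piMr// ler_norml.
      by rewrite cos_geN1 cos_le1.
    by rewrite Rintegral_exp_phase//; ring.
  rewrite RintegralZl//.
  (* The kernel is at most [2 / e n], its value at [s = p]. *)
  have i2 := integrable_EFinZr (2 * (e n)^-1) measurableT iG.
  apply: le_integrable i2 => //.
    apply/measurable_EFinP; apply: measurable_funM => //.
    exact (continuous_measurable_fun (@continuous_poisson (e n) p en0)).
  move=> s _; rewrite /= lee_fin !normrM ler_wpM2l// !ger0_norm ?invr_ge0 ?(ltW en0)//; last first.
    by rewrite addr_ge0 ?sqr_ge0.
  rewrite -mulrA ler_wpM2l// ler_pdivrMr ?ltr_pwDl ?sqr_ge0 ?exprn_gt0//.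
  by rewrite mulrDr expr2 mulKf ?gt_eqF// lerDl mulr_ge0 ?sqr_ge0// invr_ge0 ltW.
apply: (@cvg_unique _ (@Rhausdorff R) _ _ _ _ l1).
rewrite (_ : (fun n => _) = (fun n => cos d * \int[mu]_s (G s * (2 * e n / (e n ^+ 2 + (s - p) ^+ 2))))); last exact/funext.
rewrite (_ : 2 * pi * cos d * G p = cos d * (2 * pi * G p)); last by ring.
by apply: cvgMr; exact: poisson_cvg.
Qed.

End inversion.

End fourier_inversion.

(** * Euclidean vectors *)

Section vectors.
Context {R : realType}.

Lemma dotpC n (x y : 'rV[R]_n) : dotp x y = dotp y x.
Proof. by apply: eq_bigr => i _; rewrite mulrC. Qed.

Lemma dotpDl n (x y z : 'rV[R]_n) : dotp (x + y) z = dotp x z + dotp y z.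
Proof. by rewrite /dotp -big_split; apply: eq_bigr => i _; rewrite mxE mulrDl. Qed.

Lemma dotpZl n k (x y : 'rV[R]_n) : dotp (k *: x) y = k * dotp x y.
Proof. by rewrite /dotp mulr_sumr; apply: eq_bigr => i _; rewrite mxE mulrA. Qed.

Lemma dotpDr n (x y z : 'rV[R]_n) : dotp z (x + y) = dotp z x + dotp z y.
Proof. by rewrite dotpC dotpDl !(dotpC z). Qed.

Lemma dotpZr n k (x y : 'rV[R]_n) : dotp y (k *: x) = k * dotp y x.
Proof. by rewrite dotpC dotpZl dotpC. Qed.

Lemma dotpNl n (x y : 'rV[R]_n) : dotp (- x) y = - dotp x y.
Proof. by rewrite -scaleN1r dotpZl mulN1r. Qed.

Lemma dotpNr n (x y : 'rV[R]_n) : dotp x (- y) = - dotp x y.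
Proof. by rewrite dotpC dotpNl dotpC. Qed.

Lemma dotp_ge0 n (x : 'rV[R]_n) : 0 <= dotp x x.
Proof. by apply: sumr_ge0 => i _; rewrite -expr2 sqr_ge0. Qed.

Lemma sqr_enorm n (x : 'rV[R]_n) : enorm x ^+ 2 = dotp x x.
Proof. by rewrite sqr_sqrtr// dotp_ge0. Qed.

Lemma dotp0_eq0 n (x : 'rV[R]_n) : dotp x x = 0 -> x = 0.
Proof.
move=> /eqP; rewrite psumr_eq0; last by move=> i _; rewrite -expr2 sqr_ge0.
move=> /allP x0; apply/rowP => i; rewrite mxE.
by have := x0 i (mem_index_enum i); rewrite /= -expr2 sqrf_eq0 => /eqP.
Qed.

Lemma dotp_cons n (a b : R) (u w : 'rV[R]_n) :
  dotp (rV_cons (a, u)) (rV_cons (b, w)) = a * b + dotp u w.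
Proof.
rewrite /dotp big_ord_recl !rV_cons0; congr (_ + _).
by apply: eq_bigr => i _; rewrite !rV_consS.
Qed.

Lemma dotp2E (x y : 'rV[R]_2) : dotp x y = x 0 0 * y 0 0 + x 0 1 * y 0 1.
Proof.
rewrite /dotp !big_ord_recl big_ord0 addr0.
by rewrite (_ : lift ord0 ord0 = 1) //; exact/val_inj.
Qed.

Lemma dotp3E (x y : 'rV[R]_3) :
  dotp x y = x 0 0 * y 0 0 + x 0 1 * y 0 1 + x 0 2 * y 0 2.
Proof.
rewrite /dotp !big_ord_recl big_ord0 addr0 addrA.
rewrite (_ : lift ord0 ord0 = 1); last exact/val_inj.
by rewrite (_ : lift ord0 (lift ord0 ord0) = 2) //; exact/val_inj.
Qed.

Lemma crossp0 (x y : 'rV[R]_3) : crossp x y 0 0 = x 0 1 * y 0 2 - x 0 2 * y 0 1.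
Proof.
by rewrite mxE (_ : 0 + 1 = 1 :> 'I_3) 1?(_ : 0 + 2 = 2 :> 'I_3) //; exact/val_inj.
Qed.

Lemma crossp1 (x y : 'rV[R]_3) : crossp x y 0 1 = x 0 2 * y 0 0 - x 0 0 * y 0 2.
Proof.
rewrite mxE (_ : 1 + 1 = 2 :> 'I_3)//.
by rewrite (_ : 1 + 2 = 0 :> 'I_3) //; exact/val_inj.
Qed.

Lemma crossp2 (x y : 'rV[R]_3) : crossp x y 0 2 = x 0 0 * y 0 1 - x 0 1 * y 0 0.
Proof.
rewrite mxE (_ : 2 + 1 = 0 :> 'I_3); last exact/val_inj.
by rewrite (_ : 2 + 2 = 1 :> 'I_3) //; exact/val_inj.
Qed.

Definition croE := (crossp0, crossp1, crossp2).

Lemma dotp_crossp (x y : 'rV[R]_3) : dotp (crossp x y) (crossp x y) =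
  dotp x x * dotp y y - dotp x y ^+ 2.
Proof. by rewrite !dotp3E !croE; ring. Qed.

Lemma enormE n (x : 'rV[R]_n) (a : R) : 0 <= a -> dotp x x = a ^+ 2 -> enorm x = a.
Proof. by move=> a0 xa; rewrite /enorm xa sqrtr_sqr ger0_norm. Qed.

Lemma sphere2P (t : 'rV[R]_3) : sphere2 t -> dotp t t = 1.
Proof. by rewrite /sphere2 /= -sqr_enorm => ->; rewrite expr1n. Qed.

Lemma cylinder_eqE s (t x : 'rV[R]_3) :
  cylinder_eq s t x = dotp x x - dotp x t ^+ 2 - s.
Proof. by rewrite /cylinder_eq sqr_enorm. Qed.

Definition orthonormal (t n m : 'rV[R]_3) :=
  [/\ dotp t t = 1, dotp n n = 1 & dotp m m = 1] /\
  [/\ dotp t n = 0, dotp t m = 0 & dotp n m = 0].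

Lemma orthonormalNN t n m : orthonormal t n m -> orthonormal t (- n) (- m).
Proof.
by move=> [[h1 h2 h3] [h4 h5 h6]]; split; split; rewrite ?dotpNl ?dotpNr ?opprK ?h1 ?h2 ?h3 ?h4 ?h5 ?h6 ?oppr0.
Qed.

(** Let [M] have rows [t], [n], [m]. Orthonormality is [M *m M^T = 1]; for square matrices a right
    inverse is also a left one, so [x = x *m M^T *m M], which is the expansion. *)
Lemma orthonormal_expand t n m x : orthonormal t n m ->
  x = dotp x t *: t + dotp x n *: n + dotp x m *: m.
Proof.
move=> [[tt nn mm] [tn tm nm]].
pose M : 'M[R]_3 := \matrix_(i, j) (nth 0 [:: t; n; m] i) 0 j.
have ME i j : (M *m M^T) i j = dotp (nth 0 [:: t; n; m] i) (nth 0 [:: t; n; m] j).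
  by rewrite mxE; apply: eq_bigr => k _; rewrite !mxE.
have MM : M *m M^T = 1%:M.
  apply/matrixP => i j; rewrite ME mxE.
  case: i => -[|[|[|//]]] Hi; case: j => -[|[|[|//]]] Hj //=;
    by rewrite ?tt ?nn ?mm ?tn ?tm ?nm ?(dotpC n t) ?(dotpC m t) ?(dotpC m n) ?tn ?tm ?nm.
have xM : x = (x *m M^T) *m M by rewrite -mulmxA (mulmx1C MM) mulmx1.
rewrite [LHS]xM; apply/rowP => j; rewrite mxE.
rewrite !big_ord_recl big_ord0 addr0 !mxE addrA.
by congr (_ + _ + _); congr (_ * _); apply: eq_bigr => k _; rewrite !mxE.
Qed.

Lemma orthonormal_dotp t n m x : orthonormal t n m ->
  dotp x x = dotp x t ^+ 2 + dotp x n ^+ 2 + dotp x m ^+ 2.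
Proof.
move=> tnm; rewrite {1}(orthonormal_expand x tnm) !dotpDl !dotpZl.
by rewrite (dotpC t x) (dotpC n x) (dotpC m x); ring.
Qed.

Lemma orthonormal_crossp t n : dotp t t = 1 -> dotp n n = 1 -> dotp t n = 0 ->
  orthonormal t n (crossp t n).
Proof.
move=> tt nn tn; split; split => //.
- by rewrite dotp_crossp tt nn tn; ring.
- by rewrite dotp3E !croE; ring.
- by rewrite dotp3E !croE; ring.
Qed.

Lemma continuous_dotp n (w : 'rV[R]_n) : continuous (fun x => dotp x w).
Proof.
move=> x; rewrite /dotp; apply: (@smooth_on_cts _ _ _ setT) => //.
apply: smooth_on_sum; first exact: openT.
move=> i; rewrite (_ : (fun x => _) = fun x : 'rV[R]_n => w 0 i * x 0 i).
  by apply: smooth_onZ; [exact: openT|exact: smooth_on_coord].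
by apply/funext => y; rewrite mulrC.
Qed.

Lemma smooth_on_dotp (V : normedModType R) n (A : set V) (f g : V -> 'rV[R]_n) :
  open A -> smooth_on A f -> smooth_on A g -> smooth_on A (fun x => dotp (f x) (g x)).
Proof.
move=> oA sf sg; apply: smooth_on_sum; first exact: oA.
move=> i; exact (smooth_onM oA (smooth_on_coord_comp 0 i oA sf) (smooth_on_coord_comp 0 i oA sg)).
Qed.

Lemma smooth_on_id (V : normedModType R) (A : set V) : smooth_on A (@id V).
Proof. by apply: (@smooth_on_affine _ _ _ _ _ id) => // x; exact: cvg_id. Qed.

Lemma continuous_cylinder_eq s t : continuous (cylinder_eq s t : 'rV[R]_3 -> R).
Proof.
rewrite (_ : cylinder_eq s t = fun x => dotp x x - dotp x t ^+ 2 - s); last first.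
  by apply/funext => x; rewrite cylinder_eqE.
move=> x; apply: (@smooth_on_cts _ _ _ setT) => //.
have oT : open [set: 'rV[R]_3] by exact: openT.
have sid := @smooth_on_id 'rV[R]_3 setT.
have st := @smooth_on_cst _ 'rV[R]_3 'rV[R]_3 setT t.
exact (smooth_onB oT (smooth_onB oT (smooth_on_dotp oT sid sid)
  (smooth_onX 2 oT (smooth_on_dotp oT sid st))) (@smooth_on_cst _ _ _ _ s)).
Qed.

Lemma measurable_cylinder s t : measurable [set x : 'rV[R]_3 | cylinder_eq s t x = 0].
Proof.
have mc := continuous_rV_measurable (@continuous_cylinder_eq s t).
by have := mc measurableT [set 0] (measurable_set1 0); rewrite setTI; exact.
Qed.

End vectors.

Section null_sets.
Context {R : realType}.
Local Open Scope ereal_scope.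

(** The inner one-variable integral lives on the single point [a]. This is the source of all null
    sets below: generatrices in the rational chart, and the angles at which the direction is a
    pole. *)
Lemma integral_rV2_null (F : 'rV[R]_2 -> \bar R) (a : R) :
  measurable_fun setT F -> (forall v, 0 <= F v) ->
  (forall v : 'rV[R]_2, v 0%R 1%R != a -> F v = 0) ->
  \int[lebesgue_rV R 2]_v F v = 0.
Proof.
move=> mF F0 Fa; rewrite ge0_integral_rVS//.
rewrite (eq_integral (fun _ => 0)) ?integral0//= => s _.
rewrite ge0_integral_rV1//; last first.
  apply: measurableT_comp mF _; apply: measurableT_comp (@measurable_rV_cons R 1) _.
  exact: pair1_measurable.
rewrite (_ : (fun t => _) = (fun t => F (rV_cons (s, rV_cons (t, 0%R : 'rV[R]_0)))) \_ [set a]).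
  by rewrite -integral_mkcond integral_set1.
apply/funext => t; rewrite patchE; case: ifPn => // ta; apply: Fa.
rewrite (_ : 1%R = lift ord0 ord0); last exact/val_inj.
by rewrite rV_consS rV_cons0; apply: contra ta => /eqP <-; rewrite inE.
Qed.

End null_sets.

(** * Charts of the cylinder *)

Section cylinder_charts.
Context {R : realType}.
Local Notation mu2 := (lebesgue_rV R 2).
Implicit Types (t n m x : 'rV[R]_3) (v : 'rV[R]_2) (s : R).

Definition cyl s t : set 'rV[R]_3 := [set x | cylinder_eq s t x = 0].

Lemma vec2_0 (a b : R) : vec2 a b 0 0 = a. Proof. by rewrite mxE. Qed.
Lemma vec2_1 (a b : R) : vec2 a b 0 1 = b. Proof. by rewrite mxE. Qed.

Lemma vec2E v : v = vec2 (v 0 0) (v 0 1).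
Proof.
by apply/rowP => -[[|[|//]] Hi]; rewrite mxE /=; congr (v _ _); exact/val_inj.
Qed.

(** Cosine and sine in terms of the tangent [w] of the half angle, with inverse [d / (1 + c)]. They
    parameterize the circle without the point [(-1, 0)] injectively by the whole line, so no period
    has to be cut. *)
Definition ccos (w : R) := (1 - w ^+ 2) / (1 + w ^+ 2).
Definition csin (w : R) := 2 * w / (1 + w ^+ 2).

Lemma oneDsqr_neq0 (w : R) : 1 + w ^+ 2 != 0.
Proof. by rewrite gt_eqF// ltr_pwDl// sqr_ge0. Qed.

Lemma ccos_csin w : ccos w ^+ 2 + csin w ^+ 2 = 1.
Proof. by rewrite /ccos /csin; field; exact: oneDsqr_neq0. Qed.

Lemma ccosK w : csin w / (1 + ccos w) = w.
Proof.
have h := oneDsqr_neq0 w; rewrite /ccos /csin.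
have -> : 1 + (1 - w ^+ 2) / (1 + w ^+ 2) = 2 / (1 + w ^+ 2) by field.
by field.
Qed.

Lemma csinK (c d : R) : c ^+ 2 + d ^+ 2 = 1 -> c != -1 ->
  ccos (d / (1 + c)) = c /\ csin (d / (1 + c)) = d.
Proof.
move=> cd c1; have h : 1 + c != 0.
  by apply: contra c1 => /eqP h; apply/eqP; rewrite -[LHS](addKr 1) h addr0.
have dE : d ^+ 2 = 1 - c ^+ 2 by rewrite -cd addrC addKr.
have E : 1 + (d / (1 + c)) ^+ 2 = 2 / (1 + c).
  by rewrite expr_div_n dE; field.
by rewrite /ccos /csin E; split; first (rewrite expr_div_n dE); field.
Qed.

(* Rational parameterization of the cylinder of axis [t] and radius [r]; it misses
   only the generatrix through [- r *: n], and [rjac] is its area element. *)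
Definition rchart t n m (r : R) (v : 'rV[R]_2) : 'rV[R]_3 :=
  v 0 0 *: t + (r * ccos (v 0 1)) *: n + (r * csin (v 0 1)) *: m.

Definition rjac (r : R) (v : 'rV[R]_2) : R := 2 * r / (1 + v 0 1 ^+ 2).

Lemma smooth_oneDsqrV_coord : smooth_on setT (fun v : 'rV[R]_2 => (1 + v 0 1 ^+ 2)^-1).
Proof.
have oT : open [set: 'rV[R]_2] by exact: openT.
have s1 := @smooth_on_coord R 2 setT 0 1.
have sq : smooth_on setT (fun v : 'rV[R]_2 => 1 + v 0 1 ^+ 2).
  exact (smooth_onD oT (@smooth_on_cst R _ R setT 1) (smooth_onX 2 oT s1)).
by apply: (smooth_onV oT _ sq) => v _; rewrite ltr_pwDl// sqr_ge0.
Qed.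

Lemma smooth_rchart t n m r : smooth_on setT (rchart t n m r).
Proof.
have oT : open [set: 'rV[R]_2] by exact: openT.
have s0 i := @smooth_on_coord R 2 setT 0 i.
have sV := smooth_oneDsqrV_coord.
have sc : smooth_on setT (fun v : 'rV[R]_2 => ccos (v 0 1)).
  exact (smooth_onM oT (smooth_onB oT (@smooth_on_cst R _ R setT 1) (smooth_onX 2 oT (s0 1))) sV).
have ss : smooth_on setT (fun v : 'rV[R]_2 => csin (v 0 1)).
  exact (smooth_onM oT (smooth_onZ 2 oT (s0 1)) sV).
apply: (smooth_on_rV oT) => i.
rewrite (_ : (fun v => _) = fun v : 'rV[R]_2 => t 0 i * v 0 0 + r * n 0 i * ccos (v 0 1) + r * m 0 i * csin (v 0 1)).
  exact (smooth_onD oT (smooth_onD oT (smooth_onZ _ oT (s0 0)) (smooth_onZ _ oT sc)) (smooth_onZ _ oT ss)).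
by apply/funext => v; rewrite !mxE; ring.
Qed.

Lemma dpar1_rchart t n m r v : dpar1 (rchart t n m r) v = t.
Proof.
have D : is_derive v (vec2 1 0) (rchart t n m r) t.
  apply: is_derive_affine => h; rewrite /rchart !mxE /= mulr0 add0r mulr1.
  by rewrite scalerDl !addrA.
by case: D.
Qed.

Lemma dpar2_rchart t n m r v : dpar2 (rchart t n m r) v =
  (r * (- 4 * v 0 1 / (1 + v 0 1 ^+ 2) ^+ 2)) *: n +
  (r * (2 * (1 - v 0 1 ^+ 2) / (1 + v 0 1 ^+ 2) ^+ 2)) *: m.
Proof.
have h := oneDsqr_neq0 (v 0 1).
have dV (w : R) : is_derive w (1 : R) (fun w => (1 + w ^+ 2)^-1) (- (2 * w) / (1 + w ^+ 2) ^+ 2).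
  have hw := oneDsqr_neq0 w.
  by apply: is_derive_eq; rewrite /GRing.scale /=; field.
have dc (w : R) : is_derive w (1 : R) (fun w => r * ccos w) (r * (- 4 * w / (1 + w ^+ 2) ^+ 2)).
  have hw := oneDsqr_neq0 w; have dVw := dV w.
  rewrite /ccos; apply: is_derive_eq; rewrite /GRing.scale /=; field.
  by [].
have ds (w : R) : is_derive w (1 : R) (fun w => r * csin w) (r * (2 * (1 - w ^+ 2) / (1 + w ^+ 2) ^+ 2)).
  have hw := oneDsqr_neq0 w; have dVw := dV w.
  rewrite /csin; apply: is_derive_eq; rewrite /GRing.scale /=; field.
  by [].
have dcoord : is_derive v (vec2 0 1) (fun v : 'rV[R]_2 => v 0 1) (1 : R).
  by apply: is_derive_affine => k; rewrite !mxE.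
have LP (u : 'rV[R]_3) (k a b : R) : (k *: a + b) *: u = k *: (a *: u) + b *: u.
  by rewrite scalerDl scalerA.
have cL (u : 'rV[R]_3) : continuous (fun a : R => a *: u) by move=> a; exact: scalel_continuous.
have D1 : is_derive v (vec2 0 1) (fun v => (r * ccos (v 0 1)) *: n)
    ((r * (- 4 * v 0 1 / (1 + v 0 1 ^+ 2) ^+ 2) * 1) *: n).
  exact: (@is_derive_lin_comp _ _ _ _ (fun a : R => a *: n) _ _ _ _ (LP n) (cL n) (is_derive_comp1 (dc (v 0 1)) dcoord)).
have D2 : is_derive v (vec2 0 1) (fun v => (r * csin (v 0 1)) *: m)
    ((r * (2 * (1 - v 0 1 ^+ 2) / (1 + v 0 1 ^+ 2) ^+ 2) * 1) *: m).
  exact: (@is_derive_lin_comp _ _ _ _ (fun a : R => a *: m) _ _ _ _ (LP m) (cL m) (is_derive_comp1 (ds (v 0 1)) dcoord)).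
have D0 : is_derive v (vec2 0 1) (fun v : 'rV[R]_2 => v 0 0 *: t) 0.
  by apply: is_derive_affine => k; rewrite !mxE /= mulr0 add0r scaler0 add0r.
have D : is_derive v (vec2 0 1) (rchart t n m r) _ := is_deriveD (is_deriveD D0 D1) D2.
by case: D => _; rewrite /dpar2 => ->; rewrite add0r !mulr1.
Qed.

Lemma enorm_crossp_rchart t n m r v : orthonormal t n m -> 0 < r ->
  enorm (crossp (dpar1 (rchart t n m r) v) (dpar2 (rchart t n m r) v)) = rjac r v.
Proof.
move=> [[tt nn mm] [tn tm nm]] r0; have h := oneDsqr_neq0 (v 0 1).
apply: enormE.
  by rewrite /rjac divr_ge0 ?mulr_ge0 ?addr_ge0 ?sqr_ge0// ltW.
rewrite dotp_crossp dpar1_rchart dpar2_rchart !dotpDr !dotpDl !dotpZr !dotpZl.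
rewrite (dotpC m n) tt nn mm tn tm nm /rjac; field.
by [].
Qed.

Lemma dotp_rchart t n m r v : orthonormal t n m ->
  [/\ dotp (rchart t n m r v) t = v 0 0,
      dotp (rchart t n m r v) n = r * ccos (v 0 1) &
      dotp (rchart t n m r v) m = r * csin (v 0 1)].
Proof.
move=> [[tt nn mm] [tn tm nm]]; rewrite /rchart !dotpDl !dotpZl.
rewrite (dotpC n t) (dotpC m t) (dotpC m n) tt nn mm tn tm nm.
by split; ring.
Qed.

Lemma rchart_cyl t n m r v : orthonormal t n m -> cyl (r ^+ 2) t (rchart t n m r v).
Proof.
move=> tnm; rewrite /cyl /= cylinder_eqE (orthonormal_dotp _ tnm).
have [-> -> ->] := dotp_rchart r v tnm.
have E : csin (v 0 1) ^+ 2 = 1 - ccos (v 0 1) ^+ 2.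
  by rewrite -(ccos_csin (v 0 1)) addrC addKr.
by rewrite [(r * ccos _) ^+ 2]exprMn [(r * csin _) ^+ 2]exprMn E; ring.
Qed.

Lemma rchart_parameterization t n m r : orthonormal t n m -> 0 < r ->
  local_parameterization (cyl (r ^+ 2) t) setT (rchart t n m r).
Proof.
move=> tnm r0; split.
- exact: openT.
- exact: smooth_rchart.
- move=> v w _ _ E.
  have [a1 a2 a3] := dotp_rchart r v tnm; have [b1 b2 b3] := dotp_rchart r w tnm.
  rewrite (vec2E v) (vec2E w) -a1 -b1 E; congr vec2.
  rewrite -(ccosK (v 0 1)) -(ccosK (w 0 1)).
  have rn : r != 0 by rewrite gt_eqF.
  have -> : ccos (v 0 1) = ccos (w 0 1) by apply: (mulfI rn); rewrite -a2 -b2 E.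
  by have -> : csin (v 0 1) = csin (w 0 1) by apply: (mulfI rn); rewrite -a3 -b3 E.
- by move=> v _; exact: rchart_cyl.
- move=> v _; apply/eqP => E.
  have := enorm_crossp_rchart v tnm r0; rewrite E => H.
  have : 0 < rjac r v by rewrite /rjac divr_gt0 ?mulr_gt0// ltr_pwDl// sqr_ge0.
  by rewrite -H /enorm /dotp big1 ?sqrtr0 ?ltxx// => i _; rewrite mxE mul0r.
Qed.

Lemma image_rchart t n m r : orthonormal t n m -> 0 < r ->
  rchart t n m r @` setT = cyl (r ^+ 2) t `&` [set x | dotp x n != - r].
Proof.
move=> tnm r0; have rn : r != 0 by rewrite gt_eqF.
apply/seteqP; split => [_ [v _ <-]|x [xc xn]].
  split; first exact: rchart_cyl.
  rewrite /=; have [_ -> _] := dotp_rchart r v tnm.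
  apply/eqP => E; have {}E : ccos (v 0 1) = -1.
    by apply: (mulfI rn); rewrite E mulrN1.
  have := ccos_csin (v 0 1); rewrite E sqrrN expr1n => /eqP.
  rewrite -subr_eq0 addrAC subrr add0r sqrf_eq0 => /eqP S0.
  have := ccosK (v 0 1); rewrite S0 mul0r => V0.
  by move: E; rewrite -V0 /ccos expr0n/= subr0 addr0 divr1; lra.
have nm1 : (dotp x n / r) ^+ 2 + (dotp x m / r) ^+ 2 = 1.
  move: xc; rewrite /cyl /= cylinder_eqE (orthonormal_dotp x tnm) => H.
  have -> : (dotp x n / r) ^+ 2 + (dotp x m / r) ^+ 2 =
    (dotp x t ^+ 2 + dotp x n ^+ 2 + dotp x m ^+ 2 - dotp x t ^+ 2 - r ^+ 2) / r ^+ 2 + 1 by field.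
  by rewrite H mul0r add0r.
have xr : dotp x n / r != -1.
  by apply: contra xn => /eqP E; apply/eqP; rewrite -mulN1r -E divfK.
have [E1 E2] := csinK nm1 xr.
exists (vec2 (dotp x t) (dotp x m / r / (1 + dotp x n / r))) => //.
rewrite /rchart vec2_0 vec2_1 E1 E2 [RHS](orthonormal_expand x tnm).
by congr (_ + _ *: _ + _ *: _); field.
Qed.

(** * Null generatrices and integration in the rational chart *)

Section surface_measure.
Variables (s : R) (t n m : 'rV[R]_3) (sg : {measure set 'rV[R]_3 -> \bar R}).
Hypotheses (s0 : 0 < s) (tnm : orthonormal t n m) (hsg : is_surface_measure (cyl s t) sg).
Local Open Scope ereal_scope.

Let r : R := Num.sqrt s.
Let r0 : (0 < r)%R. Proof. by rewrite sqrtr_gt0. Qed.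
Let r2 : (r ^+ 2 = s)%R. Proof. by rewrite sqr_sqrtr// ltW. Qed.

Lemma measurable_dotp (w : 'rV[R]_3) : measurable_fun setT (fun x => dotp x w).
Proof. exact: continuous_rV_measurable (@continuous_dotp R 3 w). Qed.

Lemma measurable_dotp_eq (w : 'rV[R]_3) (a : R) : measurable [set x | dotp x w = a].
Proof.
by have := measurable_dotp w measurableT (measurable_set1 a); rewrite setTI; exact.
Qed.

Lemma measurable_image_rchart : measurable (rchart t n m r @` setT).
Proof.
rewrite image_rchart// r2; apply: measurableI; first exact: measurable_cylinder.
rewrite (_ : [set x | _] = ~` [set x | dotp x n = (- r)%R]).
  by apply: measurableC; exact: measurable_dotp_eq.
by apply/seteqP; split=> x /= /eqP.
Qed.

Lemma measurable_rchart : measurable_fun setT (rchart t n m r).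
Proof.
apply/measurable_fun_rVP => i; apply: continuous_rV_measurable => v.
have oT : open [set: 'rV[R]_2] by exact: openT.
have := smooth_on_coord_comp ord0 i oT (smooth_rchart t n m r).
by move=> /smooth_on_cts; apply.
Qed.

Lemma measurable_rjac : measurable_fun setT (rjac r).
Proof.
apply: measurable_funM => //; apply: continuous_rV_measurable => v.
by have := smooth_on_cts smooth_oneDsqrV_coord; apply.
Qed.

Lemma surface_integral_rchart (F : 'rV[R]_3 -> \bar R) :
  measurable_fun setT F -> (forall x, 0 <= F x) ->
  \int[sg]_(x in rchart t n m r @` setT) F x =
  \int[mu2]_v (F (rchart t n m r v) * (rjac r v)%:E).
Proof.
move=> mF F0; have [_ H] := hsg.
rewrite (H setT (rchart t n m r) _ F mF F0); last first.
  by rewrite -r2; exact: rchart_parameterization.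
by apply: eq_integral => v _; rewrite (enorm_crossp_rchart v tnm r0).
Qed.

(** Surface measures are known only through charts, so the generatrix missed by one chart must be
    seen to be null in another. The line [dotp x n = r] is opposite to the missed one and
    corresponds to [v 0 1 = 0]; for the frame with [n] and [m] negated it becomes the line missed by
    the original chart. *)
Lemma generatrix_null : sg (cyl s t `&` [set x | dotp x n = r]) = 0.
Proof.
pose E := cyl s t `&` [set x | dotp x n = r].
have mE : measurable E by apply: measurableI; [exact: measurable_cylinder|exact: measurable_dotp_eq].
have EI : E `<=` rchart t n m r @` setT.
  rewrite image_rchart// r2 => x [xc xn]; split => //=.
  by rewrite xn gt_eqF// (@lt_trans _ _ 0%R)// oppr_lt0.
have := @surface_integral_rchart (EFin \o \1_E) _ _.
rewrite integral_indic//; last exact: measurable_image_rchart.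
rewrite setIidl// => ->.
- apply: (@integral_rV2_null _ _ 0%R).
  + apply: emeasurable_funM; last by apply/measurable_EFinP; exact: measurable_rjac.
    apply/measurable_EFinP; apply: measurableT_comp; first exact: measurable_indic.
    exact: measurable_rchart.
  + move=> v; rewrite -EFinM lee_fin mulr_ge0// /rjac.
    by rewrite divr_ge0 ?mulr_ge0 ?addr_ge0 ?sqr_ge0// ltW.
  (* On the line [ccos (v 0 1) = 1], which forces [v 0 1 = 0]. *)
  + move=> v v1; rewrite /= indicE memNset ?mul0e// => -[_ /=].
    have [_ -> _] := dotp_rchart r v tnm.
    rewrite -[RHS]mulr1 => /(mulfI (lt0r_neq0 r0)); rewrite /ccos => E1.
    have := oneDsqr_neq0 (v 0 1)%R => h.
    have : (1 - v 0 1 ^+ 2 = 1 + v 0 1 ^+ 2)%R.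
      by rewrite -[LHS](divfK h) E1 mul1r.
    move=> /eqP; rewrite -subr_eq0 opprD addrACA subrr add0r -opprD oppr_eq0.
    by rewrite -mulr2n mulrn_eq0/= sqrf_eq0 (negbTE v1).
- by apply/measurable_EFinP; exact: measurable_indic.
- by move=> x; rewrite lee_fin.
Qed.

End surface_measure.

Lemma integral_cyl_rchart s t n m (sg : {measure set 'rV[R]_3 -> \bar R})
    (F : 'rV[R]_3 -> \bar R) :
  0 < s -> orthonormal t n m -> is_surface_measure (cyl s t) sg ->
  measurable_fun setT F -> (forall x, (0 <= F x)%E) ->
  (\int[sg]_(x in cyl s t) F x =
   \int[mu2]_v (F (rchart t n m (Num.sqrt s) v) * (rjac (Num.sqrt s) v)%:E))%E.
Proof.
move=> s0 tnm hsg mF F0; rewrite -(surface_integral_rchart s0 tnm hsg)//.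
have r0 : 0 < Num.sqrt s by rewrite sqrtr_gt0.
have r2 : Num.sqrt s ^+ 2 = s by rewrite sqr_sqrtr// ltW.
pose N := cyl s t `&` [set x | dotp x (- n) = Num.sqrt s].
have mN : measurable N.
  by apply: measurableI; [exact: measurable_cylinder|exact: measurable_dotp_eq].
have EN : cyl s t = rchart t n m (Num.sqrt s) @` setT `|` N.
  rewrite image_rchart// r2; apply/seteqP; split=> x.
    move=> xc; have [xn|xn] := eqVneq (dotp x n) (- Num.sqrt s); last by left.
    by right; split => //=; rewrite dotpNr xn opprK.
  by case=> -[].
rewrite {1}EN ge0_integral_setU//.
- rewrite [X in (_ + X)%E](_ : _ = 0%E) ?adde0//.
  apply: null_set_integral => //; first exact: measurable_funTS.
  exact: generatrix_null s0 (orthonormalNN tnm) hsg.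
- exact: measurable_image_rchart.
- exact: measurable_funTS.
- apply/disj_setPS => x []; rewrite image_rchart// r2 => -[_ /= xn] [_ /=].
  by rewrite dotpNr => E; move: xn; rewrite -E opprK eqxx.
Qed.

(** The left-hand side is [1] plus the squared gradient of [gh], the squared area element of its
    graph. The gradient has a component along [w] and one along [u - (u . w) w / A]; these are
    orthogonal and the latter vector has squared norm [q], whence the collapse. [k] stands for the
    quotient with a square root, of which only the square enters. *)
Lemma gjac_algebra (a A w0 w1 u0 u1 s q k : R) :
  a ^+ 2 + A = 1 -> A != 0 -> s - q != 0 -> k ^+ 2 = A / (s - q) ->
  A = w0 * w0 + w1 * w1 ->
  q = u0 * u0 + u1 * u1 - (u0 * w0 + u1 * w1) ^+ 2 / A ->
  1 + (a * w0 / A - k / A * (u0 - (u0 * w0 + u1 * w1) * w0 / A)) ^+ 2 +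
      (a * w1 / A - k / A * (u1 - (u0 * w0 + u1 * w1) * w1 / A)) ^+ 2 =
  s / (A * (s - q)).
Proof.
move=> aA A0 sq k2 AE qE.
have -> : 1 + (a * w0 / A - k / A * (u0 - (u0 * w0 + u1 * w1) * w0 / A)) ^+ 2 +
      (a * w1 / A - k / A * (u1 - (u0 * w0 + u1 * w1) * w1 / A)) ^+ 2 =
   1 + a ^+ 2 / A + k ^+ 2 / A ^+ 2 * q.
  by rewrite qE AE; field; rewrite -AE.
rewrite k2; have -> : a ^+ 2 = 1 - A by rewrite -aA addrK.
by field; rewrite sq A0.
Qed.

(** * The cylinder as two graphs over the last two coordinates *)

Section graph_charts.
Implicit Types (w u : 'rV[R]_2) (a tau : R).

(* For a unit axis [(a, w)] with [w != 0], the equation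
   [|x|^2 - (x . (a, w))^2 = s] at [x = (x0, u)] reads
   [|w|^2 (x0 - gc a w u)^2 + gq w u = s]. *)
Definition gq w u := dotp u u - dotp u w ^+ 2 / dotp w w.
Definition gc a w u := a * dotp u w / dotp w w.
(** For [tau] equal to [1] or [- 1] these are the two roots [x0] of the equation; [gdom] below is
    the open shadow of the cylinder, where the roots are distinct. *)
Definition gh a w s tau u := gc a w u + tau * Num.sqrt ((s - gq w u) / dotp w w).
Definition gchart a w s tau u : 'rV[R]_3 := rV_cons (gh a w s tau u, u).
Definition gdom w s : set 'rV[R]_2 := [set u | gq w u < s].
Definition gjac w s u := Num.sqrt (s / (dotp w w * (s - gq w u))).
Definition tl x : 'rV[R]_2 := \row_(i < 2) x 0 (lift ord0 i).

Lemma tl_cons (p : R * 'rV[R]_2) : tl (rV_cons p) = p.2.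
Proof. by apply/rowP => i; rewrite mxE rV_consS. Qed.

Lemma cylinder_eq_cons a w s (x0 : R) u : a ^+ 2 + dotp w w = 1 -> dotp w w != 0 ->
  cylinder_eq s (rV_cons (a, w)) (rV_cons (x0, u)) =
  dotp w w * (x0 - gc a w u) ^+ 2 + gq w u - s.
Proof.
rewrite cylinder_eqE !dotp_cons /gc /gq => aA.
have -> : dotp w w = 1 - a ^+ 2 by rewrite -aA addrC addKr.
by move=> A0; field.
Qed.

Variables (a : R) (w : 'rV[R]_2) (s : R) (tau : R).
Hypotheses (aw : a ^+ 2 + dotp w w = 1) (w0 : 0 < dotp w w) (s0 : 0 < s)
  (tau2 : tau ^+ 2 = 1).
Local Notation t := (rV_cons (a, w)).

Let wn : dotp w w != 0. Proof. by rewrite gt_eqF. Qed.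

Lemma smooth_gq : smooth_on setT (gq w).
Proof.
have oT : open [set: 'rV[R]_2] by exact: openT.
have sid := @smooth_on_id R 'rV[R]_2 setT.
have sd := smooth_on_dotp oT sid (@smooth_on_cst R 'rV[R]_2 'rV[R]_2 setT w).
rewrite (_ : gq w = fun u => dotp u u - (dotp w w)^-1 * (dotp u w) ^+ 2).
  exact (smooth_onB oT (smooth_on_dotp oT sid sid) (smooth_onZ _ oT (smooth_onX 2 oT sd))).
by apply/funext => u; rewrite /gq mulrC.
Qed.

Lemma continuous_gq : continuous (gq w).
Proof. by move=> u; have := smooth_on_cts smooth_gq; apply. Qed.

Lemma open_gdom : open (gdom w s).
Proof.
rewrite (_ : gdom w s = gq w @^-1` [set y | y < s])//.
by apply: open_comp; [move=> u _; exact: continuous_gq|exact: open_lt].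
Qed.

Let disc_gt0 u : gdom w s u -> 0 < (s - gq w u) / dotp w w.
Proof. by rewrite /gdom /= -subr_gt0 => h; rewrite divr_gt0. Qed.

Lemma smooth_gh : smooth_on (gdom w s) (gh a w s tau).
Proof.
have oO := open_gdom.
have sid := @smooth_on_id R 'rV[R]_2 (gdom w s).
have sd := smooth_on_dotp oO sid (@smooth_on_cst R 'rV[R]_2 'rV[R]_2 (gdom w s) w).
have sq := sub_smooth_on (@subsetT _ (gdom w s)) smooth_gq.
have sD := smooth_onB oO (@smooth_on_cst R 'rV[R]_2 R (gdom w s) s) sq.
have sA := smooth_onM oO sD (@smooth_on_cst R 'rV[R]_2 R (gdom w s) (dotp w w)^-1).
have sS := smooth_on_sqrt oO disc_gt0 sA.
have sc := smooth_onZ (a / dotp w w) oO sd.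
rewrite (_ : gh a w s tau = fun u => a / dotp w w * dotp u w + tau * Num.sqrt ((s - gq w u) / dotp w w)).
  exact (smooth_onD oO sc (smooth_onZ tau oO sS)).
by apply/funext => u; rewrite /gh /gc mulrAC.
Qed.

Lemma smooth_gchart : smooth_on (gdom w s) (gchart a w s tau).
Proof.
apply: (smooth_on_rV open_gdom) => i; case: (unliftP ord0 i) => [j ->|->].
  rewrite (_ : (fun u => _) = fun u : 'rV[R]_2 => u 0 j); first exact: smooth_on_coord.
  by apply/funext => u; rewrite /gchart rV_consS.
rewrite (_ : (fun u => _) = gh a w s tau); first exact smooth_gh.
by apply/funext => u; rewrite /gchart rV_cons0.
Qed.

Lemma gh_root u : gdom w s u ->
  dotp w w * (gh a w s tau u - gc a w u) ^+ 2 + gq w u - s = 0.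
Proof.
move=> /disc_gt0 h.
have -> : gh a w s tau u - gc a w u = tau * Num.sqrt ((s - gq w u) / dotp w w).
  by rewrite /gh addrAC subrr add0r.
rewrite exprMn tau2 mul1r sqr_sqrtr ?ltW//.
by field.
Qed.

Lemma gchart_cyl u : gdom w s u -> cyl s t (gchart a w s tau u).
Proof. by move=> Ou; rewrite /cyl /= cylinder_eq_cons// gh_root. Qed.

Lemma is_derive_gh u v : gdom w s u ->
  is_derive u v (gh a w s tau) (a * dotp v w / dotp w w -
    tau / (dotp w w * Num.sqrt ((s - gq w u) / dotp w w)) * (dotp u v - dotp u w * dotp v w / dotp w w)).
Proof.
move=> /disc_gt0 h.
have dw : is_derive u v (fun u => dotp u w) (dotp v w).
  by apply: is_derive_affine => k; rewrite dotpDl dotpZl.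
have dc i : is_derive u v (fun u : 'rV[R]_2 => u 0 i) (v 0 i).
  by apply: is_derive_affine => k; rewrite !mxE.
have du : is_derive u v (fun u => dotp u u) (2 * dotp u v).
  rewrite (_ : (fun u => _) = (fun u : 'rV[R]_2 => u 0 0 * u 0 0 + u 0 1 * u 0 1)); last first.
    by apply/funext => x; rewrite dotp2E.
  by have d0 := dc 0; have d1 := dc 1; apply: is_derive_eq; rewrite /GRing.scale /= dotp2E; ring.
have dq : is_derive u v (fun u => (s - gq w u) / dotp w w)
    (- (2 * dotp u v - 2 * dotp u w * dotp v w / dotp w w) / dotp w w).
  by rewrite /gq; apply: is_derive_eq; rewrite /GRing.scale /=; field.
have dS := @is_derive_comp1 R _ Num.sqrt (fun u => (s - gq w u) / dotp w w) u v _ _ (is_derive1_sqrt h) dq.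
have S0 : Num.sqrt ((s - gq w u) / dotp w w) != 0 by rewrite gt_eqF// sqrtr_gt0.
rewrite /gh /gc; apply: is_derive_eq; rewrite /GRing.scale /=.
by move: S0; move: (Num.sqrt _) => S S0; field; rewrite wn S0.
Qed.

Lemma derive_gchart u v : gdom w s u ->
  'D_v (gchart a w s tau) u = rV_cons ('D_v (gh a w s tau) u, v).
Proof.
move=> Ou; have dh := is_derive_gh v Ou.
rewrite derive_mx; last exact: smooth_on_derivable smooth_gchart Ou.
apply/rowP => i; rewrite mxE; case: (unliftP ord0 i) => [j ->|->].
  rewrite rV_consS (_ : (fun u => _) = fun u : 'rV[R]_2 => u 0 j); last first.
    by apply/funext => x; rewrite /gchart rV_consS.
  have D : is_derive u v (fun u : 'rV[R]_2 => u 0 j) (v 0 j).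
    by apply: is_derive_affine => k; rewrite !mxE.
  by case: D.
rewrite rV_cons0; congr ('D_v _ u).
by apply/funext => x; rewrite /gchart rV_cons0.
Qed.

Lemma rV3_cons_coord (p : R * 'rV[R]_2) : [/\ (rV_cons p : 'rV_3) 0 0 = p.1,
  (rV_cons p : 'rV_3) 0 1 = p.2 0 0 & (rV_cons p : 'rV_3) 0 2 = p.2 0 1].
Proof.
have E1 : (1 : 'I_3) = lift ord0 0 by exact/val_inj.
have E2 : (2 : 'I_3) = lift ord0 1 by exact/val_inj.
by split; [exact: rV_cons0|rewrite E1 rV_consS|rewrite E2 rV_consS].
Qed.

Lemma enorm_crossp_gchart u : gdom w s u ->
  enorm (crossp (dpar1 (gchart a w s tau) u) (dpar2 (gchart a w s tau) u)) = gjac w s u.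
Proof.
move=> Ou; rewrite /dpar1 /dpar2 !derive_gchart//.
set h1 := 'D_ _ _ _; set h2 := 'D_ _ _ _.
have h1E : h1 = _ := @derive_val _ _ _ _ _ _ _ (is_derive_gh (vec2 1 0) Ou).
have h2E : h2 = _ := @derive_val _ _ _ _ _ _ _ (is_derive_gh (vec2 0 1) Ou).
have dg : 0 < s - gq w u by rewrite subr_gt0.
have [p0 p1 p2] := rV3_cons_coord (h1, vec2 1 0).
have [q0 q1 q2] := rV3_cons_coord (h2, vec2 0 1).
rewrite /= !vec2_0 !vec2_1 in p0 p1 p2 q0 q1 q2.
apply: enormE; first exact: sqrtr_ge0.
rewrite dotp3E !croE p0 p1 p2 q0 q1 q2.
rewrite sqr_sqrtr; last by rewrite divr_ge0 ?mulr_ge0 ?(ltW w0) ?(ltW s0) ?(ltW dg).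
rewrite h1E h2E.
have -> (k : R) : tau / (dotp w w * k) = (tau / k) / dotp w w by rewrite invfM mulrA mulrAC.
set k := tau / _.
have k2 : k ^+ 2 = dotp w w / (s - gq w u).
  rewrite /k expr_div_n tau2 sqr_sqrtr ?ltW ?disc_gt0// div1r invf_div.
  by [].
have AE := dotp2E w w.
have qE : gq w u = u 0 0 * u 0 0 + u 0 1 * u 0 1 - (u 0 0 * w 0 0 + u 0 1 * w 0 1) ^+ 2 / dotp w w.
  by rewrite /gq (dotp2E u u) (dotp2E u w).
rewrite -(gjac_algebra aw wn (lt0r_neq0 dg) k2 AE qE).
rewrite (dotp2E (vec2 1 0)) (dotp2E (vec2 0 1)) !(dotp2E u) !vec2_0 !vec2_1.
by ring.
Qed.

Lemma gjac_gt0 u : gdom w s u -> 0 < gjac w s u.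
Proof. by move=> Ou; rewrite sqrtr_gt0 divr_gt0 ?mulr_gt0// subr_gt0. Qed.

Lemma gchart_parameterization :
  local_parameterization (cyl s t) (gdom w s) (gchart a w s tau).
Proof.
split.
- exact: open_gdom.
- exact smooth_gchart.
- by move=> u v _ _ /(congr1 tl); rewrite !tl_cons.
- exact: gchart_cyl.
- move=> u Ou; apply/eqP => E; have := gjac_gt0 Ou.
  rewrite -enorm_crossp_gchart// E /enorm /dotp big1 ?sqrtr0 ?ltxx// => i _.
  by rewrite mxE mul0r.
Qed.

Lemma image_gchart : gchart a w s tau @` gdom w s =
  cyl s t `&` [set x : 'rV[R]_3 | 0 < tau * (x 0 0 - gc a w (tl x))].
Proof.
apply/seteqP; split=> [_ [u Ou <-]|x [xc xt]].
  split; first exact: gchart_cyl.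
  rewrite /= tl_cons /gchart; have [-> _ _] := rV3_cons_coord (gh a w s tau u, u).
  rewrite /= /gh addrAC subrr add0r mulrA -expr2 tau2 mul1r sqrtr_gt0.
  exact: disc_gt0.
have xE := rV_consE x; rewrite -/(tl x) in xE; set u := tl x in xE xt.
have := xc; rewrite /cyl /= xE cylinder_eq_cons// => H.
rewrite /= (_ : x 0 0 = x 0 ord0)// in xt.
move: H xt xE; set y := x 0 ord0 => H xt xE.
have yq : (s - gq w u) / dotp w w = (tau * (y - gc a w u)) ^+ 2.
  rewrite exprMn tau2 mul1r.
  have -> : s - gq w u = dotp w w * (y - gc a w u) ^+ 2 by lra.
  by field.
exists u.
  rewrite /gdom /= -subr_gt0 -(@pmulr_lgt0 _ (dotp w w)^-1) ?invr_gt0//.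
  by rewrite yq exprn_gt0.
rewrite /gchart; congr (rV_cons (_, _)).
rewrite /gh yq sqrtr_sqr gtr0_norm// mulrA -expr2 tau2 mul1r.
by rewrite addrC subrK.
Qed.

Lemma measurable_tl : measurable_fun setT tl.
Proof.
apply/measurable_fun_rVP => i.
rewrite (_ : _ \o _ = @rV_coords R 3 (lift ord0 i)); first exact: measurable_rV_coord.
by apply/funext => x; rewrite /rV_coords /= mxE.
Qed.

Lemma measurable_gc : measurable_fun setT (gc a w).
Proof.
apply: measurable_funM => //; apply: measurable_funM => //.
exact: continuous_rV_measurable (@continuous_dotp R 2 w).
Qed.

Lemma measurable_gq : measurable_fun setT (gq w).
Proof. exact: continuous_rV_measurable continuous_gq. Qed.

Lemma measurable_side : measurable_fun setT (fun x : 'rV[R]_3 => tau * (x 0 0 - gc a w (tl x))).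
Proof.
apply: measurable_funM => //; apply: measurable_funB; first exact: measurable_coord.
exact: measurableT_comp measurable_gc measurable_tl.
Qed.

Lemma measurable_image_gchart : measurable (gchart a w s tau @` gdom w s).
Proof.
rewrite image_gchart; apply: measurableI; first exact: measurable_cylinder.
have := measurable_side measurableT (measurable_itv `]0, +oo[); rewrite setTI.
by rewrite (_ : _ @^-1` _ = [set x : 'rV[R]_3 | 0 < tau * (x 0 0 - gc a w (tl x))])//; apply/seteqP; split=> x /=; rewrite in_itv/= andbT.
Qed.

Lemma surface_integral_gchart (sg : {measure set 'rV[R]_3 -> \bar R})
    (F : 'rV[R]_3 -> \bar R) : is_surface_measure (cyl s t) sg ->
  measurable_fun setT F -> (forall x, (0 <= F x)%E) ->
  (\int[sg]_(x in gchart a w s tau @` gdom w s) F x =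
  \int[mu2]_(u in gdom w s) (F (gchart a w s tau u) * (gjac w s u)%:E))%E.
Proof.
move=> [_ H] mF F0; rewrite (H _ _ gchart_parameterization F mF F0).
by apply: eq_integral => u; rewrite inE => Ou; rewrite enorm_crossp_gchart.
Qed.

End graph_charts.

(** Lagrange's identity in the plane: [gq w u] is the squared distance from [u] to the line spanned
    by [w]. *)
Lemma gq_sqr w u : dotp w w != 0 ->
  gq w u = (u 0 0 * w 0 1 - u 0 1 * w 0 0) ^+ 2 / dotp w w.
Proof. by rewrite /gq !dotp2E => h; field. Qed.

(** The contour is where the two sheets meet, and neither graph covers it. There [gq = s], which by
    [gq_sqr] says [dotp x n = sqrt s] up to sign, for the unit vector [n] orthogonal both to the
    axis and to the first coordinate direction. The contour thus lies on two opposite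
    generatrices. *)
Lemma contour_null a w s (sg : {measure set 'rV[R]_3 -> \bar R}) :
  a ^+ 2 + dotp w w = 1 -> 0 < dotp w w -> 0 < s ->
  is_surface_measure (cyl s (rV_cons (a, w))) sg ->
  sg (cyl s (rV_cons (a, w)) `&` [set x : 'rV[R]_3 | x 0 0 = gc a w (tl x)]) = 0%E.
Proof.
move=> aw w0 s0 hsg; have wn : dotp w w != 0 by rewrite gt_eqF.
pose n : 'rV[R]_3 := (Num.sqrt (dotp w w))^-1 *: rV_cons (0, vec2 (w 0 1) (- w 0 0)).
have nn : dotp n n = 1.
  rewrite /n dotpZl dotpZr dotp_cons mulr0 add0r mulrA -expr2 exprVn sqr_sqrtr ?ltW//.
  rewrite [dotp (vec2 _ _) _]dotp2E vec2_0 vec2_1 -(_ : dotp w w = w 0 1 * w 0 1 + - w 0 0 * - w 0 0).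
    by rewrite mulVf.
  by rewrite dotp2E; ring.
have tt : dotp (rV_cons (a, w)) (rV_cons (a, w)) = 1 by rewrite dotp_cons -aw expr2.
have tn : dotp (rV_cons (a, w)) n = 0.
  by rewrite /n dotpZr dotp_cons mulr0 add0r [dotp w (vec2 _ _)]dotp2E vec2_0 vec2_1; ring.
have tnm := orthonormal_crossp tt nn tn.
pose N1 := cyl s (rV_cons (a, w)) `&` [set x | dotp x n = Num.sqrt s].
pose N2 := cyl s (rV_cons (a, w)) `&` [set x | dotp x (- n) = Num.sqrt s].
have mN k : measurable (cyl s (rV_cons (a, w)) `&` [set x | dotp x k = Num.sqrt s]).
  by apply: measurableI; [exact: measurable_cylinder|exact: measurable_dotp_eq].
have N10 : sg N1 = 0%E by exact: generatrix_null s0 tnm hsg.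
have N20 : sg N2 = 0%E by exact: generatrix_null s0 (orthonormalNN tnm) hsg.
have mS : measurable (cyl s (rV_cons (a, w)) `&` [set x : 'rV[R]_3 | x 0 0 = gc a w (tl x)]).
  apply: measurableI; first exact: measurable_cylinder.
  have := @measurable_side a w 1 measurableT _ (measurable_set1 0); rewrite setTI.
  rewrite (_ : _ @^-1` _ = [set x : 'rV[R]_3 | x 0 0 = gc a w (tl x)])//.
  by apply/seteqP; split=> x /=; rewrite mul1r => /eqP; rewrite ?subr_eq0 => /eqP// ->; rewrite subrr.
apply: (@subset_measure0 _ _ _ sg _ (N1 `|` N2)) => //.
- by apply: measurableU; exact: mN.
- move=> x [xc /= x0].
  have xE := rV_consE x; rewrite -/(tl x) in xE.
  have H : cylinder_eq s (rV_cons (a, w)) (rV_cons (x 0 ord0, tl x)) = 0 by rewrite -xE.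
  rewrite cylinder_eq_cons// (_ : x 0 ord0 = x 0 0)// x0 subrr expr0n mulr0 add0r gq_sqr// in H.
  have xn : dotp x n ^+ 2 = s.
    rewrite {1}xE /n dotpZr dotp_cons mulr0 add0r [dotp (tl x) (vec2 _ _)]dotp2E vec2_0 vec2_1 exprMn exprVn.
    rewrite sqr_sqrtr ?ltW//; move: H => /eqP; rewrite subr_eq0 => /eqP <-.
    by rewrite mulrN mulrC.
  have : `|dotp x n| = Num.sqrt s by rewrite -xn sqrtr_sqr.
  have [h|h] := leP 0 (dotp x n).
    by rewrite ger0_norm// => E; left.
  by rewrite ltr0_norm// => E; right; split => //=; rewrite dotpNr.
- have := @measureU0 _ _ _ sg N1 N2 (mN _) (mN _) N20; rewrite N10.
  by [].
Qed.

Lemma integral_cyl_gchart a w s (sg : {measure set 'rV[R]_3 -> \bar R})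
    (F : 'rV[R]_3 -> \bar R) :
  a ^+ 2 + dotp w w = 1 -> 0 < dotp w w -> 0 < s ->
  is_surface_measure (cyl s (rV_cons (a, w))) sg ->
  measurable_fun setT F -> (forall x, (0 <= F x)%E) ->
  (\int[sg]_(x in cyl s (rV_cons (a, w))) F x =
   \int[mu2]_(u in gdom w s) (F (gchart a w s 1 u) * (gjac w s u)%:E) +
   \int[mu2]_(u in gdom w s) (F (gchart a w s (- 1) u) * (gjac w s u)%:E))%E.
Proof.
move=> aw w0 s0 hsg mF F0.
have p1 : 1 ^+ 2 = 1 :> R by rewrite expr1n.
have m1 : (- 1) ^+ 2 = 1 :> R by rewrite sqrrN expr1n.
rewrite -(surface_integral_gchart aw w0 s0 p1 hsg mF F0).
rewrite -(surface_integral_gchart aw w0 s0 m1 hsg mF F0).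
pose N := cyl s (rV_cons (a, w)) `&` [set x : 'rV[R]_3 | x 0 0 = gc a w (tl x)].
have N0 : sg N = 0%E by exact: contour_null.
have mp : measurable (gchart a w s 1 @` gdom w s) by exact: measurable_image_gchart.
have mm : measurable (gchart a w s (- 1) @` gdom w s) by exact: measurable_image_gchart.
have mN : measurable N.
  apply: measurableI; first exact: measurable_cylinder.
  have := @measurable_side a w 1 measurableT _ (measurable_set1 0); rewrite setTI.
  rewrite (_ : _ @^-1` _ = [set x : 'rV[R]_3 | x 0 0 = gc a w (tl x)])//.
  by apply/seteqP; split=> x /=; rewrite mul1r => /eqP; rewrite ?subr_eq0 => /eqP// ->; rewrite subrr.
have E : cyl s (rV_cons (a, w)) =
    (gchart a w s 1 @` gdom w s `|` gchart a w s (- 1) @` gdom w s) `|` N.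
  rewrite !image_gchart//; apply/seteqP; split=> x.
    move=> xc; have [h|h|h] := ltgtP (x 0 0) (gc a w (tl x)).
    - by left; right; split => //=; rewrite mulN1r opprB subr_gt0.
    - by left; left; split => //=; rewrite mul1r subr_gt0.
    - by right.
  by move=> [[[]|[]]|[]].
rewrite {1}E ge0_integral_setU//; last 3 first.
- exact: measurableU.
- exact: measurable_funTS.
- apply/disj_setPS => x [] + [_ /= xN]; rewrite !image_gchart// => -[[_ /=]|[_ /=]];
    by rewrite xN subrr mulr0 ltxx.
rewrite [X in (_ + X)%E](_ : _ = 0%E) ?adde0; last first.
  by apply: null_set_integral => //; exact: measurable_funTS.
rewrite ge0_integral_setU//.
- exact: measurable_funTS.
- apply/disj_setPS => x []; rewrite !image_gchart// => -[_ /=] + [_ /=].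
  by rewrite mulN1r mul1r oppr_gt0 => h1 h2; have := lt_trans h1 h2; rewrite ltxx.
Qed.

End cylinder_charts.

(** * The coarea formula *)

Section substitution.
Context {R : realType}.
Local Notation mu := (@lebesgue_measure R).
Local Open Scope ereal_scope.

Lemma subset_itv_nat (u v : R^nat) n :
  (u n.+1 <= u n)%R -> (v n <= v n.+1)%R ->
  `[u n, v n]%classic `<=` `[u n.+1, v n.+1]%classic.
Proof.
move=> un vn x /=; rewrite !in_itv/= => /andP[ux xv].
by rewrite (le_trans un ux) (le_trans xv vn).
Qed.

Lemma exists_itv_nat (y : R) : (0 < y)%R ->
  exists n : nat, (n.+1%:R^-1 <= y <= n.+1%:R)%R.
Proof.
move=> y0; have yV0 : (0 < y^-1)%R by rewrite invr_gt0.
have h := archi_boundP (ltW (addr_gt0 y0 yV0)).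
exists (Num.bound (y + y^-1)%R).
have h1 : (y + y^-1 <= (Num.bound (y + y^-1)%R).+1%:R)%R.
  by rewrite (le_trans (ltW h))// ler_nat.
apply/andP; split; last by apply: le_trans h1; rewrite lerDl ltW.
by rewrite -[leRHS]invrK lef_pV2 ?posrE//; apply: le_trans h1; rewrite lerDr ltW.
Qed.

(** The substitution [s = q + A * y^2]. As [K] may blow up at [q] like [(s - q)^(-1/2)], the
    substitution is made on the compact intervals [[1 / (n + 1), n + 1]] in [y], and both sides pass
    to the limit by monotone convergence. *)
Lemma quadratic_substitution (A q : R) (H K : R -> R) :
  (0 < A)%R -> continuous H -> (forall y, 0 <= H y)%R ->
  {in `]q, +oo[, continuous K} -> (forall y, 0 <= K y)%R ->
  measurable_fun setT K ->
  (forall y, 0 < y -> K (q + A * y ^+ 2) * (2 * A * y) = H y)%R ->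
  \int[mu]_(s in `]q, +oo[) (K s)%:E = \int[mu]_(y in `]0%R, +oo[) (H y)%:E.
Proof.
move=> A0 cH H0 cK K0 mK HK.
pose F (y : R) := (q + A * y ^+ 2)%R.
have dF (y : R) : is_derive y (1%R : R) F (2 * A * y)%R.
  by apply: is_derive_eq; rewrite /GRing.scale /=; ring.
have F1 : F^`()%classic = (fun y => 2 * A * y)%R.
  by apply/funext => y; rewrite derive1E; case: (dF y).
have cF1 : continuous (fun y : R => 2 * A * y)%R.
  by move=> y; apply: (@continuousM _ _ (cst (2 * A)%R) id); [exact: cst_continuous|exact: cvg_id].
pose e (n : nat) : R := (n.+1%:R^-1)%R.
pose b (n : nat) : R := (n.+1%:R)%R.
have e0 n : (0 < e n)%R by rewrite invr_gt0.
have eb n : (e n <= b n)%R by rewrite (@le_trans _ _ 1%R)// ?ler1n// invf_le1// ler1n.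
have ee n : (e n.+1 <= e n)%R by rewrite lef_pV2 ?posrE// ler_nat.
have bb n : (b n <= b n.+1)%R by rewrite ler_nat.
have Fmono x y : (0 <= x)%R -> (0 <= y)%R -> (x <= y)%R -> (F x <= F y)%R.
  by move=> x0 y0 xy; rewrite lerD2l ler_pM2l// ler_pXn2r.
have E n : \int[mu]_(s in `[F (e n), F (b n)]) (K s)%:E = \int[mu]_(y in `[e n, b n]) (H y)%:E.
  rewrite (@integration_by_substitution_increasing _ F K)//.
  - apply: eq_integral => y; rewrite inE/= in_itv/= => /andP[ey _].
    by rewrite F1; congr EFin; apply: HK; exact: lt_le_trans (e0 n) ey.
  - move=> x y; rewrite !in_itv/= => /andP[ex _] /andP[ey _] xy.
    by rewrite ltrD2l ltr_pM2l// ltr_pXn2r// ?nnegrE ?(le_trans (ltW (e0 n))).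
  - by rewrite F1 => x _; exact: cF1.
  - by rewrite F1; apply/cvg_ex; eexists; exact/cvg_at_right_filter/cF1.
  - by rewrite F1; apply/cvg_ex; eexists; exact/cvg_at_left_filter/cF1.
  - exact: is_derive_LRcontinuous.
  - apply: continuous_in_subspaceT => s; rewrite inE/= in_itv/= => /andP[es _].
    apply: cK; rewrite in_itv/= andbT; apply: lt_le_trans es.
    by rewrite /F ltrDl mulr_gt0// exprn_gt0.
have lL : \int[mu]_(s in `[F (e n), F (b n)]) (K s)%:E @[n --> \oo] --> \int[mu]_(s in `]q, +oo[) (K s)%:E.
  rewrite (_ : `]q, +oo[%classic = \bigcup_n `[F (e n), F (b n)]%classic).
    apply: ge0_nondecreasing_set_cvg_integral => //.
    - apply/nondecreasing_seqP => n; rewrite subsetEset.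
      by apply: (@subset_itv_nat (F \o e) (F \o b)); apply: Fmono; rewrite // ltW.
    - by move=> n; apply/measurable_EFinP; exact: measurable_funTS.
    - by move=> n x _; rewrite lee_fin.
  apply/seteqP; split=> [x|x [n _]] /=; rewrite !in_itv/= ?andbT; last first.
    by move=> /andP[enx _]; apply: lt_le_trans enx; rewrite ltrDl mulr_gt0// exprn_gt0.
  move=> qx; have y0 : (0 < Num.sqrt ((x - q) / A))%R by rewrite sqrtr_gt0 divr_gt0// subr_gt0.
  have [n /andP[en yb]] := exists_itv_nat y0; exists n => //=; rewrite in_itv/=.
  have -> : x = F (Num.sqrt ((x - q) / A)).
    rewrite /F sqr_sqrtr; last by rewrite divr_ge0 ?subr_ge0// ltW.
    by rewrite mulrC divfK ?gt_eqF// addrC subrK.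
  by rewrite !Fmono// ltW.
have lR : \int[mu]_(y in `[e n, b n]) (H y)%:E @[n --> \oo] --> \int[mu]_(y in `]0%R, +oo[) (H y)%:E.
  rewrite (_ : `]0%R, +oo[%classic = \bigcup_n `[e n, b n]%classic).
    apply: ge0_nondecreasing_set_cvg_integral => //.
    - apply/nondecreasing_seqP => n; rewrite subsetEset.
      exact: (@subset_itv_nat e b).
    - move=> n; apply/measurable_EFinP; apply: measurable_funTS.
      exact: continuous_measurable_fun.
    - by move=> n x _; rewrite lee_fin.
  apply/seteqP; split=> [x|x [n _]] /=; rewrite !in_itv/= ?andbT; last first.
    by move=> /andP[enx _]; exact: lt_le_trans enx.
  by move=> /exists_itv_nat[n ?]; exists n => //=; rewrite in_itv.
apply: (@cvg_unique _ (@ereal_hausdorff R) _ _ _ _ lL).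
by rewrite (_ : (fun n => _) = (fun n => \int[mu]_(y in `[e n, b n]) (H y)%:E))//; exact/funext.
Qed.

(** In the coarea formula [c] is the value [gc] of [x0] on the contour, and the two half-lines
    correspond to the two sheets. *)
Lemma half_line_splitting (H : R -> R) (c : R) :
  continuous H -> (forall y, 0 <= H y)%R ->
  \int[mu]_y (H y)%:E = \int[mu]_(y in `]0%R, +oo[) (H (c + y)%R)%:E +
    \int[mu]_(y in `]0%R, +oo[) (H (c - y)%R)%:E.
Proof.
move=> cH H0.
have mH : measurable_fun setT H by exact: continuous_measurable_fun.
have cp : continuous (fun y => H (c + y)%R).
  move=> y; apply: continuous_comp; last exact: cH.
  by apply: (@continuousD _ _ _ (cst c) id); [exact: cst_continuous|exact: cvg_id].
have cm : continuous (fun y => H (c - y)%R).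
  move=> y; apply: continuous_comp; last exact: cH.
  by apply: (@continuousB _ _ _ (cst c) id); [exact: cst_continuous|exact: cvg_id].
rewrite -(setUv `]-oo, c]%classic) ge0_integral_setU//=; last 3 first.
- by apply/measurable_EFinP; exact: measurable_funTS.
- by move=> x _; rewrite lee_fin.
- exact/disj_setPCl.
2: exact: measurableC.
rewrite setCitvl addeC; congr (_ + _).
- rewrite !integral_itv_obnd_cbnd//; last 2 first.
  + by apply/measurable_EFinP/measurable_funTS; exact: continuous_measurable_fun.
  + by apply/measurable_EFinP; exact: measurable_funTS.
  have dF (y : R) : is_derive y (1%R : R) (fun y => c + y)%R 1%R.
    by apply: is_derive_affine => k; rewrite /GRing.scale /=; ring.
  have F1 : (fun y => c + y)%R^`()%classic = cst 1%R.
    by apply/funext => y; rewrite derive1E; case: (dF y).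
  have := @increasing_ge0_integration_by_substitutiony R (fun y => c + y)%R H 0%R.
  rewrite addr0 F1 => ->//.
  + by apply: eq_integral => y _; rewrite /= mulr1.
  + by move=> x y _ _ xy; rewrite ltrD2l.
  + by move=> x _; exact: cst_continuous.
  + exact: is_cvg_cst.
  + exact: is_cvg_cst.
  + split; first by move=> x _; case: (dF x).
    exact/cvg_at_right_filter/(is_derive_continuous dF).
  + apply/cvgryPge => B; near=> x; rewrite -lerBlDl; near: x.
    by apply: nbhs_pinfty_ge; exact: num_real.
  + exact: continuous_subspaceT.
- have dF (y : R) : is_derive y (1%R : R) (fun y => c - y)%R (-1)%R.
    by apply: is_derive_affine => k; rewrite /GRing.scale /=; ring.
  have F1 : (fun y => c - y)%R^`()%classic = cst (-1)%R.
    by apply/funext => y; rewrite derive1E; case: (dF y).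
  rewrite integral_itv_obnd_cbnd//; last first.
    by apply/measurable_EFinP/measurable_funTS; exact: continuous_measurable_fun.
  have := @decreasing_ge0_integration_by_substitutiony R (fun y => c - y)%R H 0%R.
  rewrite subr0 F1 => ->//.
  + by apply: eq_integral => y _; rewrite /= opprK mulr1.
  + by move=> x y _ _ xy; rewrite ltrD2l ltrN2.
  + by move=> x _; exact: cst_continuous.
  + exact: is_cvg_cst.
  + exact: is_cvg_cst.
  + split; first by move=> x _; case: (dF x).
    exact/cvg_at_right_filter/(is_derive_continuous dF).
  + apply/cvgrNyPle => B; near=> x; rewrite lerBlDr -lerBlDl; near: x.
    by apply: nbhs_pinfty_ge; exact: num_real.
  + exact: continuous_subspaceT.
Unshelve. all: by end_near. Qed.

End substitution.

(** * The coarea formula for the cylinders with a common axis *)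

Section coarea.
Context {R : realType}.

Lemma continuous_rV_cons_fst n (u : 'rV[R]_n) : continuous (fun y : R => rV_cons (y, u)).
Proof.
move=> y; apply: (@smooth_on_cts _ _ _ setT) => //.
apply: smooth_on_rV; first exact: openT.
move=> i; case: (unliftP ord0 i) => [j ->|->].
  rewrite (_ : (fun y => _) = cst (u 0 j)); first exact: smooth_on_cst.
  by apply/funext => x; rewrite rV_consS.
rewrite (_ : (fun y => _) = id); first exact: smooth_on_id.
by apply/funext => x; rewrite rV_cons0.
Qed.

Local Notation mu := (@lebesgue_measure R).
Local Notation mu2 := (lebesgue_rV R 2).
Variables (a : R) (w : 'rV[R]_2).
Hypotheses (aw : a ^+ 2 + dotp w w = 1) (w0 : 0 < dotp w w).
Variables (Phi : 'rV[R]_3 -> R) (k : R -> R).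
Hypotheses (cPhi : continuous Phi) (Phi0 : forall x, 0 <= Phi x)
  (ck : continuous k) (k0 : forall s, 0 <= k s)
  (k01 : forall s, ~ (0 < s < 1) -> k s = 0).
Local Notation t := (rV_cons (a, w)).

Let wn : dotp w w != 0. Proof. by rewrite gt_eqF. Qed.

(* The density vanishes for [s <= gq w u], where the square roots are [0]. *)
Definition gdens (tau s : R) (u : 'rV[R]_2) : R :=
  Phi (gchart a w s tau u) / (2 * Num.sqrt (dotp w w * (s - gq w u))).

Lemma measurable_inv_ge0 d (T : measurableType d) (f : T -> R) :
  measurable_fun setT f -> (forall x, 0 <= f x) ->
  measurable_fun setT (fun x => (f x)^-1).
Proof.
move=> mf f0; rewrite (_ : (fun x => _) = (fun x => f x `^ (-1))).
  exact: (measurableT_comp (measurable_powR (-1)) mf).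
apply/funext => x; have [->|fx] := eqVneq (f x) 0.
  by rewrite invr0 powR0// oppr_eq0 oner_eq0.
by rewrite powRN powRr1.
Qed.

Lemma measurable_sqrt : measurable_fun setT (@Num.sqrt R).
Proof. exact: continuous_measurable_fun (@sqrt_continuous R). Qed.

Lemma measurable_gdens tau : measurable_fun setT
  (fun z : measurableTypeR R * 'rV[R]_2 => gdens tau z.1 z.2).
Proof.
have mq : measurable_fun setT (fun z : measurableTypeR R * 'rV[R]_2 => z.1 - gq w z.2).
  apply: measurable_funB => //.
  exact: measurableT_comp (@measurable_gq R w) measurable_snd.
apply: measurable_funM.
  apply: measurableT_comp (continuous_rV_measurable cPhi) _.
  apply: measurableT_comp (@measurable_rV_cons R 2) _.
  apply/measurable_fun_pairP; split; last exact: measurable_snd.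
  apply: measurable_funD.
    exact: measurableT_comp (@measurable_gc R a w) measurable_snd.
  apply: measurable_funM => //; apply: measurableT_comp measurable_sqrt _.
  exact: measurable_funM.
apply: measurable_inv_ge0; last by move=> z; rewrite mulr_ge0// sqrtr_ge0.
apply: measurable_funM => //.
by apply: measurableT_comp measurable_sqrt _; exact: measurable_funM.
Qed.

Lemma gdens_ge0 tau s u : 0 <= gdens tau s u.
Proof. by rewrite divr_ge0// mulr_ge0// sqrtr_ge0. Qed.

(** The factor [sqrt s] of the area element cancels against the norm [2 * sqrt s] of the gradient.
    What remains, [2 * sqrt (A * (s - gq w u))] with [A = dotp w w], is the absolute value of the
    derivative of the cylinder equation in [x0], as expected when [x0] is exchanged for [s]. *)
Lemma gdens_jac s (tau : R) u : 0 < s -> gdom w s u ->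
  Phi (gchart a w s tau u) / (2 * Num.sqrt s) * gjac w s u = gdens tau s u.
Proof.
move=> s0 Ou; have dg : 0 < s - gq w u by rewrite subr_gt0.
rewrite /gjac sqrtrM ?ltW// sqrtrV ?mulr_ge0 ?ltW//.
have ? : Num.sqrt s != 0 by rewrite gt_eqF// sqrtr_gt0.
have ? : Num.sqrt (dotp w w * (s - gq w u)) != 0 by rewrite gt_eqF// sqrtr_gt0 mulr_gt0.
by rewrite /gdens; field; apply/andP.
Qed.

Lemma surface_integral_gdens s (sg : {measure set 'rV[R]_3 -> \bar R}) :
  0 < s -> is_surface_measure (cyl s t) sg ->
  (\int[sg]_(x in cyl s t) (Phi x / (2 * Num.sqrt s))%:E =
   \int[mu2]_u (gdens 1 s u)%:E + \int[mu2]_u (gdens (- 1) s u)%:E)%E.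
Proof.
move=> s0 hsg; rewrite (integral_cyl_gchart aw w0 s0 hsg); last 2 first.
- apply/measurable_EFinP; apply: measurable_funM => //.
  exact: continuous_rV_measurable.
- by move=> x; rewrite lee_fin divr_ge0// mulr_ge0// sqrtr_ge0.
have E tau : (\int[mu2]_(u in gdom w s)
    ((Phi (gchart a w s tau u) / (2 * Num.sqrt s))%:E * (gjac w s u)%:E) =
    \int[mu2]_u (gdens tau s u)%:E)%E.
  rewrite integral_mkcond; apply: eq_integral => u _; rewrite patchE.
  case: ifPn => [/[!inE] Ou|]; first by rewrite -EFinM gdens_jac.
  rewrite notin_setE /gdom /= => /negP; rewrite -leNgt => qs.
  rewrite /gdens ler0_sqrtr ?mulr0 ?invr0 ?mulr0//.
  by rewrite pmulr_rle0// subr_le0.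
by rewrite !E.
Qed.

(** With [s = gq w u + A * y^2] and [A = dotp w w] the density becomes [Phi / (2 * A * y)], and
    [2 * A * y] is the derivative of the substitution. *)
Lemma integral_gdens tau u : tau ^+ 2 = 1 ->
  (\int[mu]_s (k s * gdens tau s u)%:E =
   \int[mu]_(y in `]0%R, +oo[) (Phi (rV_cons (gc a w u + tau * y, u)) *
      k (dotp w w * y ^+ 2 + gq w u))%:E)%E.
Proof.
move=> tau2.
rewrite -(setUv `]-oo, gq w u]%classic) ge0_integral_setU//=; last 4 first.
- exact: measurableC.
- apply/measurable_EFinP; apply: measurable_funTS; apply: measurable_funM.
    exact: continuous_measurable_fun.
  have := measurableT_comp (@measurable_gdens tau) (@pair2_measurable _ _ _ _ u).
  exact.
- by move=> x _; rewrite lee_fin mulr_ge0// gdens_ge0.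
- exact/disj_setPCl.
rewrite integral0_eq ?add0e; last first.
  move=> s /=; rewrite in_itv/= => sq; rewrite /gdens ler0_sqrtr ?mulr0 ?invr0 ?mulr0//.
  by rewrite pmulr_rle0// subr_le0.
rewrite setCitvl.
have cP (f g : R -> R) : continuous f -> continuous g -> continuous (fun y => f y * g y).
  by move=> cf cg y; apply: (@continuousM _ _ f g); [exact: cf|exact: cg].
have cons_cont := @continuous_rV_cons_fst 2 u.
apply: (@quadratic_substitution R (dotp w w) (gq w u)
  (fun y => Phi (rV_cons (gc a w u + tau * y, u)) * k (dotp w w * y ^+ 2 + gq w u))
  (fun s => k s * gdens tau s u)) => //.
- apply: cP => y.
    apply: continuous_comp; last exact: cPhi.
    apply: (@continuous_comp _ _ _ (fun y => gc a w u + tau * y) (fun y => rV_cons (y, u) : 'rV[R]_3)); last exact: cons_cont.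
    apply: (@continuousD _ _ _ (cst (gc a w u)) (fun y => tau * y)); first exact: cst_continuous.
    by apply: (@continuousM _ _ (cst tau) id); [exact: cst_continuous|exact: cvg_id].
  apply: continuous_comp; last exact: ck.
  have dd x : is_derive x (1 : R) (fun y : R => dotp w w * y ^+ 2 + gq w u) (2 * dotp w w * x).
    by apply: is_derive_eq; rewrite /GRing.scale /=; ring.
  exact: (is_derive_continuous dd).
- by move=> y; rewrite mulr_ge0.
- move=> s; rewrite in_itv/= andbT => qs.
  have h : 0 < dotp w w * (s - gq w u) by rewrite mulr_gt0// subr_gt0.
  have cl : continuous (fun s : R => s - gq w u).
    move=> x; apply: (@continuousB _ _ _ id (cst (gq w u))); [exact: cvg_id|exact: cst_continuous].
  have cAl (A : R) : continuous (fun s : R => A * (s - gq w u)).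
    by apply: cP => x; [exact: cst_continuous|exact: cl].
  have cS (A : R) : continuous (fun s : R => Num.sqrt (A * (s - gq w u))).
    by move=> x; apply: continuous_comp; [exact: cAl|exact: sqrt_continuous].
  apply: (@continuousM _ _ k (fun s => gdens tau s u)); first exact: ck.
  apply: (@continuousM _ _ (fun s => Phi (gchart a w s tau u))
    (fun s => (2 * Num.sqrt (dotp w w * (s - gq w u)))^-1)).
    apply: (@continuous_comp _ _ _ (fun s => gchart a w s tau u)); last exact: cPhi.
    apply: (@continuous_comp _ _ _ (fun s => gh a w s tau u) (fun y => rV_cons (y, u) : 'rV[R]_3)); last exact: cons_cont.
    apply: (@continuousD _ _ _ (cst (gc a w u)) (fun s => tau * Num.sqrt ((s - gq w u) / dotp w w))); first exact: cst_continuous.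
    apply: (@continuousM _ _ (cst tau) (fun s => Num.sqrt ((s - gq w u) / dotp w w))); first exact: cst_continuous.
    rewrite (_ : (fun s => _) = (fun s => Num.sqrt ((dotp w w)^-1 * (s - gq w u)))); first exact: cS.
    by apply/funext => x; rewrite mulrC.
  apply: (@continuousV _ _ (fun s => 2 * Num.sqrt (dotp w w * (s - gq w u)))).
    by rewrite gt_eqF// mulr_gt0// sqrtr_gt0.
  by apply: (@continuousM _ _ (cst 2) (fun s => Num.sqrt (dotp w w * (s - gq w u)))); [exact: cst_continuous|exact: cS].
- by move=> y; rewrite mulr_ge0// gdens_ge0.
- apply: measurable_funM; first exact: continuous_measurable_fun.
  exact: (measurableT_comp (@measurable_gdens tau) (@pair2_measurable _ _ _ _ u)).
- move=> y y0; rewrite /gdens /gchart /gh.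
  have -> : gq w u + dotp w w * y ^+ 2 - gq w u = dotp w w * y ^+ 2 by rewrite addrAC subrr add0r.
  have -> : dotp w w * y ^+ 2 / dotp w w = y ^+ 2 by field.
  rewrite sqrtr_sqr gtr0_norm//.
  have -> : dotp w w * (dotp w w * y ^+ 2) = (dotp w w * y) ^+ 2 by ring.
  rewrite sqrtr_sqr gtr0_norm ?mulr_gt0//.
  rewrite (addrC (gq w u)); field.
  by rewrite wn gt_eqF.
Qed.

(** Each surface integral is the sum over the two sheets. Tonelli brings the integral in [s] inside,
    for fixed last coordinates [u]; there each sheet becomes a half-line in [x0] starting at
    [gc a w u], and the two half-lines reassemble the integral in [x0]. [cylinder_eq 0 t x] is the
    parameter of the cylinder through [x], and [2 * Num.sqrt s] is the norm of the gradient on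
    it. *)
Theorem coarea (sg : R -> {measure set 'rV[R]_3 -> \bar R}) :
  (forall s, 0 < s < 1 -> is_surface_measure (cyl s t) (sg s)) ->
  (\int[mu]_s ((k s)%:E * \int[sg s]_(x in cyl s t) (Phi x / (2 * Num.sqrt s))%:E) =
   \int[lebesgue_rV R 3]_x (Phi x * k (cylinder_eq 0 t x))%:E)%E.
Proof.
move=> hsg.
pose K tau (z : measurableTypeR R * 'rV[R]_2) := (k z.1 * gdens tau z.1 z.2)%:E.
have mK tau : measurable_fun setT (K tau).
  apply/measurable_EFinP; apply: measurable_funM; last exact: measurable_gdens.
  exact: measurableT_comp (continuous_measurable_fun ck) measurable_fst.
have K0 tau z : (0 <= K tau z)%E by rewrite lee_fin mulr_ge0// gdens_ge0.
have mKu tau : measurable_fun setT (fun s => \int[mu2]_u K tau (s, u))%E.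
  exact: (measurable_fun_fubini_tonelli_F (K tau)).
have mKs tau : measurable_fun setT (fun u => \int[mu]_s K tau (s, u))%E.
  exact: (measurable_fun_fubini_tonelli_G (K tau)).
transitivity (\int[mu]_s (\int[mu2]_u K 1%R (s, u) + \int[mu2]_u K (- 1)%R (s, u)))%E.
  apply: eq_integral => s _.
  have [s01|s01] := pselect (0 < s < 1); last first.
    (* Outside [0 < s < 1] nothing is known of [sg s]; both sides vanish with [k]. *)
    rewrite k01// mul0e !integral0_eq ?adde0// => u _; rewrite /K /= k01// mul0r//.
  case/andP : (s01) => s0 _.
  rewrite (surface_integral_gdens s0 (hsg s s01)) ge0_muleDr; last 2 first.
  - by apply: integral_ge0 => u _; rewrite lee_fin gdens_ge0.
  - by apply: integral_ge0 => u _; rewrite lee_fin gdens_ge0.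
  have mg tau : measurable_fun setT (fun u => (gdens tau s u)%:E).
    apply/measurable_EFinP.
    exact: (measurableT_comp (@measurable_gdens tau) (@pair1_measurable _ _ _ _ s)).
  rewrite -!ge0_integralZl//; last 4 first.
  - by move=> u _; rewrite lee_fin gdens_ge0.
  - by rewrite lee_fin.
  - by move=> u _; rewrite lee_fin gdens_ge0.
  - by rewrite lee_fin.
rewrite ge0_integralD//; last 2 first.
- by move=> s _; exact: integral_ge0.
- by move=> s _; exact: integral_ge0.
rewrite !(fubini_tonelli (K _))// -ge0_integralD//; last 2 first.
- by move=> s _; exact: integral_ge0.
- by move=> s _; exact: integral_ge0.
have mF : measurable_fun setT (fun x => (Phi x * k (cylinder_eq 0 t x))%:E).
  apply/measurable_EFinP; apply: measurable_funM; first exact: continuous_rV_measurable.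
  apply: measurableT_comp (continuous_measurable_fun ck) _.
  exact: continuous_rV_measurable (@continuous_cylinder_eq R 0 t).
rewrite ge0_integral_rVS//; last by move=> x; rewrite lee_fin mulr_ge0.
rewrite (fubini_tonelli (fun z : measurableTypeR R * 'rV[R]_2 =>
  (Phi (rV_cons z) * k (cylinder_eq 0 t (rV_cons z)))%:E)); last 2 first.
- exact: measurableT_comp mF (@measurable_rV_cons R 2).
- by move=> x; rewrite lee_fin mulr_ge0.
apply: eq_integral => u _; rewrite /K /= !integral_gdens ?sqrrN ?expr1n//.
pose H (y : R) := Phi (rV_cons (y, u)) * k (cylinder_eq 0 t (rV_cons (y, u))).
have cH : continuous H.
  move=> y; apply: (@continuousM _ _ (fun y => Phi (rV_cons (y, u)))
    (fun y => k (cylinder_eq 0 t (rV_cons (y, u))))).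
    by apply: continuous_comp; [exact: continuous_rV_cons_fst|exact: cPhi].
  apply: continuous_comp; last exact: ck.
  apply: (@continuous_comp _ _ _ (fun y : R => rV_cons (y, u)) (cylinder_eq 0 t)).
    exact: continuous_rV_cons_fst.
  exact: continuous_cylinder_eq.
have H0 y : 0 <= H y by rewrite mulr_ge0.
rewrite [RHS](half_line_splitting (gc a w u) cH H0).
by congr (_ + _)%E; apply: eq_integral => y _; rewrite /H cylinder_eq_cons// subr0;
  congr EFin; congr (Phi (rV_cons (_, _)) * k (_ * _ + _)); ring.
Qed.

End coarea.

(** * The transform in the rational chart *)

Section compact_support_functions.
Context {R : realType}.

Lemma compact_support_bounded (V : normedModType R) (K : set V) (f : V -> R) :
  compact K -> continuous f -> (forall x, ~ K x -> f x = 0) ->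
  exists C, forall x, `|f x| <= C.
Proof.
move=> cK cf f0.
have cfK : compact (f @` K) by apply: continuous_compact => //; exact: continuous_subspaceT.
have [M [_ MK]] := compact_bounded cfK.
exists (`|M| + 1) => x; have [Kx|/f0 ->] := pselect (K x); last by rewrite normr0 addr_ge0.
by apply: MK; [rewrite (le_lt_trans (ler_norm _))// ltrDl|exists x].
Qed.

Lemma integrable_bounded_box n (f : 'rV[R]_n -> R) (C M : R) :
  measurable_fun setT f -> (forall x, `|f x| <= C * \1_(box n M) x) ->
  (lebesgue_rV R n).-integrable setT (EFin \o f).
Proof.
move=> mf fC; have i0 := integrable_EFinZl C measurableT (@integrable_box R n M).
apply: le_integrable i0 => //; first exact/measurable_EFinP.
by move=> x _; rewrite /= lee_fin (le_trans (fC x))// ler_norm.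
Qed.

(** The first coordinate goes innermost because it is the variable [s], in which both the
    oscillation and the coarea formula operate for fixed angles. *)
Lemma Rintegral_rVS n (h : 'rV[R]_n.+1 -> R) (h1 : R -> R) (h2 : 'rV[R]_n -> R) :
  measurable_fun setT h ->
  lebesgue_measure.-integrable setT (EFin \o h1) ->
  (lebesgue_rV R n).-integrable setT (EFin \o h2) ->
  (forall s u, `|h (rV_cons (s, u))| <= h1 s * h2 u) ->
  \int[lebesgue_rV R n.+1]_y h y =
  \int[lebesgue_rV R n]_u \int[lebesgue_measure]_s h (rV_cons (s, u)).
Proof.
move=> mh i1 i2 hh.
have mhc : measurable_fun setT (h \o @rV_cons R n).
  exact: measurableT_comp mh (@measurable_rV_cons R n).
have ip := majorant_integrable_prod mhc i1 i2 hh.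
rewrite {1}/Rintegral integral_rVS; last exact/measurable_EFinP.
rewrite /Rintegral; congr fine.
rewrite -(integral21_prod_meas1 ip); apply: eq_integral => u _.
rewrite /Rintegral fineK//; apply: (integrable_fin_num measurableT).
have := @majorant_integrable_snd _ _ _ _ R lebesgue_measure (fun z => h (rV_cons (z.2, z.1)))
  h2 h1 (measurable_swapE mhc) i1; apply => x y /=.
by rewrite mulrC; exact: hh.
Qed.

Lemma Rintegral_rV1 (h : 'rV[R]_1 -> R) : measurable_fun setT h ->
  \int[lebesgue_rV R 1]_y h y = \int[lebesgue_measure]_s h (rV_cons (s, 0 : 'rV_0)).
Proof. by move=> mh; rewrite /Rintegral integral_rV1//; exact/measurable_EFinP. Qed.

End compact_support_functions.

(** * A measurable choice of orthonormal frames *)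

Section frames.
Context {R : realType}.
Implicit Types t x : 'rV[R]_3.

Lemma vec3E (a b c : R) : [/\ vec3 a b c 0 0 = a, vec3 a b c 0 1 = b & vec3 a b c 0 2 = c].
Proof. by rewrite !mxE. Qed.

Lemma rV3P (x y : 'rV[R]_3) : x 0 0 = y 0 0 -> x 0 1 = y 0 1 -> x 0 2 = y 0 2 -> x = y.
Proof.
move=> h0 h1 h2; apply/rowP => -[[|[|[|//]]] Hi].
- by rewrite (_ : Ordinal Hi = 0)//; exact/val_inj.
- by rewrite (_ : Ordinal Hi = 1)//; exact/val_inj.
- by rewrite (_ : Ordinal Hi = 2)//; exact/val_inj.
Qed.

Lemma measurable_vec3 d (T : measurableType d) (a b c : T -> R) :
  measurable_fun setT a -> measurable_fun setT b -> measurable_fun setT c ->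
  measurable_fun setT (fun z => vec3 (a z) (b z) (c z)).
Proof.
move=> ma mb mc; apply/measurable_fun_rVP => i.
case: i => -[|[|[|//]]] Hi.
- by rewrite (_ : _ \o _ = a)//; apply/funext => z; rewrite /rV_coords /= mxE.
- by rewrite (_ : _ \o _ = b)//; apply/funext => z; rewrite /rV_coords /= mxE.
- by rewrite (_ : _ \o _ = c)//; apply/funext => z; rewrite /rV_coords /= mxE.
Qed.

Lemma crossp_vec3 (x y : 'rV[R]_3) : crossp x y = vec3 (x 0 1 * y 0 2 - x 0 2 * y 0 1)
  (x 0 2 * y 0 0 - x 0 0 * y 0 2) (x 0 0 * y 0 1 - x 0 1 * y 0 0).
Proof.
have [h0 h1 h2] := vec3E (x 0 1 * y 0 2 - x 0 2 * y 0 1)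
  (x 0 2 * y 0 0 - x 0 0 * y 0 2) (x 0 0 * y 0 1 - x 0 1 * y 0 0).
by apply: rV3P; rewrite croE ?h0 ?h1 ?h2.
Qed.

Definition pole : set 'rV[R]_3 := [set t : 'rV[R]_3 | t 0 0 ^+ 2 = 1].

(* At a pole the first component is [0], since [0^-1 = 0]. *)
Definition frame_n t : 'rV[R]_3 :=
  vec3 0 ((Num.sqrt (1 - t 0 0 ^+ 2))^-1 * t 0 2 + \1_pole t)
    (- ((Num.sqrt (1 - t 0 0 ^+ 2))^-1 * t 0 1)).
Definition frame_m t : 'rV[R]_3 := crossp t (frame_n t).

(** A tangent frame cannot be chosen continuously on the whole sphere, but measurability suffices
    here. Off the poles [frame_n] is the normalized cross product of [t] with the first coordinate
    vector; at a pole it is the second coordinate vector. *)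
Lemma frame_orthonormal t : dotp t t = 1 -> orthonormal t (frame_n t) (frame_m t).
Proof.
move=> tt; have [n0 n1 n2] := vec3E 0 ((Num.sqrt (1 - t 0 0 ^+ 2))^-1 * t 0 2 + \1_pole t)
    (- ((Num.sqrt (1 - t 0 0 ^+ 2))^-1 * t 0 1)).
have t3 := tt; rewrite dotp3E in t3.
have [pt|npt] := pselect (pole t).
  have p1 : \1_pole t = 1 :> R by rewrite indicE mem_set.
  have E0 : Num.sqrt (1 - t 0 0 ^+ 2) = 0 by rewrite (pt : t 0 0 ^+ 2 = 1) subrr sqrtr0.
  have t12 : t 0 1 ^+ 2 + t 0 2 ^+ 2 = 0.
    by move: t3 (pt : t 0 0 ^+ 2 = 1); lra.
  have t1 : t 0 1 = 0.
    by move/eqP : t12; rewrite paddr_eq0 ?sqr_ge0// => /andP[+ _]; rewrite sqrf_eq0 => /eqP.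
  apply: orthonormal_crossp => //; rewrite dotp3E n0 n1 n2 p1 E0 invr0; last by rewrite t1; ring.
  by ring.
have p0 : \1_pole t = 0 :> R by rewrite indicE memNset.
have A0 : 0 < 1 - t 0 0 ^+ 2.
  rewrite lt_neqAle eq_sym subr_eq0 eq_sym; apply/andP; split; first exact/eqP.
  by have := sqr_ge0 (t 0 1); have := sqr_ge0 (t 0 2); move: t3; lra.
have S2 : (Num.sqrt (1 - t 0 0 ^+ 2))^-1 ^+ 2 = (1 - t 0 0 ^+ 2)^-1 by rewrite exprVn sqr_sqrtr// ltW.
apply: orthonormal_crossp => //; rewrite dotp3E n0 n1 n2 p0; last by ring.
move: S2; set S := (Num.sqrt _)^-1 => S2.
have -> : 0 * 0 + (S * t 0 2 + 0) * (S * t 0 2 + 0) + - (S * t 0 1) * - (S * t 0 1) =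
  S ^+ 2 * (dotp t t - t 0 0 ^+ 2) by rewrite dotp3E; ring.
by rewrite tt S2 mulVf// gt_eqF.
Qed.

Lemma pole_measurable : measurable pole.
Proof.
have mf : measurable_fun setT (fun t => t 0 0 ^+ 2) by apply: measurable_funX; exact: measurable_coord.
by have := mf measurableT _ (measurable_set1 1); rewrite setTI; exact.
Qed.

Lemma measurable_frame_n : measurable_fun setT frame_n.
Proof.
have mS : measurable_fun setT (fun t => (Num.sqrt (1 - t 0 0 ^+ 2))^-1).
  apply: measurable_inv_ge0; last by move=> x; exact: sqrtr_ge0.
  apply: measurableT_comp measurable_sqrt _; apply: measurable_funB => //.
  by apply: measurable_funX; exact: measurable_coord.
apply: measurable_vec3 => //.
- apply: measurable_funD; last by apply: measurable_indic; exact: pole_measurable.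
  by apply: measurable_funM => //; exact: measurable_coord.
- apply: measurableT_comp => //; apply: measurable_funM => //; exact: measurable_coord.
Qed.

Lemma measurable_frame_m : measurable_fun setT frame_m.
Proof.
have mn i : measurable_fun setT (fun t => frame_n t 0 i).
  exact: measurableT_comp (measurable_coord i 0) measurable_frame_n.
have -> : frame_m = fun t => vec3 (t 0 1 * frame_n t 0 2 - t 0 2 * frame_n t 0 1)
    (t 0 2 * frame_n t 0 0 - t 0 0 * frame_n t 0 2) (t 0 0 * frame_n t 0 1 - t 0 1 * frame_n t 0 0).
  by apply/funext => t; rewrite /frame_m crossp_vec3.
by apply: measurable_vec3; apply: measurable_funB; apply: measurable_funM;
  by [exact: mn|exact: measurable_coord].
Qed.

End frames.

Section rational_transform.
Context {R : realType}.
Notation mu := (@lebesgue_measure R).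
Notation mu2 := (lebesgue_rV R 2).

Lemma integrable_rVS n (h : 'rV[R]_n.+1 -> R) : measurable_fun setT h ->
  (mu \x lebesgue_rV R n)%E.-integrable setT (fun z => (h (rV_cons z))%:E) ->
  (lebesgue_rV R n.+1).-integrable setT (EFin \o h).
Proof.
move=> mh /integrableP[_ ih]; apply/integrableP; split; first exact/measurable_EFinP.
rewrite ge0_integral_rVS//; last first.
  by apply: measurableT_comp => //; exact/measurable_EFinP.
rewrite -(fubini_tonelli1 (fun z : measurableTypeR R * 'rV[R]_n => `|(h (rV_cons z))%:E|%E))//.
apply: measurableT_comp => //; apply/measurable_EFinP.
exact: measurableT_comp mh (@measurable_rV_cons R n).
Qed.

Lemma integrable_rV1 (h : 'rV[R]_1 -> R) : measurable_fun setT h ->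
  mu.-integrable setT (fun s => (h (rV_cons (s, 0 : 'rV_0)))%:E) ->
  (lebesgue_rV R 1).-integrable setT (EFin \o h).
Proof.
move=> mh /integrableP[_ ih]; apply/integrableP; split; first exact/measurable_EFinP.
rewrite ge0_integral_rV1//.
by apply: measurableT_comp => //; exact/measurable_EFinP.
Qed.

Lemma measurable_oneDsqrV_coord n (i : 'I_n) :
  measurable_fun setT (fun v : 'rV[R]_n => (1 + v 0 i ^+ 2)^-1).
Proof.
apply: measurable_inv_ge0; last by move=> v; rewrite addr_ge0// sqr_ge0.
by apply: measurable_funD => //; apply: measurable_funX; exact: measurable_coord.
Qed.

Lemma integrable_oneDsqrV_coord :
  (lebesgue_rV R 1).-integrable setT (EFin \o (fun v : 'rV[R]_1 => (1 + v 0 0 ^+ 2)^-1)).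
Proof.
apply: integrable_rV1; first exact: measurable_oneDsqrV_coord.
under eq_fun do rewrite rV_cons0.
exact: integrable_oneDsqrV.
Qed.

(* Since [|x . t| <= 3 M] on [box 3 M] for a unit [t], the pullback by [rchart] of a
   function bounded by the indicator of [box 3 M] is bounded by [strip (3 * M)]. *)
Definition strip (M : R) (v : 'rV[R]_2) : R := \1_`[- M, M] (v 0 0) / (1 + v 0 1 ^+ 2).

Lemma measurable_strip M : measurable_fun setT (strip M).
Proof.
apply: measurable_funM; last exact: measurable_oneDsqrV_coord.
apply: measurableT_comp; last exact: measurable_coord.
by apply: measurable_indic.
Qed.

Lemma integrable_strip M : mu2.-integrable setT (EFin \o strip M).
Proof.
apply: integrable_rVS; first exact: measurable_strip.
have i1 : mu.-integrable setT (EFin \o (\1_`[- M, M] : R -> R)).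
  exact: integrable_indic_itv.
have i2 := integrable_oneDsqrV_coord.
apply: (majorant_integrable_prod _ i1 i2).
  exact: measurableT_comp (@measurable_strip M) (@measurable_rV_cons R 1).
move=> s v; rewrite /strip rV_cons0 ger0_norm; last by rewrite divr_ge0// addr_ge0// sqr_ge0.
by rewrite (_ : (1 : 'I_2) = lift ord0 0) ?rV_consS//; exact/val_inj.
Qed.

(* [(1 + v1^2)^-1] is the area element [rjac] divided by the norm [2 sqrt s] of the
   gradient of the defining function. *)
Definition chart_transform (f : 'rV[R]_3 -> R) s t : R :=
  \int[mu2]_v (f (rchart t (frame_n t) (frame_m t) (Num.sqrt s) v) / (1 + v 0 1 ^+ 2)).

Lemma measurable_rchart_frame : measurable_fun setT (fun z : (R * 'rV[R]_3) * 'rV[R]_2 =>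
  rchart z.1.2 (frame_n z.1.2) (frame_m z.1.2) (Num.sqrt z.1.1) z.2).
Proof.
pose T := ((R * 'rV[R]_3) * 'rV[R]_2)%type.
have m1 : measurable_fun setT (fun z : T => Num.sqrt z.1.1).
  apply: measurableT_comp; first exact: measurable_sqrt.
  exact: measurableT_comp measurable_fst measurable_fst.
have m2 : measurable_fun setT (fun z : T => z.1.2).
  exact: measurableT_comp measurable_snd measurable_fst.
have mv i : measurable_fun setT (fun z : T => z.2 0 i).
  exact: measurableT_comp (@measurable_coord R 2 i 0) measurable_snd.
have mD : measurable_fun setT (fun z : T => (1 + z.2 0 1 ^+ 2)^-1).
  exact: measurableT_comp (@measurable_oneDsqrV_coord 2 1) measurable_snd.
have mcn i : measurable_fun setT (fun z : T => frame_n z.1.2 0 i).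
  apply: (measurableT_comp (f := fun t => frame_n t 0 i)) => //.
  exact: measurableT_comp (measurable_coord i 0) measurable_frame_n.
have mcm i : measurable_fun setT (fun z : T => frame_m z.1.2 0 i).
  apply: (measurableT_comp (f := fun t => frame_m t 0 i)) => //.
  exact: measurableT_comp (measurable_coord i 0) measurable_frame_m.
have mt i : measurable_fun setT (fun z : T => z.1.2 0 i).
  exact: measurableT_comp (@measurable_coord R 3 i 0) m2.
have mc : measurable_fun setT (fun z : T => ccos (z.2 0 1)).
  apply: measurable_funM => //; apply: measurable_funB => //; exact: measurable_funX.
have ms : measurable_fun setT (fun z : T => csin (z.2 0 1)).
  by apply: measurable_funM => //; apply: measurable_funM.
apply/measurable_fun_rVP => i.
rewrite (_ : _ \o _ = fun z : T => z.2 0 0 * z.1.2 0 i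
   + Num.sqrt z.1.1 * ccos (z.2 0 1) * frame_n z.1.2 0 i
   + Num.sqrt z.1.1 * csin (z.2 0 1) * frame_m z.1.2 0 i); last first.
  by apply/funext => z; rewrite /rV_coords /= !mxE.
exact (measurable_funD (measurable_funD (measurable_funM (mv 0) (mt i))
  (measurable_funM (measurable_funM m1 mc) (mcn i)))
  (measurable_funM (measurable_funM m1 ms) (mcm i))).
Qed.

Lemma measurable_chart_transform_integrand (f : 'rV[R]_3 -> R) : measurable_fun setT f ->
  measurable_fun setT (fun z : (R * 'rV[R]_3) * 'rV[R]_2 =>
    f (rchart z.1.2 (frame_n z.1.2) (frame_m z.1.2) (Num.sqrt z.1.1) z.2) / (1 + z.2 0 1 ^+ 2)).
Proof.
move=> mf; apply: measurable_funM.
  exact: measurableT_comp mf measurable_rchart_frame.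
exact: measurableT_comp (@measurable_oneDsqrV_coord 2 1) measurable_snd.
Qed.

Lemma measurable_chart_transform (f : 'rV[R]_3 -> R) : measurable_fun setT f ->
  measurable_fun setT (fun z : R * 'rV[R]_3 => chart_transform f z.1 z.2).
Proof.
move=> mf.
exact: (measurable_Rintegral_snd mu2 (measurable_chart_transform_integrand mf)).
Qed.

Lemma dotp_box (x t : 'rV[R]_3) M : box 3 M x -> dotp t t = 1 -> `|dotp x t| <= 3 * M.
Proof.
move=> xM tt.
have t1 i : `|t 0 i| <= 1.
  rewrite -(@ler_pXn2r _ 2)// ?nnegrE// expr1n real_normK ?num_real// -tt /dotp (bigD1 i)//= -expr2 lerDl.
  by apply: sumr_ge0 => j _; rewrite -expr2 sqr_ge0.
have b i : `|x 0 i * t 0 i| <= M.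
  by rewrite normrM (le_trans (ler_piMr _ (t1 i))).
rewrite dotp3E (le_trans (ler_normD _ _))//.
have := ler_normD (x 0 0 * t 0 0) (x 0 1 * t 0 1).
by have := b 0; have := b 1; have := b 2; lra.
Qed.

Section bounded.
Variables (f : 'rV[R]_3 -> R) (C M : R).
Hypotheses (C0 : 0 <= C) (mf : measurable_fun setT f)
  (fC : forall x, `|f x| <= C * \1_(box 3 M) x).

Lemma chart_transform_majorant s t v : dotp t t = 1 ->
  `|f (rchart t (frame_n t) (frame_m t) (Num.sqrt s) v) / (1 + v 0 1 ^+ 2)| <= C * strip (3 * M) v.
Proof.
move=> tt; have D0 : 0 <= (1 + v 0 1 ^+ 2)^-1 by rewrite invr_ge0 addr_ge0// sqr_ge0.
rewrite normrM (ger0_norm D0) /strip mulrA ler_wpM2r// (le_trans (fC _))// ler_wpM2l//.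
rewrite !indicE; case: (boolP (_ \in box 3 M)) => [|_]; last by rewrite ler0n.
move=> /set_mem xM; have := dotp_box xM tt.
have [-> _ _] := dotp_rchart (Num.sqrt s) v (frame_orthonormal tt).
by rewrite ler_norml => h; rewrite mem_set//= in_itv.
Qed.

Lemma chart_transform_integrable s t : dotp t t = 1 -> mu2.-integrable setT (fun v =>
  (f (rchart t (frame_n t) (frame_m t) (Num.sqrt s) v) / (1 + v 0 1 ^+ 2))%:E).
Proof.
move=> tt; apply: le_integrable (integrable_EFinZl C measurableT (integrable_strip (3 * M))) => //.
  apply/measurable_EFinP.
  exact: (measurableT_comp (measurable_chart_transform_integrand mf) (@pair1_measurable _ _ _ _ (s, t))).
move=> v _; by rewrite /= lee_fin (le_trans (chart_transform_majorant _ _ tt))// ler_norm.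
Qed.

Lemma chart_transform_bound s t : dotp t t = 1 ->
  `|chart_transform f s t| <= C * \int[mu2]_v strip (3 * M) v.
Proof.
move=> tt; have iS := integrable_strip (3 * M).
rewrite -RintegralZl// (le_trans (le_normr_Rintegral _ (chart_transform_integrable s tt)))//.
apply: le_Rintegral => //.
- exact: integrable_abse (chart_transform_integrable s tt).
- exact: integrable_EFinZl.
- by move=> v _; exact: chart_transform_majorant.
Qed.

(** [is_surface_measure] speaks of nonnegative functions only, so the positive and the negative part
    are transported separately; taking them commutes with the nonnegative factor [rjac]. Division by
    [2 * Num.sqrt s] turns [rjac] into [(1 + v 0 1 ^+ 2)^-1]. *)
Lemma surface_integral_chart_transform s t (sg : {measure set 'rV[R]_3 -> \bar R}) :
  0 < s -> dotp t t = 1 -> is_surface_measure (cyl s t) sg ->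
  \int[sg]_(x in cyl s t) (f x / (2 * Num.sqrt s)) = chart_transform f s t.
Proof.
move=> s0 tt hsg; have tnm := frame_orthonormal tt.
have mE : measurable_fun setT (fun x => (f x / (2 * Num.sqrt s))%:E).
  by apply/measurable_EFinP; apply: measurable_funM.
have r0 : 0 < Num.sqrt s by rewrite sqrtr_gt0.
have EJ v : f (rchart t (frame_n t) (frame_m t) (Num.sqrt s) v) / (1 + v 0 1 ^+ 2) =
  (f (rchart t (frame_n t) (frame_m t) (Num.sqrt s) v) / (2 * Num.sqrt s)) * rjac (Num.sqrt s) v.
  rewrite /rjac; by field; rewrite oneDsqr_neq0 gt_eqF.
have J0 v : 0 <= rjac (Num.sqrt s) v.
  by apply: divr_ge0; [rewrite mulr_ge0// ltW|rewrite addr_ge0// sqr_ge0].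
rewrite /chart_transform /Rintegral integralE [in RHS]integralE; congr (fine (_ - _)%E).
- rewrite (integral_cyl_rchart s0 tnm hsg)//; last exact: measurable_funepos.
  apply: eq_integral => v _; rewrite !funeposE /= EJ -!EFin_max -EFinM.
  by rewrite maxr_pMl// mul0r.
- rewrite (integral_cyl_rchart s0 tnm hsg)//; last exact: measurable_funeneg.
  apply: eq_integral => v _; rewrite !funenegE /= EJ -!EFin_max -EFinM.
  by rewrite maxr_pMl// mul0r mulNr.
Qed.

End bounded.

(** The two charts meet here: the coarea formula comes from the graph chart of [t] split as a first
    coordinate and a tail, while the surface integrals in it are expressed in the rational chart. *)
Lemma coarea_chart_transform_ge0 (f : 'rV[R]_3 -> R) (k : R -> R) (C M : R) (t : 'rV[R]_3)
    (sg : R -> {measure set 'rV[R]_3 -> \bar R}) :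
  0 <= C -> continuous f -> (forall x, 0 <= f x) -> (forall x, `|f x| <= C * \1_(box 3 M) x) ->
  continuous k -> (forall s, 0 <= k s) -> (forall s : R, ~ (0 < s < 1) -> k s = 0) ->
  dotp t t = 1 -> ~ pole t ->
  (forall s, 0 < s < 1 -> is_surface_measure (cyl s t) (sg s)) ->
  \int[mu]_s (k s * chart_transform f s t) = \int[lebesgue_rV R 3]_x (f x * k (cylinder_eq 0 t x)).
Proof.
move=> C0 cf f0 fC ck k0 k01 tt npt hsg.
have mf : measurable_fun setT f by exact: continuous_rV_measurable.
have tE : t = rV_cons (t 0 ord0, tl t) by exact: rV_consE.
have aw : (t 0 ord0) ^+ 2 + dotp (tl t) (tl t) = 1 by rewrite -tt [in RHS]tE dotp_cons /= expr2.
have w0 : 0 < dotp (tl t) (tl t).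
  by rewrite lt_neqAle dotp_ge0 andbT; apply/eqP => w0; apply: npt; move: aw; rewrite -w0 addr0.
have hsg' : forall s, 0 < s < 1 -> is_surface_measure (cyl s (rV_cons (t 0 ord0, tl t))) (sg s).
  by rewrite -tE.
have := coarea aw w0 cf f0 ck k0 k01 hsg'; rewrite -tE /Rintegral => <-.
congr fine; apply: eq_integral => s _.
have [s01|s01] := pselect (0 < s < 1); last by rewrite k01// mul0r mul0e.
have s0 : 0 < s by case/andP : s01.
rewrite EFinM; congr (_ * _)%E.
(* [coarea] is an identity of extended reals; that the surface integral is finite follows from
   integrability in the rational chart. *)
rewrite -(surface_integral_chart_transform mf s0 tt (hsg s s01)) /Rintegral fineK//.
rewrite (integral_cyl_rchart s0 (frame_orthonormal tt) (hsg s s01)); last 2 first.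
- by apply/measurable_EFinP; apply: measurable_funM.
- by move=> x; rewrite lee_fin divr_ge0// mulr_ge0// sqrtr_ge0.
have := integrable_fin_num measurableT (chart_transform_integrable C0 mf fC s tt).
congr (_ \is a fin_num); apply: eq_integral => v _; rewrite /rjac -EFinM; congr EFin.
by field; rewrite oneDsqr_neq0 gt_eqF// sqrtr_gt0.
Qed.

Lemma chart_transformB (f g : 'rV[R]_3 -> R) (C M : R) s t : dotp t t = 1 -> 0 <= C ->
  measurable_fun setT f -> measurable_fun setT g ->
  (forall x, `|f x| <= C * \1_(box 3 M) x) -> (forall x, `|g x| <= C * \1_(box 3 M) x) ->
  chart_transform (fun x => f x - g x) s t = chart_transform f s t - chart_transform g s t.
Proof.
move=> tt C0 mf mg fC gC; rewrite /chart_transform -RintegralB//.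
- by apply: eq_Rintegral => v _; rewrite mulrBl.
- exact: (chart_transform_integrable C0 mf fC).
- exact: (chart_transform_integrable C0 mg gC).
Qed.

Lemma continuous_maxr0 (T : topologicalType) (f : T -> R) : continuous f ->
  continuous (fun x => Num.max (f x) 0).
Proof. by move=> cf x; apply: continuous_max; [exact: cf|exact: cst_continuous]. Qed.

Lemma maxr0B (x : R) : x = Num.max x 0 - Num.max (- x) 0.
Proof.
case: (leP 0 x) => x0.
  by rewrite (max_idPr _) ?oppr_le0// subr0.
by rewrite (max_idPl _) ?oppr_ge0 ?ltW// opprK add0r.
Qed.

Lemma maxr0_le (x C : R) : `|x| <= C -> `|Num.max x 0| <= C.
Proof. by move=> xC; case: (leP 0 x) => x0 //; rewrite normr0 (le_trans _ xC). Qed.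

Lemma itv_bounded (k : R -> R) : continuous k -> (forall s : R, ~ (0 < s < 1) -> k s = 0) ->
  exists D, 0 <= D /\ forall s, `|k s| <= D * \1_`[0, 1] s.
Proof.
move=> ck k01; have [D kD] : exists D, forall s, `|k s| <= D.
  apply: (@compact_support_bounded R R^o `[0, 1]%classic) => //; first exact: segment_compact.
  move=> s s01; apply: k01 => /andP[s0 s1]; apply: s01.
  by rewrite /= in_itv/= !ltW.
exists D; split=> [|s]; first exact: le_trans (kD 0).
rewrite indicE; case: (boolP (s \in _)) => [_|s01]; first by rewrite mulr1.
rewrite k01 ?normr0 ?mulr0// => /andP[s0 s1].
by move: s01; rewrite notin_setE /= in_itv/= !ltW.
Qed.

Section signed_coarea.
Variables (f : 'rV[R]_3 -> R) (C M : R) (t : 'rV[R]_3)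
  (sg : R -> {measure set 'rV[R]_3 -> \bar R}).
Hypotheses (C0 : 0 <= C) (cf : continuous f) (fC : forall x, `|f x| <= C * \1_(box 3 M) x)
  (tt : dotp t t = 1) (npt : ~ pole t)
  (hsg : forall s, 0 < s < 1 -> is_surface_measure (cyl s t) (sg s)).

Lemma integrable_mulr_chart_transform (k : R -> R) (g : 'rV[R]_3 -> R) : continuous k ->
  (forall s : R, ~ (0 < s < 1) -> k s = 0) ->
  continuous g -> (forall x, `|g x| <= C * \1_(box 3 M) x) ->
  mu.-integrable setT (fun s => (k s * chart_transform g s t)%:E).
Proof.
move=> ck k01 cg gC; have [D [D0 kD]] := itv_bounded ck k01.
have i1 := @integrable_indic_itv R 0 1 true false.
have mg : measurable_fun setT g by exact: continuous_rV_measurable.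
apply: le_integrable (integrable_EFinZl (D * (C * \int[mu2]_v strip (3 * M) v)) measurableT i1) => //.
  apply/measurable_EFinP; apply: measurable_funM; first exact: continuous_measurable_fun.
  exact: (measurableT_comp (measurable_chart_transform mg) (@pair2_measurable _ _ _ _ t)).
move=> s _; rewrite /= lee_fin (le_trans _ (ler_norm _))// normrM mulrAC.
by apply: ler_pM => //; exact: (chart_transform_bound C0 mg gC).
Qed.

Lemma integrable_mulr_cylinder_eq (k : R -> R) (g : 'rV[R]_3 -> R) : continuous k ->
  (forall s : R, ~ (0 < s < 1) -> k s = 0) ->
  continuous g -> (forall x, `|g x| <= C * \1_(box 3 M) x) ->
  (lebesgue_rV R 3).-integrable setT (fun x => (g x * k (cylinder_eq 0 t x))%:E).
Proof.
move=> ck k01 cg gC; have [D [D0 kD]] := itv_bounded ck k01.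
apply: (@integrable_bounded_box R 3 _ (C * D) M).
  apply: measurable_funM; first exact: continuous_rV_measurable.
  apply: measurableT_comp (continuous_measurable_fun ck) _.
  exact: continuous_rV_measurable (@continuous_cylinder_eq R 0 t).
move=> x; rewrite normrM mulrAC ler_pM//.
by rewrite (le_trans (kD _))// indicE; case: (_ \in _); rewrite ?mulr1 ?mulr0.
Qed.

(** Both [f] and [k] are split into positive and negative parts, which remain continuous and keep
    the bounds: first [f] against a nonnegative [l], then [k]. *)
Lemma coarea_chart_transform (k : R -> R) : continuous k -> (forall s : R, ~ (0 < s < 1) -> k s = 0) ->
  \int[mu]_s (k s * chart_transform f s t) = \int[lebesgue_rV R 3]_x (f x * k (cylinder_eq 0 t x)).
Proof.
pose fp x := Num.max (f x) 0; pose fn x := Num.max (- f x) 0.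
have cfp : continuous fp by exact: continuous_maxr0.
have cfn : continuous fn.
  by apply: continuous_maxr0 => x; apply: continuousN; exact: cf.
have fp0 x : 0 <= fp x by rewrite le_max lexx orbT.
have fn0 x : 0 <= fn x by rewrite le_max lexx orbT.
have fpC x : `|fp x| <= C * \1_(box 3 M) x by exact: maxr0_le.
have fnC x : `|fn x| <= C * \1_(box 3 M) x by apply: maxr0_le; rewrite normrN.
have fE : f = fun x => fp x - fn x by apply/funext => x; exact: maxr0B.
have mfp : measurable_fun setT fp by exact: continuous_rV_measurable.
have mfn : measurable_fun setT fn by exact: continuous_rV_measurable.
have step (l : R -> R) : continuous l -> (forall s, 0 <= l s) ->
    (forall s : R, ~ (0 < s < 1) -> l s = 0) ->
    \int[mu]_s (l s * chart_transform f s t) = \int[lebesgue_rV R 3]_x (f x * l (cylinder_eq 0 t x)).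
  move=> cl l0 l01.
  transitivity (\int[mu]_s (l s * chart_transform fp s t - l s * chart_transform fn s t)).
    apply: eq_Rintegral => s _; by rewrite -mulrBr -(chart_transformB s tt C0 mfp mfn fpC fnC) -fE.
  rewrite RintegralB//; try exact: integrable_mulr_chart_transform.
  rewrite (coarea_chart_transform_ge0 C0 cfp fp0 fpC cl l0 l01 tt npt hsg).
  rewrite (coarea_chart_transform_ge0 C0 cfn fn0 fnC cl l0 l01 tt npt hsg).
  rewrite -RintegralB//; try exact: integrable_mulr_cylinder_eq.
  by apply: eq_Rintegral => x _; rewrite -mulrBl /fp /fn -maxr0B.
move=> ck k01.
pose kp s := Num.max (k s) 0; pose kn s := Num.max (- k s) 0.
have ckp : continuous kp by exact: continuous_maxr0.
have ckn : continuous kn.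
  by apply: continuous_maxr0 => x; apply: continuousN; exact: ck.
have kp0 x : 0 <= kp x by rewrite le_max lexx orbT.
have kn0 x : 0 <= kn x by rewrite le_max lexx orbT.
have kp01 (s : R) : ~ (0 < s < 1) -> kp s = 0 by move=> /k01 ks; rewrite /kp ks maxxx.
have kn01 (s : R) : ~ (0 < s < 1) -> kn s = 0 by move=> /k01 ks; rewrite /kn ks oppr0 maxxx.
have kE s : k s = kp s - kn s by exact: maxr0B.
transitivity (\int[mu]_s (kp s * chart_transform f s t - kn s * chart_transform f s t)).
  by apply: eq_Rintegral => s _; rewrite -mulrBl -kE.
rewrite RintegralB//; try exact: integrable_mulr_chart_transform.
rewrite !step// -RintegralB//; try exact: integrable_mulr_cylinder_eq.
by apply: eq_Rintegral => x _; rewrite -mulrBr -kE.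
Qed.

End signed_coarea.

End rational_transform.

(** * The paired oscillatory integral *)

Section slices.
Context {R : realType}.
Notation e0 := (delta_mx 0 ord0 : 'rV[R]_3).

Lemma rV_cons_shift n (s h : R) (u : 'rV[R]_n) :
  rV_cons (h + s, u) = h *: delta_mx 0 ord0 + rV_cons (s, u).
Proof.
apply/rowP => i; rewrite [RHS]mxE [X in _ = X + _]mxE [X in _ = _ * X + _]mxE.
case: (unliftP ord0 i) => [j ->|->]; rewrite ?rV_consS ?rV_cons0 /=.
  by rewrite mulr0 add0r.
by rewrite mulr1.
Qed.

Lemma is_derive_slice n (k : 'rV[R]_n.+1 -> R) (s : R) (u : 'rV[R]_n) :
  derivable k (rV_cons (s, u)) (delta_mx 0 ord0) ->
  is_derive s (1 : R) (fun s => k (rV_cons (s, u))) ('D_(delta_mx 0 ord0) k (rV_cons (s, u))).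
Proof.
move=> dk; suff E : (fun h : R => h^-1 *: (((fun s => k (rV_cons (s, u))) \o shift s) (h *: 1) - k (rV_cons (s, u))))
   = (fun h : R => h^-1 *: ((k \o shift (rV_cons (s, u))) (h *: delta_mx 0 ord0) - k (rV_cons (s, u)))).
  by split; rewrite /derivable /derive E.
by apply/funext => h /=; rewrite -rV_cons_shift /GRing.scale /= mulr1.
Qed.

Lemma derive_off_support (V W : normedModType R) (K : set V) (f : V -> W) v :
  closed K -> (forall x, ~ K x -> f x = 0) -> forall x, ~ K x -> 'D_v f x = 0.
Proof.
move=> cK f0 x Kx; rewrite (@near_eq_derive _ _ _ f (cst 0) x v); first by rewrite derive_cst.
apply: (@near_eq_open _ _ _ (~` K)) => //; first exact: closed_openC.
by move=> y /[!inE] /f0.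
Qed.

Lemma measurable_cylinder_eq d0 (T1 : measurableType d0) (s : T1 -> R) (t x : T1 -> 'rV[R]_3) :
  measurable_fun setT s -> measurable_fun setT t -> measurable_fun setT x ->
  measurable_fun setT (fun z => cylinder_eq (s z) (t z) (x z)).
Proof.
move=> ms mt mx.
have mxi i : measurable_fun setT (fun z => x z 0 i).
  exact: measurableT_comp (@measurable_coord R 3 i 0) mx.
have mti i : measurable_fun setT (fun z => t z 0 i).
  exact: measurableT_comp (@measurable_coord R 3 i 0) mt.
rewrite (_ : (fun z => _) = fun z =>
  x z 0 0 * x z 0 0 + x z 0 1 * x z 0 1 + x z 0 2 * x z 0 2
  - (x z 0 0 * t z 0 0 + x z 0 1 * t z 0 1 + x z 0 2 * t z 0 2) ^+ 2 - s z); last first.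
  by apply/funext => z; rewrite cylinder_eqE !dotp3E.
apply: measurable_funB => //; apply: measurable_funB; last apply: measurable_funX;
  by apply: measurable_funD; [apply: measurable_funD|]; exact: measurable_funM.
Qed.

End slices.

(** * Decay and total integral in the frequency of the pairing *)

Section weak_formula.
Context {R : realType}.

(** One real part of the pairing at a fixed frequency: [f] and [kap] are to include the weights, and
    [d] chooses between cosine and sine. *)
Definition weak_integral (th : 'rV[R]_2 -> 'rV[R]_3) (f kap : 'rV[R]_3 -> R) (d xi : R) :=
  \int[lebesgue_rV R 3]_y \int[lebesgue_rV R 3]_x
    (cos (xi * cylinder_eq (y 0 0) (th (tl y)) x + d) * (f x * kap y)).

Notation mu := (@lebesgue_measure R).
Variables (th : 'rV[R]_2 -> 'rV[R]_3) (f kap : 'rV[R]_3 -> R) (C M : R) (K : set 'rV[R]_3)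
  (sg : R -> 'rV[R]_3 -> {measure set 'rV[R]_3 -> \bar R}).
Hypotheses (mth : measurable_fun setT th) (th1 : forall u, dotp (th u) (th u) = 1)
  (th_pole : {ae lebesgue_rV R 2, forall u, ~ pole (th u)})
  (C0 : 0 <= C) (cf : continuous f) (fC : forall x, `|f x| <= C * \1_(box 3 M) x)
  (sk : smooth_on setT kap) (cK : compact K) (K01 : forall y : 'rV[R]_3, K y -> 0 < y 0 0 < 1)
  (k0 : forall y, ~ K y -> kap y = 0)
  (hsg : forall s t, 0 < s < 1 -> dotp t t = 1 -> is_surface_measure (cyl s t) (sg s t)).

Let mf : measurable_fun setT f.
Proof. exact: continuous_rV_measurable. Qed.

Let ck : continuous kap.
Proof. by move=> y; exact: smooth_on_cts sk _. Qed.

Let mk : measurable_fun setT kap.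
Proof. exact: continuous_rV_measurable. Qed.

Let p u x := cylinder_eq 0 (th u) x.

Let D0 := fun g : 'rV[R]_3 -> R => 'D_(delta_mx 0 ord0) g.

Let bounds : exists B N, [/\ 0 <= B, 0 < N, K `<=` box 3 N, forall x u, box 3 M x -> `|p u x| < N
  & forall y, [/\ `|kap y| <= B, `|D0 kap y| <= B & `|D0 (D0 kap) y| <= B]].
Proof.
have [N0 KN0] := compact_sub_box cK.
have clK : closed K by exact: compact_closed.
have s1 : smooth_on setT (D0 kap) by exact: smooth_on_derive.
have s2 : smooth_on setT (D0 (D0 kap)) by exact: smooth_on_derive.
have z1 := derive_off_support (delta_mx 0 ord0) clK k0.
have z2 := derive_off_support (delta_mx 0 ord0) clK z1.
have [B0 hB0] := compact_support_bounded cK ck k0.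
have [B1 hB1] : exists B1, forall y, `|D0 kap y| <= B1.
  by apply: (compact_support_bounded cK) => // y; exact: smooth_on_cts s1 _.
have [B2 hB2] : exists B2, forall y, `|D0 (D0 kap) y| <= B2.
  by apply: (compact_support_bounded cK) => // y; exact: smooth_on_cts s2 _.
have b0 : 0 <= B0 by exact: le_trans (hB0 0).
have b1 : 0 <= B1 by exact: le_trans (hB1 0).
have b2 : 0 <= B2 by exact: le_trans (hB2 0).
(* On the box the squares [dotp x x] and [dotp x (th u) ^+ 2] are at most [3 * M ^+ 2] and
   [9 * M ^+ 2]. Making [N] larger than their sum keeps [p u x] within the interval on which Fourier
   inversion is performed. *)
exists (B0 + B1 + B2), (`|N0| + 12 * M ^+ 2 + 1); split.
- by rewrite !addr_ge0.
- by have := normr_ge0 N0; have := sqr_ge0 M; lra.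
- move=> y /KN0 yN i; apply: le_trans (yN i) _.
  by have := ler_norm N0; have := sqr_ge0 M; lra.
- move=> x u xM; rewrite /p cylinder_eqE subr0.
  have h1 : dotp x x <= 3 * M ^+ 2.
    have h i : x 0 i * x 0 i <= M ^+ 2.
      by rewrite -expr2 -real_normK ?num_real// lerXn2r// ?nnegrE// (le_trans _ (xM i)).
    by rewrite dotp3E; have := h 0; have := h 1; have := h 2; lra.
  have h2 : dotp x (th u) ^+ 2 <= 9 * M ^+ 2.
    have := dotp_box xM (th1 u); rewrite ler_norml => /andP[h3 h4].
    have : 0 <= (3 * M - dotp x (th u)) * (3 * M + dotp x (th u)) by apply: mulr_ge0; lra.
    by lra.
  rewrite (le_lt_trans (ler_normB _ _))// (ger0_norm (dotp_ge0 _)) (ger0_norm (sqr_ge0 _)).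
  by have := normr_ge0 N0; lra.
- by move=> y; split; [apply: le_trans (hB0 y) _|apply: le_trans (hB1 y) _|apply: le_trans (hB2 y) _]; lra.
Qed.

Let H d (xi : R) u x s := phase_cos (p u x) d xi s * (f x * kap (rV_cons (s, u))).

Let T := (((R * 'rV[R]_2) * 'rV[R]_3) * R)%type.

Let mp d0 (T1 : measurableType d0) (u : T1 -> 'rV[R]_2) (x : T1 -> 'rV[R]_3) :
  measurable_fun setT u -> measurable_fun setT x -> measurable_fun setT (fun z => p (u z) (x z)).
Proof.
move=> mu mx; apply: measurable_cylinder_eq => //; exact: measurableT_comp mth mu.
Qed.

Let mH d : measurable_fun setT (fun z : T => H d z.1.1.1 z.1.1.2 z.1.2 z.2).
Proof.
have m11 : measurable_fun setT (fun z : T => z.1.1) by exact: measurableT_comp measurable_fst measurable_fst.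
have mxi : measurable_fun setT (fun z : T => z.1.1.1) by exact: measurableT_comp measurable_fst m11.
have mu : measurable_fun setT (fun z : T => z.1.1.2) by exact: measurableT_comp measurable_snd m11.
have mx : measurable_fun setT (fun z : T => z.1.2) by exact: measurableT_comp measurable_snd measurable_fst.
apply: measurable_funM.
  apply: (measurableT_comp (continuous_measurable_fun (@continuous_cos R))).
  apply: measurable_funD => //; apply: measurable_funM => //; apply: measurable_funB => //.
  exact: (mp mu mx).
apply: measurable_funM; first exact: measurableT_comp mf mx.
apply: measurableT_comp mk _.
apply: measurableT_comp (@measurable_rV_cons R 2) _.
exact: measurable_fun_pair.
Qed.

Section estimates.
Variables (B N : R).
Hypotheses (B0 : 0 <= B) (N0 : 0 < N) (KN : K `<=` box 3 N)
  (pN : forall x u, box 3 M x -> `|p u x| < N)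
  (kB : forall y, [/\ `|kap y| <= B, `|D0 kap y| <= B & `|D0 (D0 kap) y| <= B]).

Let off_box (g : 'rV[R]_3 -> R) s u : (forall y, ~ K y -> g y = 0) ->
  N < `|s| \/ ~ box 2 N u -> g (rV_cons (s, u)) = 0.
Proof.
move=> g0 su; apply: g0 => /KN Ks; case: su => [Ns|]; last apply.
  by have := Ks ord0; rewrite rV_cons0 leNgt Ns.
by move=> i; have := Ks (lift ord0 i); rewrite rV_consS.
Qed.

Let dslice u s : is_derive s (1 : R) (fun s => kap (rV_cons (s, u))) (D0 kap (rV_cons (s, u))).
Proof. by apply: is_derive_slice; exact: smooth_on_derivable sk _. Qed.

Let dslice2 u s :
  is_derive s (1 : R) (fun s => D0 kap (rV_cons (s, u))) (D0 (D0 kap) (rV_cons (s, u))).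
Proof.
by apply: is_derive_slice; exact: (smooth_on_derivable (smooth_on_derive (delta_mx 0 ord0) sk)).
Qed.

Let cslice2 u : continuous (fun s : R => D0 (D0 kap) (rV_cons (s, u))).
Proof.
move=> s; apply: (@continuous_comp _ _ _ (fun s : R => rV_cons (s, u))).
  exact: continuous_rV_cons_fst.
exact: (smooth_on_cts (smooth_on_derive (delta_mx 0 ord0) (smooth_on_derive (delta_mx 0 ord0) sk))).
Qed.

Let k0' : forall y, ~ K y -> D0 kap y = 0.
Proof. exact: derive_off_support (compact_closed (@norm_hausdorff _ _) cK) k0. Qed.

(** Fourier inversion asks for functions that vanish from the end point [M <= |s|] on, while the
    support gives zero only for [|s| > N]; hence the radius [N + 1]. *)
Let N1 : 0 < N + 1. Proof. by rewrite addr_gt0. Qed.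

Let slice0 (g : 'rV[R]_3 -> R) u s : (forall y, ~ K y -> g y = 0) ->
  N + 1 <= `|s| -> g (rV_cons (s, u)) = 0.
Proof. by move=> g0 Ns; apply: off_box => //; left; rewrite (lt_le_trans _ Ns)// ltrDl. Qed.

Let J d xi u x := \int[mu]_s H d xi u x s.
Let J0 d xi u x := \int[mu]_s (phase_cos (p u x) d xi s * kap (rV_cons (s, u))).

Let J0_le d xi u x : `|J0 d xi u x| <= 4 * (N + 1) * B / (1 + xi ^+ 2) * \1_(box 2 N) u.
Proof.
rewrite indicE; case: (boolP (u \in _)) => [_|/negP uN].
  rewrite mulr1; apply: (phase_integral_bound N1 (dslice u) (dslice2 u) (@cslice2 u)).
  - by move=> s; exact: slice0.
  - by move=> s; exact: slice0.
  - by move=> s; have [] := kB (rV_cons (s, u)).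
  - by move=> s; have [] := kB (rV_cons (s, u)).
rewrite mulr0 /J0 (_ : Rintegral _ _ _ = \int[mu]_(s in setT) 0).
  by rewrite Rintegral_cst// mul0r normr0.
apply: eq_Rintegral => s _; rewrite (off_box k0) ?mulr0//.
by right => uK; apply: uN; exact/mem_set.
Qed.

Let kap_le s u : `|kap (rV_cons (s, u))| <= \1_`[- N, N] s * (B * \1_(box 2 N) u).
Proof.
have [sN|sN] := pselect (`|s| <= N); last first.
  by rewrite off_box ?normr0 ?mulr_ge0//; left; rewrite ltNge; exact/negP.
have [uN|uN] := pselect (box 2 N u); last first.
  by rewrite off_box ?normr0 ?mulr_ge0//; right.
rewrite !indicE mem_set; last by rewrite /= in_itv/= -ler_norml.
by rewrite mem_set// mul1r mulr1; have [] := kB (rV_cons (s, u)).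
Qed.

Let mslice u : measurable_fun setT (fun s => kap (rV_cons (s, u))).
Proof.
by apply: (measurableT_comp mk); apply: measurableT_comp (@measurable_rV_cons R 2) _.
Qed.

Let i_itv : mu.-integrable setT (EFin \o (\1_`[- N, N] : R -> R)).
Proof. exact: integrable_indic_itv. Qed.

Let JE d xi u x : J d xi u x = f x * J0 d xi u x.
Proof.
rewrite /J /J0 -RintegralZl//; first by apply: eq_Rintegral => s _; rewrite /H mulrCA.
apply: le_integrable (integrable_EFinZr (B * \1_(box 2 N) u) measurableT i_itv) => //.
  apply/measurable_EFinP; apply: measurable_funM => //.
  exact: continuous_measurable_fun (@continuous_phase_cos R (p u x) d xi).
move=> s _; rewrite /= lee_fin (le_trans _ (ler_norm _))// normrM (le_trans _ (kap_le s u))//.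
by rewrite ler_piMl// ler_norml cos_geN1 cos_le1.
Qed.

(** A majorant that is a product of functions of [xi], [u] and [x], each integrable: it justifies
    every exchange of integrals that involves the frequency. *)
Let J_le d xi u x : `|J d xi u x| <=
  ((1 + xi ^+ 2)^-1 * \1_(box 2 N) u) * (4 * (N + 1) * B * C * \1_(box 3 M) x).
Proof.
rewrite JE normrM mulrC (le_trans (ler_pM _ _ (J0_le d xi u x) (fC x)))//.
by rewrite le_eqVlt; apply/orP; left; apply/eqP; ring.
Qed.

Let mJ d : measurable_fun setT (fun z : (R * 'rV[R]_2) * 'rV[R]_3 => J d z.1.1 z.1.2 z.2).
Proof. exact: (measurable_Rintegral_snd mu (mH d)). Qed.

Let h3 x := 4 * (N + 1) * B * C * \1_(box 3 M) x.
Let I3 := \int[lebesgue_rV R 3]_x h3 x.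

Let ih3 : (lebesgue_rV R 3).-integrable setT (EFin \o h3).
Proof. exact: (integrable_EFinZl _ measurableT (@integrable_box R 3 M)). Qed.

Let I3_ge0 : 0 <= I3.
Proof. by apply: Rintegral_ge0 => x _; rewrite !mulr_ge0// ltW. Qed.

Let Ju d xi u := \int[lebesgue_rV R 3]_x J d xi u x.

Let mJu d : measurable_fun setT (fun z : R * 'rV[R]_2 => Ju d z.1 z.2).
Proof. exact: (measurable_Rintegral_snd (lebesgue_rV R 3) (mJ d)). Qed.

Let Ju_le d xi u : `|Ju d xi u| <= (1 + xi ^+ 2)^-1 * (\1_(box 2 N) u * I3).
Proof.
rewrite mulrA.
exact: (@majorant_Rintegral_le _ _ _ _ R (lebesgue_rV R 3) _
  (fun z : R * 'rV[R]_2 => (1 + z.1 ^+ 2)^-1 * \1_(box 2 N) z.2) h3 (mJ d) ih3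
  (fun z x => J_le d z.1 z.2 x) (xi, u)).
Qed.

Let ih2 : (lebesgue_rV R 2).-integrable setT (EFin \o (fun u => \1_(box 2 N) u * I3)).
Proof. exact: (integrable_EFinZr _ measurableT (@integrable_box R 2 N)). Qed.

Let E d xi := \int[lebesgue_rV R 3]_y \int[lebesgue_rV R 3]_x
  (phase_cos (p (tl y) x) d xi (y 0 0) * (f x * kap y)).

Let mtl : measurable_fun setT (@tl R).
Proof. exact: measurable_tl. Qed.

Let mEx d xi : measurable_fun setT (fun z : 'rV[R]_3 * 'rV[R]_3 =>
  phase_cos (p (tl z.1) z.2) d xi (z.1 0 0) * (f z.2 * kap z.1)).
Proof.
apply: measurable_funM.
  apply: (measurableT_comp (continuous_measurable_fun (@continuous_cos R))).
  apply: measurable_funD => //; apply: measurable_funM => //; apply: measurable_funB => //.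
    apply: mp => //; exact: measurableT_comp mtl measurable_fst.
  exact: measurableT_comp (@measurable_coord R 3 0 0) measurable_fst.
apply: measurable_funM; first exact: measurableT_comp mf measurable_snd.
exact: measurableT_comp mk measurable_fst.
Qed.

Let cos_le d xi u x s (a : R) : `|phase_cos (p u x) d xi s * a| <= `|a|.
Proof. by rewrite normrM ler_piMl// ler_norml cos_geN1 cos_le1. Qed.

Let h1 x := C * \1_(box 3 M) x.
Let I1 := \int[lebesgue_rV R 3]_x h1 x.

Let ih1 : (lebesgue_rV R 3).-integrable setT (EFin \o h1).
Proof. exact: (integrable_EFinZl _ measurableT (@integrable_box R 3 M)). Qed.

(** The integral in [s] is brought innermost, as it alone supplies the decay in [xi]. At this stage
    [xi] is fixed, and bounding the cosine by [1] is enough for the exchanges. *)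
Let E_Ju d xi : E d xi = \int[lebesgue_rV R 2]_u Ju d xi u.
Proof.
have mh := measurable_Rintegral_snd (lebesgue_rV R 3) (mEx d xi).
rewrite /E (Rintegral_rVS mh i_itv
  (integrable_EFinZr (B * I1) measurableT (@integrable_box R 2 N))); last first.
  move=> s u; have := @majorant_Rintegral_le _ _ _ _ R (lebesgue_rV R 3) _
    (fun y : 'rV[R]_3 => `|kap y|) h1 (mEx d xi) ih1.
  move=> /(_ _ (rV_cons (s, u))) h.
  apply: le_trans (h _) _ => [y x|].
    by rewrite (le_trans (cos_le _ _ _ _ _ _))// normrM mulrC ler_wpM2l.
  have I10 : 0 <= I1 by apply: Rintegral_ge0 => x _; rewrite mulr_ge0.
  rewrite (le_trans (ler_wpM2r I10 (kap_le s u)))//.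
  by rewrite le_eqVlt; apply/orP; left; apply/eqP; ring.
apply: eq_Rintegral => u _; rewrite /Ju /J.
transitivity (\int[mu]_s \int[lebesgue_rV R 3]_x H d xi u x s).
  by apply: eq_Rintegral => s _; apply: eq_Rintegral => x _; rewrite tl_cons rV_cons0.
apply: (@Rintegral_fubini _ _ _ _ R mu (lebesgue_rV R 3) (fun z => H d xi u z.2 z.1)
  _ _ _ (integrable_EFinZr (B * \1_(box 2 N) u) measurableT i_itv) ih1).
  have := measurable_swapE (measurableT_comp (mH d) (_ :
    measurable_fun setT (fun z : 'rV[R]_3 * R => (((xi, u), z.1), z.2)))).
  by apply; apply: measurable_fun_pair => //; apply: measurable_fun_pair.
move=> s x; rewrite /H (le_trans (cos_le _ _ _ _ _ _))// normrM mulrC.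
by rewrite ler_pM//; exact: kap_le.
Qed.

Let mE d : measurable_fun setT (E d).
Proof.
rewrite (_ : E d = fun xi => \int[lebesgue_rV R 2]_u Ju d xi u); last exact/funext/E_Ju.
exact: (measurable_Rintegral_snd (lebesgue_rV R 2) (mJu d)).
Qed.

Let E_le : exists D, 0 <= D /\ forall d xi, `|E d xi| <= D / (1 + xi ^+ 2).
Proof.
exists (\int[lebesgue_rV R 2]_u (\1_(box 2 N) u * I3)); split.
  by apply: Rintegral_ge0 => u _; rewrite mulr_ge0.
move=> d xi; rewrite E_Ju mulrC.
exact: (@majorant_Rintegral_le _ _ _ _ R (lebesgue_rV R 2) _
  (fun xi : R => (1 + xi ^+ 2)^-1) _ (mJu d) ih2 (fun xi u => Ju_le d xi u) xi).
Qed.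

Let fourier_J d u x : \int[mu]_xi J d xi u x = 2 * pi * cos d * (f x * kap (rV_cons (p u x, u))).
Proof.
(* Inversion needs [|p u x| < N + 1], known only for [x] in the box; outside, [f x = 0] makes both
   sides zero. *)
have [xM|xM] := pselect (box 3 M x); last first.
  have fx : f x = 0.
    by have := fC x; rewrite indicE memNset// mulr0 normr_le0 => /eqP.
  rewrite fx mul0r mulr0 (_ : Rintegral _ _ _ = \int[mu]_(s in setT) 0).
    by rewrite Rintegral_cst// mul0r.
  by apply: eq_Rintegral => xi _; rewrite JE fx mul0r.
have pN1 : `|p u x| < N + 1 by rewrite (lt_trans (pN u xM))// ltrDl.
have g0 s : N + 1 <= `|s| -> kap (rV_cons (s, u)) = 0 by exact: slice0.
have g1 s : N + 1 <= `|s| -> D0 kap (rV_cons (s, u)) = 0 by exact: slice0.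
have g2 s : `|kap (rV_cons (s, u))| <= B by have [] := kB (rV_cons (s, u)).
have g3 s : `|D0 (D0 kap) (rV_cons (s, u))| <= B by have [] := kB (rV_cons (s, u)).
have iJ := fourier_inversion_integrable pN1 (dslice u) (dslice2 u) (@cslice2 u) g0 g1 g2 g3 d.
have EJ := fourier_inversion pN1 (dslice u) (dslice2 u) (@cslice2 u) g0 g1 g2 g3 d.
transitivity (\int[mu]_xi (f x * J0 d xi u x)).
  by apply: eq_Rintegral => xi _; rewrite JE.
by rewrite RintegralZl// EJ mulrCA.
Qed.

Let mchart_transform : measurable_fun setT (fun z : 'rV[R]_2 * R => kap (rV_cons (z.2, z.1)) * chart_transform f z.2 (th z.1)).
Proof.
apply: measurable_funM.
  apply: measurableT_comp mk _; apply: measurableT_comp (@measurable_rV_cons R 2) _.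
  exact: measurable_swap.
have mz : measurable_fun setT (fun z : 'rV[R]_2 * R => (z.2, th z.1)).
  by apply: measurable_fun_pair => //; exact: measurableT_comp mth measurable_fst.
exact: (measurableT_comp (measurable_chart_transform mf) mz).
Qed.

Let coarea_slice u : ~ pole (th u) ->
  \int[lebesgue_rV R 3]_x (f x * kap (rV_cons (p u x, u))) =
  \int[mu]_s (kap (rV_cons (s, u)) * chart_transform f s (th u)).
Proof.
move=> npu; rewrite (coarea_chart_transform C0 cf fC (th1 u) npu (fun s s01 => hsg s01 (th1 u)))//.
- move=> s; apply: (@continuous_comp _ _ _ (fun s : R => rV_cons (s, u))); last exact: ck.
  exact: continuous_rV_cons_fst.
- by move=> s s01; apply: k0 => /K01; rewrite rV_cons0.
Qed.

Let chart_transform_rV3 : \int[lebesgue_rV R 3]_y (kap y * chart_transform f (y 0 0) (th (tl y))) =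
  \int[lebesgue_rV R 2]_u \int[mu]_s (kap (rV_cons (s, u)) * chart_transform f s (th u)).
Proof.
pose D := C * \int[lebesgue_rV R 2]_v strip (3 * M) v.
rewrite (Rintegral_rVS _ i_itv (integrable_EFinZr (B * D) measurableT (@integrable_box R 2 N))).
- by apply: eq_Rintegral => u _; apply: eq_Rintegral => s _; rewrite tl_cons rV_cons0.
- have mz : measurable_fun setT (fun y : 'rV[R]_3 => (y 0 0, th (tl y))).
    apply: measurable_fun_pair; first exact: measurable_coord.
    exact: measurableT_comp mth mtl.
  by apply: measurable_funM => //; exact: (measurableT_comp (measurable_chart_transform mf) mz).
- move=> s u; rewrite normrM rV_cons0 tl_cons /=.
  rewrite (le_trans (ler_pM _ _ (kap_le s u) (chart_transform_bound C0 mf fC s (th1 u))))// -/D.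
  by rewrite le_eqVlt; apply/orP; left; apply/eqP; ring.
Qed.

(** The frequency integral is moved past [u] and then past [x]. Fourier inversion then evaluates
    [kap] at [s = p u x], and the coarea formula with [k = kap (rV_cons (_, u))] turns the integral
    over [x] into one over [s] of the transform. *)
Let E_fourier d : \int[mu]_xi E d xi =
  2 * pi * cos d * \int[lebesgue_rV R 3]_y (kap y * chart_transform f (y 0 0) (th (tl y))).
Proof.
transitivity (\int[mu]_xi \int[lebesgue_rV R 2]_u Ju d xi u).
  by apply: eq_Rintegral => xi _; rewrite E_Ju.
rewrite (@Rintegral_fubini _ _ _ _ R mu (lebesgue_rV R 2) (fun z => Ju d z.1 z.2)
  (fun xi : R => (1 + xi ^+ 2)^-1) _ (mJu d) (@integrable_oneDsqrV R) ih2 (fun xi u => Ju_le d xi u)) /=.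
transitivity (\int[lebesgue_rV R 2]_u \int[lebesgue_rV R 3]_x
    (2 * pi * cos d * (f x * kap (rV_cons (p u x, u))))).
  apply: eq_Rintegral => u _; rewrite /Ju.
  have mJ' : measurable_fun setT (fun z : R * 'rV[R]_3 => J d z.1 u z.2).
    apply: (measurableT_comp (mJ d) (_ : measurable_fun setT (fun z : R * 'rV[R]_3 => ((z.1, u), z.2)))).
    by apply: measurable_fun_pair => //; apply: measurable_fun_pair.
  have ih : (lebesgue_rV R 3).-integrable setT (EFin \o (fun x => \1_(box 2 N) u * h3 x)).
    exact: integrable_EFinZl.
  rewrite (@Rintegral_fubini _ _ _ _ R mu (lebesgue_rV R 3) (fun z => J d z.1 u z.2)
    (fun xi : R => (1 + xi ^+ 2)^-1) _ mJ' (@integrable_oneDsqrV R) ih); last first.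
    by move=> xi x /=; rewrite mulrA; exact: J_le.
  by apply: eq_Rintegral => x _; exact: fourier_J.
pose D := C * \int[lebesgue_rV R 2]_v strip (3 * M) v.
have hr u s : `|kap (rV_cons (s, u)) * chart_transform f s (th u)| <= (\1_(box 2 N) u * (B * D)) * \1_`[- N, N] s.
  rewrite normrM (le_trans (ler_pM _ _ (kap_le s u) (chart_transform_bound C0 mf fC s (th1 u))))// -/D.
  by rewrite le_eqVlt; apply/orP; left; apply/eqP; ring.
have ih := integrable_EFinZr (B * D) measurableT (@integrable_box R 2 N).
rewrite chart_transform_rV3 -RintegralZl//; last first.
  exact: (@majorant_integrable_Rintegral _ _ _ _ R (lebesgue_rV R 2) mu _ _ _ mchart_transform ih i_itv hr).
have ixk u : (lebesgue_rV R 3).-integrable setT (fun x => (f x * kap (rV_cons (p u x, u)))%:E).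
  apply: (@integrable_bounded_box R 3 _ (C * B) M).
    apply: measurable_funM => //; apply: measurableT_comp mk _.
    apply: measurableT_comp (@measurable_rV_cons R 2) _.
    by apply: measurable_fun_pair => //; exact: mp.
  by move=> x; rewrite normrM mulrAC ler_pM//; have [] := kB (rV_cons (p u x, u)).
rewrite /Rintegral; congr fine; apply: ae_eq_integral => //.
- have mz : measurable_fun setT (fun z : 'rV[R]_2 * 'rV[R]_3 =>
      2 * pi * cos d * (f z.2 * kap (rV_cons (p z.1 z.2, z.1)))).
    apply: measurable_funM => //; apply: measurable_funM; first exact: measurableT_comp mf measurable_snd.
    apply: measurableT_comp mk _; apply: measurableT_comp (@measurable_rV_cons R 2) _.
    by apply: measurable_fun_pair => //; exact: mp.
  by apply/measurable_EFinP; exact: (measurable_Rintegral_snd (lebesgue_rV R 3) mz).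
- apply/measurable_EFinP; apply: measurable_funM => //.
  exact: (measurable_Rintegral_snd mu mchart_transform).
(* The coarea formula is available only when [th u] is not a pole, so the integrands are compared
   almost everywhere in [u]. *)
- apply: filterS th_pole => u npu _; congr EFin.
  have Eu : \int[lebesgue_rV R 3]_x (2 * pi * cos d * (f x * kap (rV_cons (p u x, u)))) =
    2 * pi * cos d * \int[lebesgue_rV R 3]_x (f x * kap (rV_cons (p u x, u))).
    by rewrite RintegralZl//; exact: ixk.
  exact: etrans Eu (congr1 ( *%R _) (coarea_slice npu)).
Qed.

Let weak_integralE d : weak_integral th f kap d = E d.
Proof.
apply/funext => xi; apply: eq_Rintegral => y _; apply: eq_Rintegral => x _.
by rewrite /phase_cos /p !cylinder_eqE subr0.
Qed.

Lemma weak_formula_estimates d :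
  [/\ measurable_fun setT (weak_integral th f kap d),
    exists D, 0 <= D /\ forall xi, `|weak_integral th f kap d xi| <= D / (1 + xi ^+ 2) &
    \int[mu]_xi weak_integral th f kap d xi =
    2 * pi * cos d * \int[lebesgue_rV R 3]_y (kap y * chart_transform f (y 0 0) (th (tl y)))].
Proof.
rewrite weak_integralE; split; [exact: mE| |exact: E_fourier].
by have [D [D00 ED]] := E_le; exists D; split=> // xi; exact: ED.
Qed.

End estimates.

Theorem weak_formula d :
  [/\ measurable_fun setT (weak_integral th f kap d),
    exists D, 0 <= D /\ forall xi, `|weak_integral th f kap d xi| <= D / (1 + xi ^+ 2) &
    \int[mu]_xi weak_integral th f kap d xi =
    2 * pi * cos d * \int[lebesgue_rV R 3]_y (kap y * chart_transform f (y 0 0) (th (tl y)))].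
Proof.
have [B [N [B0 N0 KN pN kB]]] := bounds.
exact: (weak_formula_estimates B0 N0 KN pN kB d).
Qed.

End weak_formula.

(** * The weight *)

Section gradients.
Context {R : realType}.

Lemma grad_is_derive n (f : 'rV[R]_n -> R) (x g : 'rV[R]_n) :
  (forall v, is_derive x v f (dotp g v)) -> grad f x = g.
Proof.
move=> fg; apply/rowP => j; rewrite mxE (@derive_val _ _ _ _ _ _ _ (fg _)).
rewrite /dotp (bigD1 j)//= mxE !eqxx mulr1 big1 ?addr0// => i ij.
by rewrite mxE (negPf ij) andbF mulr0.
Qed.

Lemma is_derive_dotpl n (w x v : 'rV[R]_n) : is_derive x v (fun y => dotp y w) (dotp v w).
Proof.
by apply: is_derive_affine => t; rewrite dotpDl dotpZl.
Qed.

Lemma is_derive_dotp2 n (x v : 'rV[R]_n) : is_derive x v (fun y => dotp y y) (2 * dotp x v).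
Proof.
rewrite (_ : (fun y : 'rV[R]_n => dotp y y) = \sum_(i < n) (fun y : 'rV[R]_n => y 0 i ^+ 2)); last first.
  by apply/funext => y; rewrite fct_sumE; apply: eq_bigr => i _; rewrite expr2.
have D i : is_derive x v (fun y : 'rV[R]_n => y 0 i ^+ 2) (2 * x 0 i * v 0 i).
  have d1 : is_derive x v (fun y : 'rV[R]_n => y 0 i) (v 0 i).
    by apply: is_derive_affine => t; rewrite !mxE.
  have := is_deriveX 2 d1; rewrite (_ : _ ^+ 2 = fun y : 'rV[R]_n => y 0 i ^+ 2)//.
have := @is_derive_sum _ _ _ n (fun i (y : 'rV[R]_n) => y 0 i ^+ 2) x v _ D.
move/is_derive_eq; apply; rewrite /dotp mulr_sumr; apply: eq_bigr => i _; by rewrite mulrA.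
Qed.

Lemma is_derive_cylinder_eq s (t x v : 'rV[R]_3) :
  is_derive x v (cylinder_eq s t) (2 * (dotp x v - dotp x t * dotp v t)).
Proof.
have d1 := is_derive_dotp2 x v.
have d2 := is_deriveX 2 (is_derive_dotpl t x v).
have := is_deriveB (is_deriveB d1 d2) (is_derive_cst s x v).
rewrite (_ : _ - _ - _ = cylinder_eq s t); last first.
  by apply/funext => y; rewrite cylinder_eqE.
by move/is_derive_eq; apply; rewrite /GRing.scale /=; ring.
Qed.

Lemma grad_cylinder_eq s (t x : 'rV[R]_3) :
  grad (cylinder_eq s t) x = 2 *: (x - dotp x t *: t).
Proof.
apply: grad_is_derive => v; have := is_derive_cylinder_eq s t x v.
by rewrite dotpZl dotpDl dotpNl dotpZl (dotpC t v).
Qed.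

Lemma dotp_normal (t x : 'rV[R]_3) : dotp t t = 1 ->
  dotp (x - dotp x t *: t) (x - dotp x t *: t) = dotp x x - dotp x t ^+ 2.
Proof.
move=> tt; rewrite !(dotpDl, dotpDr, dotpNl, dotpNr, dotpZl, dotpZr) tt (dotpC t x).
by ring.
Qed.

Lemma enorm_grad_cylinder_eq s (t x : 'rV[R]_3) : dotp t t = 1 -> 0 <= s -> cyl s t x ->
  enorm (grad (cylinder_eq s t) x) = 2 * Num.sqrt s.
Proof.
move=> tt s0 sx; apply: enormE; first by rewrite mulr_ge0 ?sqrtr_ge0.
rewrite grad_cylinder_eq dotpZl dotpZr dotp_normal// exprMn sqr_sqrtr//.
by move: sx; rewrite /cyl /= cylinder_eqE => /eqP; rewrite subr_eq0 => /eqP ->; ring.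
Qed.

Lemma is_derive_hfun s (t y v : 'rV[R]_3) : dotp t t = 1 -> dotp y y != 1 ->
  let Q := 1 - dotp y y in let q := dotp y y - dotp y t ^+ 2 in
  is_derive y v (fun y => hfun s y t)
   (8 * (dotp y v - dotp y t * dotp v t) / Q ^+ 2 + 16 * q * dotp y v / Q ^+ 3).
Proof.
move=> tt y1 Q q; have Q0 : Q != 0 by rewrite /Q subr_eq0 eq_sym.
have d1 := is_derive_cylinder_eq 0 t y v.
have dQ : is_derive y v (fun y : 'rV[R]_3 => 1 - dotp y y) (- (2 * dotp y v)).
  have := is_deriveB (is_derive_cst (1 : R) y v) (is_derive_dotp2 y v).
  by rewrite sub0r.
have dh : is_derive Q (1 : R) (fun z : R => (z ^+ 2)^-1) (- 2 / Q ^+ 3).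
  have Q20 : Q ^+ 2 != 0 by rewrite expf_neq0.
  have := @is_deriveV R (fun z : R => z ^+ 2) Q _ 1 Q20 (is_deriveX 2 (is_derive_id Q (1 : R))).
  by move/is_derive_eq; apply; rewrite /GRing.scale /=; field.
have d2 := @is_derive_comp1 R _ (fun z : R => (z ^+ 2)^-1) (fun y : 'rV[R]_3 => 1 - dotp y y) y v _ _ dh dQ.
have := is_deriveB (is_deriveM (is_deriveM (is_derive_cst (4 : R) y v) d1) d2) (is_derive_cst s y v).
rewrite (_ : _ - _ = fun y => hfun s y t); last first.
  apply/funext => z; rewrite /hfun !sqr_enorm dotp_crossp tt mulr1.
  by rewrite -[dotp z z - _]subr0 -cylinder_eqE.
move/is_derive_eq; apply; rewrite /GRing.scale /= -[(cst 4 * _) y]/(4 * cylinder_eq 0 t y) !cylinder_eqE subr0 -/Q -/q.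
by field.
Qed.

Lemma grad_hfun s (t y : 'rV[R]_3) : dotp t t = 1 -> dotp y y != 1 ->
  let Q := 1 - dotp y y in let q := dotp y y - dotp y t ^+ 2 in
  grad (fun y => hfun s y t) y =
  (8 / Q ^+ 2) *: (y - dotp y t *: t) + (16 * q / Q ^+ 3) *: y.
Proof.
move=> tt y1 Q q; apply: grad_is_derive => v; have /= := is_derive_hfun s v tt y1.
move/is_derive_eq; apply; rewrite -/Q -/q !(dotpDl, dotpNl, dotpZl) (dotpC t v).
ring.
Qed.

(** [S] is [hfun s y t + s]. In the squared norm, the cross term and the square of the radial term
    combine because [Q + dotp y y = 1], leaving [16 * S * (1 + S) / Q ^+ 2]. *)
Lemma enorm_grad_hfun s (t y : 'rV[R]_3) : dotp t t = 1 -> dotp y y < 1 ->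
  let Q := 1 - dotp y y in let S := 4 * (dotp y y - dotp y t ^+ 2) / Q ^+ 2 in
  0 <= S -> enorm (grad (fun y => hfun s y t) y) = 4 * Num.sqrt (S * (1 + S)) / Q.
Proof.
move=> tt y1 Q S S0; have Q0 : 0 < Q by rewrite subr_gt0.
apply: enormE.
  by rewrite divr_ge0 ?mulr_ge0 ?sqrtr_ge0// ltW.
rewrite grad_hfun//; last by rewrite lt_eqF.
rewrite exprMn exprMn sqr_sqrtr; last by rewrite mulr_ge0// addr_ge0.
rewrite !(dotpDl, dotpDr, dotpNl, dotpNr, dotpZl, dotpZr) tt (dotpC t y) /S -/Q.
have yE : dotp y y = 1 - Q by rewrite /Q; ring.
rewrite yE; field; exact: lt0r_neq0.
Qed.

End gradients.

Section weight.
Context {R : realType}.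

(* On the cylinder of parameter [s] the weight of the transform splits as
   [weight_x x * weight_s s], see [weight_hfun]. *)
Definition weight_x (x : 'rV[R]_3) : R := (2 * (Num.sqrt (1 + dotp x x) + 1))^-1.
Definition weight_s (s : R) : R := (Num.sqrt (s * (1 + s)))^-1.

(** Multiplying by the conjugate [sqrt (1 + |x|^2) + 1] removes the quotients by the norm of [x];
    this form of the factor is smooth even at the origin. *)
Lemma vmapE (x : 'rV[R]_3) : x != 0 ->
  let l := (Num.sqrt (1 + dotp x x) + 1)^-1 in vmap x = l *: x.
Proof.
move=> x0 l; have r0 : 0 < dotp x x.
  by rewrite lt_neqAle dotp_ge0 andbT; apply/eqP => xx; move/negP: x0; apply; apply/eqP/dotp0_eq0.
have e0 : 0 < enorm x by rewrite sqrtr_gt0.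
rewrite /vmap scalerA; congr (_ *: _).
have -> : 1 + 1 / enorm x ^+ 2 = (1 + dotp x x) / (enorm x ^+ 2).
  by rewrite sqr_enorm; field; exact: lt0r_neq0.
have s0 : 0 <= 1 + dotp x x by rewrite addr_ge0// ltW.
rewrite sqrtrM// sqrtrV ?sqr_ge0// sqrtr_sqr ger0_norm ?ltW// /l.
have e2 : enorm x ^+ 2 = (Num.sqrt (1 + dotp x x) - 1) * (Num.sqrt (1 + dotp x x) + 1).
  by rewrite sqr_enorm -[LHS](addrK 1) (addrC _ 1) -{1}(sqr_sqrtr s0); ring.
have w0 : 0 < Num.sqrt (1 + dotp x x) + 1 by rewrite ltr_wpDl ?sqrtr_ge0.
apply: (@mulIf _ (enorm x ^+ 2)); first by rewrite expf_neq0// gt_eqF.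
by rewrite [in RHS]e2; field; rewrite !gt_eqF.
Qed.

(** With [W = sqrt (1 + |x|^2)] one finds [|v|^2 = (W - 1) / (W + 1)] and [1 - |v|^2 = 2 / (W + 1)].
    The quantity [S] of [enorm_grad_hfun] is then the cylinder parameter [s], and the gradient has
    norm [2 * (W + 1) * sqrt (s * (1 + s))]. *)
Lemma weight_hfun s (t x : 'rV[R]_3) : dotp t t = 1 -> 0 <= s -> x != 0 -> cyl s t x ->
  (enorm (grad (fun y => hfun s y t) (vmap x)))^-1 = weight_x x * weight_s s.
Proof.
move=> tt s0 x0 sx; rewrite vmapE//.
set W := Num.sqrt (1 + dotp x x).
have W1 : 1 < W.
  rewrite -[ltLHS]sqrtr1 ltr_sqrt; last by rewrite ltr_pwDl ?dotp_ge0.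
  rewrite ltrDl lt_neqAle dotp_ge0 andbT.
  by apply/eqP => xx; move/negP: x0; apply; apply/eqP/dotp0_eq0.
have W2 : dotp x x = W ^+ 2 - 1.
  by rewrite sqr_sqrtr ?addr_ge0 ?dotp_ge0//; ring.
have Wp : 0 < W + 1 by lra.
have yy : dotp ((W + 1)^-1 *: x) ((W + 1)^-1 *: x) = (W - 1) / (W + 1).
  by rewrite dotpZl dotpZr W2; field; rewrite gt_eqF.
have Q : 1 - dotp ((W + 1)^-1 *: x) ((W + 1)^-1 *: x) = 2 / (W + 1).
  by rewrite yy; field; rewrite gt_eqF.
have q : dotp x x - dotp x t ^+ 2 = s.
  by move: sx; rewrite /cyl /= cylinder_eqE => /eqP; rewrite subr_eq0 => /eqP.
have S : 4 * (dotp ((W + 1)^-1 *: x) ((W + 1)^-1 *: x) - dotp ((W + 1)^-1 *: x) t ^+ 2) /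
   (1 - dotp ((W + 1)^-1 *: x) ((W + 1)^-1 *: x)) ^+ 2 = s.
  by rewrite Q -q dotpZl dotpZr !dotpZl; field; rewrite gt_eqF.
rewrite enorm_grad_hfun//; last 2 first.
- by rewrite -subr_gt0 Q divr_gt0.
- by rewrite S.
rewrite S Q /weight_x /weight_s -/W !invfM !invrK.
by set c := (Num.sqrt _)^-1; field; rewrite gt_eqF.
Qed.

Lemma smooth_weight_x : smooth_on setT weight_x.
Proof.
have oT : open [set: 'rV[R]_3] by exact: openT.
have sid := @smooth_on_id R 'rV[R]_3 setT.
have s1 : smooth_on setT (fun x : 'rV[R]_3 => 1 + dotp x x).
  exact (smooth_onD oT (@smooth_on_cst _ _ R setT 1) (smooth_on_dotp oT sid sid)).
have p1 (x : 'rV[R]_3) : setT x -> 0 < 1 + dotp x x.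
  by move=> _; rewrite ltr_pwDl ?dotp_ge0.
have s2 := smooth_onZ 2 oT (smooth_onD oT (smooth_on_sqrt oT p1 s1) (@smooth_on_cst _ _ R setT 1)).
apply: (smooth_onV oT _ s2) => x _.
by rewrite mulr_gt0// ltr_wpDl ?sqrtr_ge0.
Qed.

Lemma smooth_weight_s : smooth_on [set s : R | 0 < s] weight_s.
Proof.
have oT : open [set s : R | 0 < s] by exact: open_pos.
have sid := @smooth_on_id R R [set s : R | 0 < s].
have s1 : smooth_on [set s : R | 0 < s] (fun s => s * (1 + s)).
  exact (smooth_onM oT sid (smooth_onD oT (@smooth_on_cst _ _ R _ 1) sid)).
have p1 (s : R) : [set s : R | 0 < s] s -> 0 < s * (1 + s).
  by move=> /= s0; rewrite mulr_gt0// addr_gt0.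
apply: (smooth_onV oT _ (smooth_on_sqrt oT p1 s1)) => s s0.
by rewrite sqrtr_gt0 p1.
Qed.

End weight.

Section transform_formula.
Context {R : realType}.

Lemma compact_support_box n (K : set 'rV[R]_n) (f : 'rV[R]_n -> R) :
  compact K -> continuous f -> (forall x, ~ K x -> f x = 0) ->
  exists C M, 0 <= C /\ forall x, `|f x| <= C * \1_(box n M) x.
Proof.
move=> cK cf f0; have [C fC] := compact_support_bounded cK cf f0.
have [M KM] := compact_sub_box cK.
have C0 : 0 <= C by exact: le_trans (fC 0).
exists C, M; split=> // x; have [xM|xM] := pselect (box n M x).
  by rewrite indicE mem_set// mulr1.
by rewrite f0 ?normr0 ?mulr_ge0// => /KM.
Qed.

Lemma chart_transformZ (g : 'rV[R]_3 -> R) (c C M : R) s t : dotp t t = 1 -> 0 <= C ->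
  measurable_fun setT g -> (forall x, `|g x| <= C * \1_(box 3 M) x) ->
  chart_transform (fun x => c * g x) s t = c * chart_transform g s t.
Proof.
move=> tt C0 mg gC; rewrite /chart_transform -RintegralZl//; last exact: (chart_transform_integrable C0 mg gC).
by apply: eq_Rintegral => v _; rewrite mulrA.
Qed.

Section one_direction.
Variables (eps1 eps2 s : R) (t : 'rV[R]_3) (sg : {measure set 'rV[R]_3 -> \bar R}).
Hypotheses (e1 : 0 < eps1) (e12 : eps1 < eps2) (e2 : eps2 < 1) (s01 : 0 < s < 1) (tt : dotp t t = 1)
  (hsg : is_surface_measure (cyl s t) sg).
Let X := shell (alpha_of eps1) (alpha_of eps2).

Lemma shell_neq0 (x : 'rV[R]_3) : X x -> x != 0.
Proof.
move=> /andP[a1 _]; apply/eqP => x0; move: a1; rewrite x0 /enorm.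
have -> : dotp (0 : 'rV[R]_3) 0 = 0 by rewrite /dotp big1// => i _; rewrite mxE mul0r.
rewrite sqrtr0.
apply/negP; rewrite -leNgt /alpha_of divr_ge0 ?mulr_ge0 ?(ltW e1)// subr_ge0.
by rewrite expr_le1// ltW// (lt_trans e12).
Qed.

(** Since [g] vanishes off the shell, the integral extends to the whole cylinder. There the weight
    splits and the norm of the gradient is the constant [2 * Num.sqrt s]. *)
Lemma Rintegral_weighted (g : 'rV[R]_3 -> R) (C M : R) : 0 <= C -> continuous g ->
  (forall x, `|weight_x x * g x| <= C * \1_(box 3 M) x) -> (forall x, ~ X x -> g x = 0) ->
  \int[sg]_(x in X `&` cyl s t)
    ((enorm (grad (fun y => hfun s y t) (vmap x)))^-1 * g x * (enorm (grad (cylinder_eq s t) x))^-1) =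
  weight_s s * chart_transform (fun x => weight_x x * g x) s t.
Proof.
move=> C0 cg gC g0; case/andP : (s01) => s0 _.
have mg : measurable_fun setT (fun x => weight_x x * g x).
  apply: measurable_funM; last exact: continuous_rV_measurable.
  by apply: continuous_rV_measurable => x; exact: (smooth_on_cts (@smooth_weight_x R)).
rewrite -(chart_transformZ _ _ tt C0 mg gC).
have mwg : measurable_fun setT (fun x => weight_s s * (weight_x x * g x)).
  exact: measurable_funM.
rewrite -(surface_integral_chart_transform mwg s0 tt hsg) Rintegral_mkcondl.
apply: eq_Rintegral => x /[!inE] sx; rewrite patchE; case: ifPn => [/[!inE] Xx|Xx].
  by rewrite enorm_grad_cylinder_eq ?(ltW s0)// weight_hfun ?(ltW s0) ?shell_neq0//; ring.
by rewrite g0 ?mulr0 ?mul0r// => /mem_set; exact/negP.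
Qed.

End one_direction.

Lemma cylinder_transformE (eps1 eps2 s : R) (t : 'rV[R]_3)
    (sigma : R -> 'rV[R]_3 -> {measure set 'rV[R]_3 -> \bar R}) (f : 'rV[R]_3 -> R[i]) :
  0 < eps1 -> eps1 < eps2 -> eps2 < 1 -> 0 < s < 1 -> dotp t t = 1 ->
  is_surface_measure (cyl s t) (sigma s t) ->
  test_function (shell (alpha_of eps1) (alpha_of eps2)) f ->
  cylinder_transform sigma eps1 eps2 f s t =
  Complex (weight_s s * chart_transform (fun x => weight_x x * complex.Re (f x)) s t)
    (weight_s s * chart_transform (fun x => weight_x x * complex.Im (f x)) s t).
Proof.
move=> e1 e12 e2 s01 tt hsg [[sr si] [K [cK KX f0]]].
have K0 (h : R[i] -> R) : h 0 = 0 -> forall x, ~ K x -> weight_x x * h (f x) = 0.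
  by move=> h0 x /f0 ->; rewrite h0 mulr0.
have X0 (h : R[i] -> R) : h 0 = 0 -> forall x,
    ~ shell (alpha_of eps1) (alpha_of eps2) x -> h (f x) = 0.
  by move=> h0 x Xx; rewrite f0// => /KX.
have cw (h : 'rV[R]_3 -> R) : smooth_on setT h -> continuous (fun x => weight_x x * h x).
  move=> sh x; apply: (@continuousM _ _ (@weight_x R) h).
    exact: (smooth_on_cts (@smooth_weight_x R)).
  exact: (smooth_on_cts sh).
have [C1 [M1 [C10 h1]]] := compact_support_box cK (cw _ sr) (K0 (@complex.Re R) erefl).
have [C2 [M2 [C20 h2]]] := compact_support_box cK (cw _ si) (K0 (@complex.Im R) erefl).
have c1 : continuous (fun x => complex.Re (f x)) by move=> x; exact: (smooth_on_cts sr).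
have c2 : continuous (fun x => complex.Im (f x)) by move=> x; exact: (smooth_on_cts si).
rewrite -(Rintegral_weighted e1 e12 e2 s01 tt hsg C10 c1 h1 (X0 (@complex.Re R) erefl)).
rewrite -(Rintegral_weighted e1 e12 e2 s01 tt hsg C20 c2 h2 (X0 (@complex.Im R) erefl)).
rewrite /cylinder_transform /delta_integral /cintegral; congr Complex; apply: eq_Rintegral => x _.
- by case: (f x) => a b /=; move: (enorm _)^-1 (enorm _)^-1 => p q; ring.
- by case: (f x) => a b /=; move: (enorm _)^-1 (enorm _)^-1 => p q; ring.
Qed.

End transform_formula.

(** * Complex integrals and cutoffs *)

Section complex_integrals.
Context {R : realType}.
Notation Re := (@complex.Re R).
Notation Im := (@complex.Im R).

Lemma complex_ext (a b : R[i]) : Re a = Re b -> Im a = Im b -> a = b.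
Proof. by case: a b => [? ?] [? ?] /= -> ->. Qed.

Lemma ReD (a b : R[i]) : Re (a + b) = Re a + Re b. Proof. by case: a b => [? ?] []. Qed.
Lemma ImD (a b : R[i]) : Im (a + b) = Im a + Im b. Proof. by case: a b => [? ?] []. Qed.
Lemma ReM (a b : R[i]) : Re (a * b) = Re a * Re b - Im a * Im b.
Proof. by case: a b => [? ?] []. Qed.
Lemma ImM (a b : R[i]) : Im (a * b) = Re a * Im b + Im a * Re b.
Proof. by case: a b => [? ?] []. Qed.

Section linearity.
Context d (T : measurableType d) (mu : {measure set T -> \bar R}) (D : set T).
Hypothesis mD : measurable D.

Lemma cintegrable0 : cintegrable mu D (fun=> 0).
Proof. by split; exact: integrable0. Qed.

Lemma cintegral0 : cintegral mu D (fun=> 0) = 0.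
Proof.
by apply: complex_ext => /=; rewrite (_ : Rintegral _ _ _ = \int[mu]_(x in D) 0)//;
  rewrite /Rintegral integral0_eq.
Qed.

Lemma cintegrableD (f g : T -> R[i]) : cintegrable mu D f -> cintegrable mu D g ->
  cintegrable mu D (fun x => f x + g x).
Proof.
move=> [f1 f2] [g1 g2]; split.
- by apply: eq_integrable (integrableD mD f1 g1) => // x _; rewrite ReD EFinD.
- by apply: eq_integrable (integrableD mD f2 g2) => // x _; rewrite ImD EFinD.
Qed.

Lemma cintegralD (f g : T -> R[i]) : cintegrable mu D f -> cintegrable mu D g ->
  cintegral mu D (fun x => f x + g x) = cintegral mu D f + cintegral mu D g.
Proof.
move=> [f1 f2] [g1 g2]; apply: complex_ext; rewrite ?ReD ?ImD /= -RintegralD//.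
- by apply: eq_Rintegral => x _; rewrite ReD.
- by apply: eq_Rintegral => x _; rewrite ImD.
Qed.

Lemma cintegrableZ c (f : T -> R[i]) : cintegrable mu D f ->
  cintegrable mu D (fun x => c * f x).
Proof.
move=> [f1 f2].
have i1 := integrable_EFinZl (Re c) mD f1; have i2 := integrable_EFinZl (Re c) mD f2.
have j1 := integrable_EFinZl (Im c) mD f1; have j2 := integrable_EFinZl (Im c) mD f2.
split.
- by apply: eq_integrable (integrableB mD i1 j2) => // x _; rewrite ReM EFinB.
- by apply: eq_integrable (integrableD mD i2 j1) => // x _; rewrite ImM EFinD.
Qed.

Lemma cintegralZ c (f : T -> R[i]) : cintegrable mu D f ->
  cintegral mu D (fun x => c * f x) = c * cintegral mu D f.
Proof.
move=> [f1 f2].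
have i1 := integrable_EFinZl (Re c) mD f1; have i2 := integrable_EFinZl (Re c) mD f2.
have j1 := integrable_EFinZl (Im c) mD f1; have j2 := integrable_EFinZl (Im c) mD f2.
apply: complex_ext; rewrite ?ReM ?ImM /= -!RintegralZl//.
- by rewrite -RintegralB//; apply: eq_Rintegral => x _; rewrite ReM.
- by rewrite -RintegralD//; apply: eq_Rintegral => x _; rewrite ImM.
Qed.

Lemma cintegrable_sum (I : Type) (r : seq I) (c : I -> R[i]) (h : I -> T -> R[i]) :
  (forall k, cintegrable mu D (h k)) ->
  cintegrable mu D (fun x => \sum_(k <- r) c k * h k x).
Proof.
move=> ih; elim: r => [|k r IH].
  by under eq_fun do rewrite big_nil; exact: cintegrable0.
under eq_fun do rewrite big_cons.
by apply: cintegrableD => //; exact: cintegrableZ.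
Qed.

Lemma cintegral_sum (I : Type) (r : seq I) (c : I -> R[i]) (h : I -> T -> R[i]) :
  (forall k, cintegrable mu D (h k)) ->
  cintegral mu D (fun x => \sum_(k <- r) c k * h k x) = \sum_(k <- r) c k * cintegral mu D (h k).
Proof.
move=> ih; elim: r => [|k r IH].
  by under eq_fun do rewrite big_nil; rewrite big_nil; exact: cintegral0.
under eq_fun do rewrite big_cons.
rewrite big_cons cintegralD; last exact: cintegrable_sum; last exact: cintegrableZ.
by rewrite cintegralZ// IH.
Qed.

Lemma cintegrable_real (h : T -> R) : mu.-integrable D (EFin \o h) ->
  cintegrable mu D (fun x => (h x)%:C%C).
Proof. by move=> ih; split => //; exact: integrable0. Qed.

Lemma cintegral_real (h : T -> R) :
  cintegral mu D (fun x => (h x)%:C%C) = (\int[mu]_(x in D) h x)%:C%C.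
Proof. by apply: complex_ext => //=; rewrite /Rintegral integral0_eq. Qed.

Lemma eq_cintegral (f g : T -> R[i]) : (forall x, D x -> f x = g x) ->
  cintegral mu D f = cintegral mu D g.
Proof.
by move=> fg; apply: complex_ext; apply: eq_Rintegral => x /[!inE] Dx; rewrite fg.
Qed.

End linearity.

Lemma ccvg_sum (F : set_system R) (I : Type) (r : seq I) (c : I -> R[i]) (u : I -> R -> R[i])
    (l : I -> R[i]) : Filter F -> (forall k, ccvg_to F (u k) (l k)) ->
  ccvg_to F (fun t => \sum_(k <- r) c k * u k t) (\sum_(k <- r) c k * l k).
Proof.
move=> FF ul; elim: r => [|k r [IH1 IH2]].
  under eq_fun do rewrite big_nil; rewrite big_nil.
  by split; exact: cvg_cst.
under eq_fun do rewrite big_cons; rewrite big_cons.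
have [u1 u2] := ul k; split.
- under eq_fun do rewrite ReD ReM; rewrite ReD ReM.
  by apply: cvgD => //; apply: cvgB; apply: cvgMr.
- under eq_fun do rewrite ImD ImM; rewrite ImD ImM.
  by apply: cvgD => //; apply: cvgD; apply: cvgMr.
Qed.

End complex_integrals.

(** * Removal of the frequency cutoff *)

Section cutoff.
Context {R : realType}.
Notation leb1 := (lebesgue_rV R 1).
Variables (W : R -> R) (B : R).
Hypotheses (mW : measurable_fun setT W) (WB : forall xi, `|W xi| <= B / (1 + xi ^+ 2)).

Let mW1 : measurable_fun setT (fun xi : 'rV[R]_1 => W (xi 0 0)).
Proof. exact: measurableT_comp mW (@measurable_coord R 1 0 0). Qed.

Section real_cutoff.
Variables (r : 'rV[R]_1 -> R) (D : R).
Hypotheses (cr : continuous r) (rD : forall xi, `|r xi| <= D).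

Let mr e : measurable_fun setT (fun xi : 'rV[R]_1 => r (e *: xi) * W (xi 0 0)).
Proof.
apply: measurable_funM => //; apply: continuous_rV_measurable => x.
by apply: (@continuous_comp _ _ _ (fun x : 'rV[R]_1 => e *: x)); [exact: scaler_continuous|exact: cr].
Qed.

Let rW_le e xi : `|r (e *: xi) * W (xi 0 0)| <= D * B * (1 + xi 0 0 ^+ 2)^-1.
Proof. by rewrite normrM -mulrA ler_pM. Qed.

Let iDB := integrable_EFinZl (D * B) measurableT (@integrable_oneDsqrV_coord R).

Lemma cutoff_integrable e :
  leb1.-integrable setT (EFin \o (fun xi : 'rV[R]_1 => r (e *: xi) * W (xi 0 0))).
Proof.
apply: le_integrable iDB => //; first exact/measurable_EFinP.
by move=> xi _; rewrite /= lee_fin (le_trans (rW_le _ _))// ler_norm.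
Qed.

(** Dominated convergence along sequences tending to [0] from the right. The majorant
    [D * B / (1 + xi^2)] comes from the decay of [W], the cutoff being merely bounded. *)
Lemma cutoff_cvg : \int[leb1]_xi (r (e *: xi) * W (xi 0 0)) @[e --> 0^'+] -->
  r 0 * \int[lebesgue_measure]_xi W xi.
Proof.
apply/cvg_at_rightP => u [u0 cu].
have -> : r 0 * \int[lebesgue_measure]_xi W xi = \int[leb1]_xi (r 0 * W (xi 0 0)).
  rewrite RintegralZl//.
    by congr (_ * _); rewrite Rintegral_rV1//; apply: eq_Rintegral => s _; rewrite rV_cons0.
  apply: le_integrable (integrable_EFinZl B measurableT (@integrable_oneDsqrV_coord R)) => //.
    exact/measurable_EFinP.
  by move=> xi _; rewrite /= lee_fin (le_trans (WB _))// ler_norm.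
apply: (Rintegral_dominated measurableT (fun n => mr (u n)) _ iDB (fun n x _ => rW_le (u n) x)).
move=> xi _; apply: cvgMl; rewrite -[X in r X](scale0r xi).
apply: (@cvg_comp _ _ _ (fun n => u n *: xi) r); last exact: cr.
by apply: cvgZr_tmp.
Qed.

End real_cutoff.

Lemma complex_cutoff (chi : 'rV[R]_1 -> R[i]) : test_function setT chi -> chi 0 = 1 ->
  (forall e, cintegrable leb1 setT (fun xi => chi (e *: xi) * (W (xi 0 0))%:C%C)) /\
  ccvg_to 0^'+ (fun e => cintegral leb1 setT (fun xi => chi (e *: xi) * (W (xi 0 0))%:C%C))
    (\int[lebesgue_measure]_xi W xi)%:C%C.
Proof.
move=> [[s1 s2] [K [cK _ chi0]]] chi1.
have c1 : continuous (fun xi => complex.Re (chi xi)) by move=> x; exact: (smooth_on_cts s1).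
have c2 : continuous (fun xi => complex.Im (chi xi)) by move=> x; exact: (smooth_on_cts s2).
have [D1 h1] : exists D, forall x, `|complex.Re (chi x)| <= D.
  by apply: (compact_support_bounded cK c1) => x /chi0 ->.
have [D2 h2] : exists D, forall x, `|complex.Im (chi x)| <= D.
  by apply: (compact_support_bounded cK c2) => x /chi0 ->.
have ER e xi : complex.Re (chi (e *: xi) * (W (xi 0 0))%:C%C) = complex.Re (chi (e *: xi)) * W (xi 0 0).
  by rewrite ReM /= mulr0 subr0.
have EI e xi : complex.Im (chi (e *: xi) * (W (xi 0 0))%:C%C) = complex.Im (chi (e *: xi)) * W (xi 0 0).
  by rewrite ImM /= mulr0 add0r.
split=> [e|].
  split; [under eq_fun do rewrite ER|under eq_fun do rewrite EI].
  - exact: (cutoff_integrable c1 h1 e).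
  - exact: (cutoff_integrable c2 h2 e).
split => /=.
- rewrite (_ : (fun e => _) = fun e => \int[leb1]_xi (complex.Re (chi (e *: xi)) * W (xi 0 0))).
    by have := cutoff_cvg c1 h1; rewrite chi1 mul1r.
  by apply/funext => e; apply: eq_Rintegral => xi _; exact: ER.
- rewrite (_ : (fun e => _) = fun e => \int[leb1]_xi (complex.Im (chi (e *: xi)) * W (xi 0 0))).
    by have := cutoff_cvg c2 h2; rewrite chi1 mul0r.
  by apply/funext => e; apply: eq_Rintegral => xi _; exact: EI.
Qed.

End cutoff.

(** * The oscillatory kernel *)

Section extension.
Context {R : realType}.

(** At a point of [A] the product rule applies, and off [K] the product is locally zero; the two
    open sets cover the space. It handles [weight_s], singular at [s = 0], against a test function
    supported in [0 < s < 1]. *)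
Lemma smooth_on_extension (V : normedModType R) (A K : set V) (w g : V -> R) :
  open A -> closed K -> K `<=` A -> smooth_on A w -> smooth_on setT g ->
  (forall x, ~ K x -> g x = 0) -> smooth_on setT (fun x => w x * g x).
Proof.
move=> oA cK KA sw sg g0 vs x _; have [Ax|Ax] := pselect (A x).
  exact: (smooth_onM oA sw (sub_smooth_on (@subsetT _ A) sg)).
have s0 : smooth_on (~` K) (fun x => w x * g x).
  apply: (eq_smooth_on (closed_openC cK) _ (@smooth_on_cst R V R (~` K) 0)).
  by move=> y /[!inE] /g0 ->; rewrite mulr0.
by apply: s0 => /KA.
Qed.

Variables (U : set 'rV[R]_2) (theta : 'rV[R]_2 -> 'rV[R]_3).

(* Extends [theta] by a direction that is not a pole. *)
Definition total_theta (u : 'rV[R]_2) : 'rV[R]_3 := if u \in U then theta u else vec3 0 0 1.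

Hypothesis htheta : local_parameterization sphere2 U theta.

Lemma total_theta_unit u : dotp (total_theta u) (total_theta u) = 1.
Proof.
rewrite /total_theta; case: ifPn => [/set_mem Uu|_].
  by case: htheta => _ _ _ /(_ _ Uu) /sphere2P.
rewrite dotp3E; by have [-> -> ->] := @vec3E R 0 0 1; ring.
Qed.

Lemma measurable_total_theta : measurable_fun setT total_theta.
Proof.
case: htheta => oU st _ _ _.
have mU : measurable U by exact: open_rV_measurable.
apply/measurable_fun_rVP => i; rewrite -(setUv U).
apply/measurable_funU => //; first exact: measurableC.
split.
- apply: (eq_measurable_fun (fun u => theta u 0 i)).
    by move=> u uU; rewrite /= /rV_coords /total_theta uU.
  apply: open_continuous_rV_measurable => // u /[!inE] Uu.
  exact: (smooth_on_cts (smooth_on_coord_comp 0 i oU st) Uu).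
- apply: (eq_measurable_fun (cst (vec3 0 0 (1 : R) 0 i))) => //.
  by move=> u; rewrite in_setC /= /rV_coords /total_theta => /negPf ->.
Qed.

Lemma negligible_coord (a : R) : (lebesgue_rV R 2).-negligible [set v : 'rV[R]_2 | v 0 1 = a].
Proof.
have mA : measurable [set v : 'rV[R]_2 | v 0 1 = a].
  have mf := @measurable_coord R 2 1 0.
  by have := mf measurableT _ (measurable_set1 a); rewrite setTI; exact.
exists [set v : 'rV[R]_2 | v 0 1 = a]; split => //.
rewrite -[X in lebesgue_rV R 2 X]setIT -integral_indic//.
apply: (@integral_rV2_null R (EFin \o \1_[set v : 'rV[R]_2 | v 0 1 = a]) a).
- by apply/measurable_EFinP; exact: measurable_indic.
- by move=> v; rewrite lee_fin /= indicE ler0n.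
- by move=> v va; rewrite /= indicE memNset//; exact/eqP.
Qed.

(** By injectivity of [theta] each of the two poles has at most one preimage in [U], and that point
    lies on a null line. Outside [U] the chosen direction is not a pole. *)
Lemma total_theta_pole : {ae lebesgue_rV R 2, forall u, ~ pole (total_theta u)}.
Proof.
case: htheta => oU st inj sph _.
pose P (e : R) := [set u | U u /\ theta u = vec3 e 0 0].
have Pn e : (lebesgue_rV R 2).-negligible (P e).
  have [[u0 [Uu0 tu0]]|Pe] := pselect (exists u, P e u); last first.
    rewrite (_ : P e = set0); first exact: negligible_set0.
    by apply/seteqP; split=> u // Pu; apply: Pe; exists u.
  apply: negligibleS (negligible_coord (u0 0 1)) => u [Uu tu] /=.
  by rewrite (inj u u0 Uu Uu0) // tu tu0.
apply: negligibleS (negligibleU (Pn 1) (Pn (- 1))) => u /=.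
move=> /contrapT; rewrite /total_theta; case: ifPn => [/set_mem Uu pu|_]; last first.
  rewrite /pole /= ; have [-> _ _] := @vec3E R 0 0 1.
  by rewrite expr0n /= => /eqP; rewrite eq_sym oner_eq0.
have := sphere2P (sph u Uu); rewrite dotp3E -!expr2 (pu : _ ^+ 2 = 1) => tt.
have t12 : theta u 0 1 ^+ 2 + theta u 0 2 ^+ 2 = 0 by move: tt; lra.
have [t1 t2] : theta u 0 1 = 0 /\ theta u 0 2 = 0.
  move/eqP : t12; rewrite paddr_eq0 ?sqr_ge0// => /andP[].
  by rewrite !sqrf_eq0 => /eqP -> /eqP.
have /eqP := (pu : theta u 0 0 ^+ 2 = 1); rewrite sqrf_eq1 => /orP[] /eqP t0; [left|right];
  split=> //; apply: rV3P; rewrite ?t0 ?t1 ?t2.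
all: by rewrite ?(proj1 (vec3E _ _ _)) /vec3 !mxE.
Qed.

End extension.

Section oscillatory_kernel.
Context {R : realType}.

Definition phase (theta : 'rV[R]_2 -> 'rV[R]_3) (z : 'rV[R]_3 * 'rV[R]_3 * 'rV[R]_1) : R :=
  z.2 0 0 * cylinder_eq (z.1.2 0 0) (theta (vec2 (z.1.2 0 1) (z.1.2 0 2))) z.1.1.

Definition amplitude (z : 'rV[R]_3 * 'rV[R]_3 * 'rV[R]_1) : R[i] :=
  ((2 * pi)^-1 * (weight_x z.1.1 * weight_s (z.1.2 0 0)))%:C%C.

Definition part (i : bool) (z : R[i]) : R := if i then complex.Im z else complex.Re z.
Definition part_unit (i : bool) : R[i] := if i then Complex 0 1 else 1.
Definition shift (b : bool) : R := if b then - (pi / 2) else 0.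

(* Indices [(i, j, b)]: part [i] of [f], part [j] of [g], part [b] of the
   exponential. *)
Definition parts : seq (bool * bool * bool) :=
  [:: (false, false, false); (false, false, true); (false, true, false); (false, true, true);
      (true, false, false); (true, false, true); (true, true, false); (true, true, true)].

Definition part_coef (k : bool * bool * bool) : R[i] :=
  ((2 * pi)^-1)%:C%C * (part_unit k.1.1 * part_unit k.1.2 * part_unit k.2).

Lemma cos_shift (p : R) b : cos (p + shift b) = if b then sin p else cos p.
Proof.
case: b => /=; last by rewrite addr0.
by rewrite cosD cosN sinN cos_pihalf sin_pihalf; ring.
Qed.

(** Eight real integrands with complex coefficients, so that the real estimates apply termwise. The
    cutoff is put into the coefficient because it is constant in [x] and [y]. *)
Lemma integrand_parts (p wx ws : R) (chi f g : R[i]) :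
  cexpi p * ((2 * pi)^-1 * (wx * ws))%:C%C * chi * f * g =
  \sum_(k <- parts) (chi * part_coef k) *
    (cos (p + shift k.2) * ((wx * part k.1.1 f) * (ws * part k.1.2 g)))%:C%C.
Proof.
rewrite /parts !big_cons big_nil !cos_shift /part_coef /cexpi /=.
set P := (2 * pi)^-1; set c := cos p; set s := sin p.
case: chi f g => [c1 c2] [f1 f2] [g1 g2].
by apply: complex_ext; rewrite /=; ring.
Qed.

Lemma smooth_part (V : normedModType R) i (f : V -> R[i]) :
  csmooth_on setT f -> smooth_on setT (fun x => part i (f x)).
Proof. case=> s1 s2; case: i; [exact s2|exact s1]. Qed.

Lemma shell_open (a b : R) : open (shell a b).
Proof.
have ce : continuous (@enorm R 3).
  move=> x; apply: (@continuous_comp _ _ _ (fun x : 'rV[R]_3 => dotp x x)); last exact: sqrt_continuous.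
  have sid := @smooth_on_id R 'rV[R]_3 setT.
  exact: (smooth_on_cts (smooth_on_dotp openT sid sid)).
have -> : shell a b = (@enorm R 3) @^-1` `]a, b[%classic.
  by apply/seteqP; split=> x; rewrite /shell /= in_itv.
by apply: open_comp => // x _; exact: ce.
Qed.

Lemma open_half_space : open [set y : 'rV[R]_3 | 0 < y 0 0].
Proof.
rewrite (_ : [set y | _] = (fun y : 'rV[R]_3 => y 0 0) @^-1` [set s | 0 < s])//.
by apply: open_comp (@open_pos R) => y _; exact: continuous_coord.
Qed.

Lemma smooth_weight_s_coord :
  smooth_on [set y : 'rV[R]_3 | 0 < y 0 0] (fun y : 'rV[R]_3 => weight_s (y 0 0)).
Proof.
apply: (@smooth_on_comp_lin R R 'rV[R]_3 R _ _ (fun y : 'rV[R]_3 => y 0 0) (@weight_s R)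
  _ _ _ (@smooth_weight_s R)) => //.
- by move=> t y z; rewrite !mxE.
- exact: continuous_coord.
Qed.

Section fixed_geometry.
Variables (eps1 eps2 : R) (sigma : R -> 'rV[R]_3 -> {measure set 'rV[R]_3 -> \bar R})
  (U : set 'rV[R]_2) (theta : 'rV[R]_2 -> 'rV[R]_3).
Hypotheses (e1 : 0 < eps1) (e12 : eps1 < eps2) (e2 : eps2 < 1)
  (hsigma : forall s t, 0 < s < 1 -> sphere2 t ->
     is_surface_measure [set x | cylinder_eq s t x = 0] (sigma s t))
  (htheta : local_parameterization sphere2 U theta).
Let X := shell (alpha_of eps1) (alpha_of eps2).
Let Y := coord_domain U.
Let th := total_theta U theta.

Lemma tl_vec2 (y : 'rV[R]_3) : tl y = vec2 (y 0 1) (y 0 2).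
Proof.
rewrite [LHS]vec2E !mxE; congr (vec2 (y _ _) (y _ _)); exact/val_inj.
Qed.

Lemma theta_tl y : Y y -> theta (vec2 (y 0 1) (y 0 2)) = th (tl y).
Proof. by move=> [_ Uy]; rewrite tl_vec2 /th /total_theta mem_set. Qed.

Lemma sigma_surface s t : 0 < s < 1 -> dotp t t = 1 -> is_surface_measure (cyl s t) (sigma s t).
Proof. by move=> s01 tt; apply: hsigma => //; rewrite /sphere2 /= /enorm tt sqrtr1. Qed.

Section test_functions.
Variable f : 'rV[R]_3 -> R[i].
Hypothesis tf : test_function X f.
Let F i x := weight_x x * part i (f x).

Lemma weighted_part_continuous i : continuous (F i).
Proof.
case: tf => sf _ x; apply: (@continuousM _ _ (@weight_x R) (fun x => part i (f x))).
  exact: (smooth_on_cts (@smooth_weight_x R)).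
exact: (smooth_on_cts (smooth_part i sf)).
Qed.

Lemma weighted_part_bound i : exists C M, 0 <= C /\ forall x, `|F i x| <= C * \1_(box 3 M) x.
Proof.
case: tf => sf [K [cK KX f0]]; apply: (compact_support_box cK).
  exact: weighted_part_continuous.
by move=> x /f0 fx; rewrite /F fx /part; case: i; rewrite mulr0.
Qed.

Lemma cylinder_transform_coordE y : Y y ->
  cylinder_transform_coord sigma eps1 eps2 theta f y =
  Complex (weight_s (y 0 0) * chart_transform (F false) (y 0 0) (th (tl y)))
    (weight_s (y 0 0) * chart_transform (F true) (y 0 0) (th (tl y))).
Proof.
move=> Yy; have [y01 _] := Yy; have tt := total_theta_unit htheta (tl y).
rewrite /cylinder_transform_coord theta_tl//.
exact: (cylinder_transformE e1 e12 e2 y01 tt (sigma_surface y01 tt) tf).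
Qed.

Lemma measurable_chart_transform_coord i : measurable_fun setT (fun y : 'rV[R]_3 => chart_transform (F i) (y 0 0) (th (tl y))).
Proof.
have mF : measurable_fun setT (F i) by apply: continuous_rV_measurable; exact: weighted_part_continuous.
have mz : measurable_fun setT (fun y : 'rV[R]_3 => (y 0 0, th (tl y))).
  apply: measurable_fun_pair; first exact: measurable_coord.
  exact: measurableT_comp (measurable_total_theta htheta) (@measurable_tl R).
exact: (measurableT_comp (measurable_chart_transform mF) mz).
Qed.

Lemma chart_transform_coord_bound i : exists D, forall y : 'rV[R]_3, `|chart_transform (F i) (y 0 0) (th (tl y))| <= D.
Proof.
have [C [M [C0 FC]]] := weighted_part_bound i.
have mF : measurable_fun setT (F i) by apply: continuous_rV_measurable; exact: weighted_part_continuous.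
exists (C * \int[lebesgue_rV R 2]_v strip (3 * M) v) => y.
exact: (chart_transform_bound C0 mF FC _ (total_theta_unit htheta _)).
Qed.

End test_functions.

(** On [K] the transform is bounded: the chart integral is bounded everywhere, and [weight_s] is
    continuous on the compact [K], which stays in [0 < s]. *)
Lemma cylinder_transform_coord_integrable f K : test_function X f -> compact K -> K `<=` Y ->
  cintegrable (lebesgue_rV R 3) K (cylinder_transform_coord sigma eps1 eps2 theta f).
Proof.
move=> tf cK KY; have mK : measurable K by exact: compact_rV_measurable.
have Kpos : K `<=` [set y : 'rV[R]_3 | 0 < y 0 0] by move=> y /KY [/andP[]].
have cw : {within K, continuous (fun y : 'rV[R]_3 => weight_s (y 0 0))}.
  apply: continuous_in_subspaceT => y /[!inE] /Kpos y0.
  exact: (smooth_on_cts smooth_weight_s_coord y0).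
have [A hA] : exists A, forall y, K y -> `|weight_s (y 0 0)| <= A.
  have cfK := continuous_compact cw cK.
  have [A [_ AK]] := compact_bounded cfK.
  exists (`|A| + 1) => y Ky; apply: AK; last by exists y.
  by rewrite (le_lt_trans (ler_norm _))// ltrDl.
have mw : measurable_fun setT (fun y : 'rV[R]_3 => weight_s (y 0 0)).
  apply: measurable_inv_ge0; last by move=> y; exact: sqrtr_ge0.
  apply: measurableT_comp; first exact: measurable_sqrt.
  have m0 := @measurable_coord R 3 0 0.
  by apply: measurable_funM => //; exact: measurable_funD.
have [M KM] := compact_sub_box cK.
have muK : (lebesgue_rV R 3 K < +oo)%E.
  apply: le_lt_trans (lebesgue_rV_box 3 M); apply: le_measure => //; rewrite inE //.
  exact: box_measurable.
have ii i : (lebesgue_rV R 3).-integrable K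
    (EFin \o (fun y : 'rV[R]_3 => weight_s (y 0 0) * chart_transform (fun x => weight_x x * part i (f x)) (y 0 0) (th (tl y)))).
  apply: measurable_bounded_integrable => //.
    apply: measurable_funTS; apply: measurable_funM => //; exact: measurable_chart_transform_coord.
  have [D hD] := chart_transform_coord_bound tf i.
  exists (A * D); split; first exact: num_real.
  move=> B AB y Ky; rewrite /= normrM; apply: le_trans (ltW AB).
  by apply: ler_pM => //; exact: hA.
split.
- apply: eq_integrable (ii false) => //; first by move=> y /[!inE] Ky; rewrite (cylinder_transform_coordE tf (KY _ Ky)).
- apply: eq_integrable (ii true) => //; first by move=> y /[!inE] Ky; rewrite (cylinder_transform_coordE tf (KY _ Ky)).
Qed.

(** * The pairing with two test functions and its limit *)

Section pairing.
Variables f g : 'rV[R]_3 -> R[i].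
Hypotheses (tf : test_function X f) (tg : test_function Y g).
Let F i x := weight_x x * part i (f x).
Let kap j (y : 'rV[R]_3) := weight_s (y 0 0) * part j (g y).

Let kap_props j : [/\ smooth_on setT (kap j) &
  exists K, [/\ compact K, K `<=` Y & forall y, ~ K y -> kap j y = 0]].
Proof.
case: tg => sg [K [cK KY g0]].
have p0 y : ~ K y -> part j (g y) = 0 by move=> /g0 ->; case: j.
split; last by exists K; split=> // y /p0 h; rewrite /kap h mulr0.
have Kpos : K `<=` [set y : 'rV[R]_3 | 0 < y 0 0] by move=> y /KY [/andP[]].
have clK : closed K by exact: compact_closed.
exact: (smooth_on_extension open_half_space clK Kpos smooth_weight_s_coord (smooth_part j sg) p0).
Qed.

Let L i j := \int[lebesgue_rV R 3]_y (kap j y * chart_transform (F i) (y 0 0) (th (tl y))).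

Let weak i j b :
  [/\ measurable_fun setT (weak_integral th (F i) (kap j) (shift b)),
    exists D, 0 <= D /\ forall xi, `|weak_integral th (F i) (kap j) (shift b) xi| <= D / (1 + xi ^+ 2) &
    \int[lebesgue_measure]_xi weak_integral th (F i) (kap j) (shift b) xi =
    2 * pi * cos (shift b) * L i j].
Proof.
have [C [M [C0 FC]]] := weighted_part_bound tf i.
have [sk [K [cK KY k0]]] := kap_props j.
have K01 (y : 'rV[R]_3) : K y -> 0 < y 0 0 < 1 by move=> /KY [].
have cF : continuous (F i) by exact: weighted_part_continuous.
exact (@weak_formula R th (F i) (kap j) C M K sigma (measurable_total_theta htheta) (total_theta_unit htheta)
  (total_theta_pole htheta) C0 cF FC sk cK K01 k0
  (fun s t => @sigma_surface s t) (shift b)).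
Qed.

Let T (k : bool * bool * bool) (xi : R) (y x : 'rV[R]_3) :=
  cos (xi * cylinder_eq (y 0 0) (th (tl y)) x + shift k.2) * (F k.1.1 x * kap k.1.2 y).

Let mT k xi : measurable_fun setT (fun z : 'rV[R]_3 * 'rV[R]_3 => T k xi z.1 z.2).
Proof.
have mF : measurable_fun setT (F k.1.1).
  by apply: continuous_rV_measurable; exact: weighted_part_continuous.
have mk : measurable_fun setT (kap k.1.2).
  have [sk _] := kap_props k.1.2.
  by apply: continuous_rV_measurable => y; exact: (smooth_on_cts sk).
apply: measurable_funM.
  apply: (measurableT_comp (continuous_measurable_fun (@continuous_cos R))).
  apply: measurable_funD => //; apply: measurable_funM => //; apply: measurable_cylinder_eq => //.
    exact: measurableT_comp (@measurable_coord R 3 0 0) measurable_fst.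
  apply: measurableT_comp; first exact: measurable_total_theta htheta.
  exact: measurableT_comp (@measurable_tl R) measurable_fst.
apply: measurable_funM; first exact: measurableT_comp mF measurable_snd.
exact: measurableT_comp mk measurable_fst.
Qed.

Let T_le k : exists h1 h2, [/\ (lebesgue_rV R 3).-integrable setT (EFin \o h1),
  (lebesgue_rV R 3).-integrable setT (EFin \o h2) &
  forall xi y x, `|T k xi y x| <= h1 y * h2 x].
Proof.
have [C [M [C0 FC]]] := weighted_part_bound tf k.1.1.
have [sk [K [cK KY k0]]] := kap_props k.1.2.
have ck : continuous (kap k.1.2) by move=> y; exact: (smooth_on_cts sk).
have [D [N [D0 kD]]] := compact_support_box cK ck k0.
exists (fun y => D * \1_(box 3 N) y), (fun x => C * \1_(box 3 M) x); split.
- exact: integrable_EFinZl measurableT (integrable_box 3 N).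
- exact: integrable_EFinZl measurableT (integrable_box 3 M).
- move=> xi y x; rewrite /T normrM.
  apply: le_trans (_ : `|F k.1.1 x * kap k.1.2 y| <= _).
    by rewrite ler_piMl// ler_norml cos_geN1 cos_le1.
  by rewrite normrM mulrC; apply: ler_pM => //; exact: FC.
Qed.

Let T_integrable k xi y : (lebesgue_rV R 3).-integrable setT (fun x => (T k xi y x)%:E).
Proof.
have [h1 [h2 [i1 i2 hT]]] := T_le k.
exact: (majorant_integrable_snd (mT k xi) i2 (hT xi) y).
Qed.

Let T_integrable2 k xi : (lebesgue_rV R 3).-integrable setT
  (fun y => (\int[lebesgue_rV R 3]_x T k xi y x)%:E).
Proof.
have [h1 [h2 [i1 i2 hT]]] := T_le k.
exact: (majorant_integrable_Rintegral (mT k xi) i1 i2 (hT xi)).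
Qed.

Let W k := weak_integral th (F k.1.1) (kap k.1.2) (shift k.2).

Lemma pairing_parts (chi : R[i]) (xi : 'rV[R]_1) :
  cintegral (lebesgue_rV R 3) setT (fun y => cintegral (lebesgue_rV R 3) setT (fun x =>
    cexpi (phase theta (x, y, xi)) * amplitude (x, y, xi) * chi * f x * g y)) =
  \sum_(k <- parts) part_coef k * (chi * (W k (xi 0 0))%:C%C).
Proof.
transitivity (cintegral (lebesgue_rV R 3) setT (fun y =>
  \sum_(k <- parts) (chi * part_coef k) * (\int[lebesgue_rV R 3]_x T k (xi 0 0) y x)%:C%C)).
  apply: eq_cintegral => y _.
  transitivity (cintegral (lebesgue_rV R 3) setT (fun x =>
    \sum_(k <- parts) (chi * part_coef k) * (T k (xi 0 0) y x)%:C%C)).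
    apply: eq_cintegral => x _; rewrite /amplitude integrand_parts /=.
    apply: eq_bigr => k _; congr (_ * _%:C%C); rewrite /T /phase /=.
    (* Outside [Y] the extended direction may differ from [theta], but there [g] vanishes. *)
    have [Yy|Yy] := pselect (Y y); first by rewrite theta_tl.
    case: tg => _ [K [_ KY g0]]; have gy : g y = 0 by apply: g0 => /KY.
    by rewrite /kap gy (_ : part _ 0 = 0) ?mulr0//; case: (k.1.2).
  rewrite cintegral_sum//; last by move=> k; apply: cintegrable_real; exact: T_integrable.
  by apply: eq_bigr => k _; rewrite cintegral_real.
rewrite cintegral_sum//; last by move=> k; apply: cintegrable_real; exact: T_integrable2.
by apply: eq_bigr => k _; rewrite cintegral_real mulrAC mulrC; congr (_ * _); rewrite mulrC.
Qed.

Lemma transform_pairing :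
  cintegral (lebesgue_rV R 3) setT (fun y => cylinder_transform_coord sigma eps1 eps2 theta f y * g y) =
  \sum_(k <- parts) part_coef k * (2 * pi * cos (shift k.2) * L k.1.1 k.1.2)%:C%C.
Proof.
pose c (k : bool * bool * bool) := part_coef k * (2 * pi * cos (shift k.2))%:C%C.
pose h (k : bool * bool * bool) (y : 'rV[R]_3) := kap k.1.2 y * chart_transform (F k.1.1) (y 0 0) (th (tl y)).
have ih k : (lebesgue_rV R 3).-integrable setT (EFin \o h k).
  have [sk [K [cK KY k0]]] := kap_props k.1.2.
  have ck : continuous (kap k.1.2) by move=> y; exact: (smooth_on_cts sk).
  have [D [N [D0 kD]]] := compact_support_box cK ck k0.
  have [A hA] := chart_transform_coord_bound tf k.1.1.
  apply: (@integrable_bounded_box R 3 _ (D * A) N).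
    apply: measurable_funM; first exact: continuous_rV_measurable.
    exact: measurable_chart_transform_coord.
  by move=> y; rewrite normrM mulrAC ler_pM.
transitivity (cintegral (lebesgue_rV R 3) setT (fun y => \sum_(k <- parts) c k * (h k y)%:C%C)).
  apply: eq_cintegral => y _.
  have [Yy|Yy] := pselect (Y y); last first.
    case: tg => _ [K [_ KY g0]]; have gy : g y = 0 by apply: g0 => /KY.
    rewrite gy mulr0 big1// => k _; rewrite /h /kap gy (_ : part _ 0 = 0) ?mulr0 ?mul0r ?mulr0//.
    by case: (k.1.2).
  rewrite (cylinder_transform_coordE tf Yy) /parts !big_cons big_nil /c /h /kap /part_coef.
  (* The four terms with the sine vanish since [cos (- (pi / 2)) = 0]. The other four form the
     complex product of the transform and [g], the factor [2 * pi] of the inversion cancelling that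
     of the amplitude. *)
  rewrite /shift /= cos0 cosN cos_pihalf.
  have P0 : 2 * pi != 0 :> R by rewrite mulf_neq0// gt_eqF// pi_gt0.
  have P1 := mulVf P0.
  set P := (2 * pi)^-1 in P1 *; set Q := 2 * pi in P1 *.
  set r0 := chart_transform _ _ _; set r1 := chart_transform _ _ _; set w := weight_s _.
  case: (g y) => g1 g2.
  by apply: complex_ext; rewrite /=; ring: P1.
rewrite cintegral_sum//; last by move=> k; exact: cintegrable_real.
apply: eq_bigr => k _; rewrite cintegral_real /c -mulrA; congr (_ * _).
rewrite [Rintegral _ _ _](_ : _ = L k.1.1 k.1.2)//.
by apply: complex_ext; rewrite /=; ring.
Qed.

Lemma pairing_limit (chi : 'rV[R]_1 -> R[i]) : test_function setT chi -> chi 0 = 1 ->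
  ccvg_to 0^'+ (fun eps => cintegral (lebesgue_rV R 1) setT (fun xi =>
    cintegral (lebesgue_rV R 3) setT (fun y => cintegral (lebesgue_rV R 3) setT (fun x =>
      cexpi (phase theta (x, y, xi)) * amplitude (x, y, xi) * chi (eps *: xi) * f x * g y))))
  (cintegral (lebesgue_rV R 3) setT (fun y => cylinder_transform_coord sigma eps1 eps2 theta f y * g y)).
Proof.
move=> tc c1; rewrite transform_pairing.
have cut k := let: And3 mW (ex_intro D (conj _ WD)) _ := weak k.1.1 k.1.2 k.2 in
  complex_cutoff mW WD tc c1.
rewrite (_ : (fun eps => _) = fun eps => \sum_(k <- parts) part_coef k *
    cintegral (lebesgue_rV R 1) setT (fun xi => chi (eps *: xi) * (W k (xi 0 0))%:C%C)); last first.
  apply/funext => eps; rewrite -cintegral_sum//; last by move=> k; have [+ _] := cut k; exact.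
  by apply: eq_cintegral => xi _; rewrite pairing_parts.
apply: ccvg_sum => k; have [_] := cut k.
by have [_ _ ->] := weak k.1.1 k.1.2 k.2.
Qed.

End pairing.

Lemma cylinder_transform_oscillatory :
  has_oscillatory_kernel X Y (cylinder_transform_coord sigma eps1 eps2 theta)
    (phase theta) amplitude.
Proof.
move=> f tf; split; first by move=> K; exact: cylinder_transform_coord_integrable.
by move=> g chi tg tc c1; exact: pairing_limit.
Qed.

End fixed_geometry.
End oscillatory_kernel.

(** * Phase, amplitude and canonical relation *)

Section phase_geometry.
Context {R : realType}.

Definition angles (y : 'rV[R]_3) : 'rV[R]_2 := vec2 (y 0 1) (y 0 2).

Lemma angles_linear (t : R) y z : angles (t *: y + z) = t *: angles y + angles z.
Proof.
by rewrite [LHS]vec2E [RHS]vec2E /angles !vec2_0 !vec2_1 !mxE.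
Qed.

Lemma continuous_angles : continuous angles.
Proof.
move=> y; apply: (@smooth_on_cts _ _ _ setT) => //.
apply: smooth_on_rV; first exact: openT.
move=> i; case: i => -[|[|//]] Hi.
- rewrite (_ : (fun x => _) = fun x : 'rV[R]_3 => x 0 1); first exact: smooth_on_coord.
  by apply/funext => x; rewrite mxE.
- rewrite (_ : (fun x => _) = fun x : 'rV[R]_3 => x 0 2); first exact: smooth_on_coord.
  by apply/funext => x; rewrite mxE.
Qed.

Lemma smooth_fst (V W : normedModType R) (A : set (V * W)) : smooth_on A (@fst V W).
Proof. by apply: (@smooth_on_affine R _ _ A fst fst) => // x; exact: cvg_fst. Qed.

Lemma smooth_snd (V W : normedModType R) (A : set (V * W)) : smooth_on A (@snd V W).
Proof. by apply: (@smooth_on_affine R _ _ A snd snd) => // x; exact: cvg_snd. Qed.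

Lemma open_coord_domain (U : set 'rV[R]_2) : open U -> open (coord_domain U).
Proof.
move=> oU.
have -> : coord_domain U = (fun y : 'rV[R]_3 => y 0 0) @^-1` `]0, 1[%classic `&` angles @^-1` U.
  by apply/seteqP; split=> y; rewrite /coord_domain /= in_itv.
apply: openI; apply: open_comp => // y _; first exact: continuous_coord.
exact: continuous_angles.
Qed.

Lemma open_setX (V W : normedModType R) (A : set V) (B : set W) :
  open A -> open B -> open (A `*` B).
Proof.
rewrite !openE => oA oB [a b] [/= /oA Aa /oB Bb].
by exists (A, B).
Qed.

Lemma open_neq0 (V : normedModType R) : open [set x : V | x != 0].
Proof.
rewrite (_ : [set x | _] = ~` [set 0]); last by apply/seteqP; split=> x /= /eqP.
exact/closed_openC/(accessible_closed_set1 (hausdorff_accessible (@norm_hausdorff _ V))).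
Qed.

Variables (U : set 'rV[R]_2) (theta : 'rV[R]_2 -> 'rV[R]_3).
Hypothesis htheta : local_parameterization sphere2 U theta.
Let Y := coord_domain U.

Lemma phaseE x y (xi : 'rV[R]_1) : phase theta (x, y, xi) =
  xi 0 0 * (dotp x x - dotp x (theta (angles y)) ^+ 2 - y 0 0).
Proof. by rewrite /phase /= cylinder_eqE. Qed.

Lemma smooth_phase (X : set 'rV[R]_3) : open X ->
  smooth_on (X `*` Y `*` [set xi : 'rV[R]_1 | xi != 0]) (phase theta).
Proof.
move=> oX; case: htheta => oU st _ _ _.
set D := _ `*` _.
have oD : open D.
  by apply: open_setX; [apply: open_setX => //; exact: open_coord_domain|exact: open_neq0].
have sxi : smooth_on D (fun z => z.2 0 0).
  exact (smooth_on_coord_comp 0 0 oD (@smooth_snd _ _ D)).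
have sp : smooth_on D (fun z => z.1) by exact (@smooth_fst _ _ D).
have cf : continuous (fun z : 'rV[R]_3 * 'rV[R]_3 * 'rV[R]_1 => z.1) by move=> z; exact: cvg_fst.
have sx : smooth_on D (fun z => z.1.1).
  apply: (@smooth_on_affine R _ _ D (fun z : 'rV[R]_3 * 'rV[R]_3 * 'rV[R]_1 => z.1.1) (fun z => z.1.1)) => //.
  by move=> z; apply: (@continuous_comp _ _ _ _ fst); [exact: cf|exact: cvg_fst].
have cy : continuous (fun z : 'rV[R]_3 * 'rV[R]_3 * 'rV[R]_1 => z.1.2).
  by move=> z; apply: (@continuous_comp _ _ _ _ snd); [exact: cf|exact: cvg_snd].
have sy : smooth_on D (fun z => z.1.2).
  exact: (@smooth_on_affine R _ _ D (fun z : 'rV[R]_3 * 'rV[R]_3 * 'rV[R]_1 => z.1.2) (fun z => z.1.2)).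
have sth : smooth_on D (fun z => theta (angles z.1.2)).
  apply: (@smooth_on_comp_lin R _ _ _ U D (fun z => angles z.1.2) theta) => //.
  - by move=> t z1 z2; rewrite /= angles_linear.
  - by move=> z; apply: (@continuous_comp _ _ _ (fun z : 'rV[R]_3 * 'rV[R]_3 * 'rV[R]_1 => z.1.2) angles); [exact: cy|exact: continuous_angles].
  - by move=> z [[_ [_ Uz]] _].
have sd := smooth_onB oD (smooth_onB oD (smooth_on_dotp oD sx sx)
  (smooth_onX 2 oD (smooth_on_dotp oD sx sth))) (smooth_on_coord_comp 0 0 oD sy).
apply: (eq_smooth_on oD _ (smooth_onM oD sxi sd)).
by move=> [[x y] xi] _ /=; rewrite phaseE.
Qed.

(** The phase is affine in [s] with slope [- xi]; this alone shows that its differential never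
    vanishes for a nonzero frequency. *)
Lemma is_derive_phase_s x y (xi : 'rV[R]_1) :
  is_derive (x, y, xi) (0, delta_mx 0 0, 0) (phase theta) (- xi 0 0).
Proof.
apply: is_derive_affine => t.
transitivity (phase theta (t *: 0 + x, t *: delta_mx 0 0 + y, t *: 0 + xi)); first by [].
rewrite !scaler0 !add0r.
rewrite !phaseE; have -> : angles (t *: delta_mx 0 0 + y) = angles y.
  rewrite angles_linear (_ : angles (delta_mx 0 0) = 0) ?scaler0 ?add0r//.
  by apply/rowP => -[[|[|//]] Hi]; rewrite !mxE /= ?mxE.
by rewrite !mxE /GRing.scale /=; ring.
Qed.

Lemma rV1_neq0 (xi : 'rV[R]_1) : (xi != 0) = (xi 0 0 != 0).
Proof.
congr negb; apply/eqP/eqP => [->|x0]; first by rewrite mxE.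
by apply/rowP => i; rewrite (ord1 i) x0 mxE.
Qed.

Lemma phase_function_phase (X : set 'rV[R]_3) : open X -> phase_function X Y (phase theta).
Proof.
move=> oX; split; first exact: smooth_phase.
- by move=> x y xi t _ _ _ _; rewrite !phaseE mxE mulrA.
- move=> x y xi _ _ xi0; exists (0, delta_mx 0 0, 0).
  by rewrite (@derive_val _ _ _ _ _ _ _ (is_derive_phase_s x y xi)) oppr_eq0 -rV1_neq0.
Qed.

Lemma iter_derive_fst (V W : normedModType R) (g : V -> R) (vs : seq V) :
  iter_derive [seq (v, 0 : W) | v <- vs] (g \o fst) = iter_derive vs g \o fst.
Proof.
elim: vs => [//|v vs IH] /=; rewrite IH; apply/funext => z.
by rewrite (@derive_comp_lin R V _ R (@fst V W)).
Qed.

(** The directions [(0, w)] stand last in the list, hence act first: one of them already kills a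
    function of the first component, and the remaining derivatives act on zero. *)
Lemma iter_derive_fst0 (V W : normedModType R) (g : V -> R) (vs : seq (V * W)) (w : W) ws :
  iter_derive (vs ++ [seq (0 : V, w) | w <- w :: ws]) (g \o fst) = cst 0.
Proof.
have d0 w' (h : V -> R) : 'D_(0 : V, w') (h \o fst) = cst 0 :> (V * W -> R).
  apply/funext => z; apply: (@derive_val _ _ _ _ _ _ _ (_ : is_derive z (0 : V, w') (h \o fst) 0)).
  by apply: is_derive_affine => t; rewrite /= !scaler0 !add0r.
have c0 us : iter_derive us (cst 0 : V * W -> R) = cst 0.
  by elim: us => [//|u us IH] /=; rewrite IH derive_cstE.
have cw (us : seq W) (u : W) : iter_derive [seq (0 : V, w) | w <- u :: us] (g \o fst) = cst 0.
  elim: us u => [|u' us IH] u; first exact: d0.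
  transitivity ('D_(0 : V, u) (iter_derive [seq (0 : V, w) | w <- u' :: us] (g \o fst))); first by [].
  by rewrite IH derive_cstE.
by rewrite /iter_derive foldr_cat -/(iter_derive _ _) -/(iter_derive _ _) cw c0.
Qed.

Lemma symbol_amplitude (X : set 'rV[R]_3) : open X -> symbol X Y 0 (@amplitude R).
Proof.
move=> oX; case: htheta => oU _ _ _ _.
have oY : open Y by exact: open_coord_domain.
have oXY : open (X `*` Y) by exact: open_setX.
pose g (p : 'rV[R]_3 * 'rV[R]_3) := (2 * pi)^-1 * (weight_x p.1 * weight_s (p.2 0 0)) : R.
have sg : smooth_on (X `*` Y) g.
  have s1 : smooth_on (X `*` Y) (fun p => weight_x p.1).
    apply: (@smooth_on_comp_lin R _ _ _ setT (X `*` Y) fst (@weight_x R)) => //.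
    - by move=> z; exact: cvg_fst.
    - exact: smooth_weight_x.
  have s2 : smooth_on (X `*` Y) (fun p => weight_s (p.2 0 0)).
    apply: (@smooth_on_comp_lin R _ _ _ _ (X `*` Y) snd (fun y : 'rV[R]_3 => weight_s (y 0 0))
      _ _ _ (@smooth_weight_s_coord R)) => //.
    - by move=> z; exact: cvg_snd.
    - by move=> p [_ [/andP[]]].
  exact (smooth_onZ _ oXY (smooth_onM oXY s1 s2)).
have Rg : (fun z => complex.Re (amplitude z)) = g \o fst by [].
have Ig : (fun z => complex.Im (amplitude z)) = cst 0 :> (('rV[R]_3 * 'rV[R]_3) * 'rV[R]_1 -> R) by [].
have c0 us : iter_derive us (cst 0 : ('rV[R]_3 * 'rV[R]_3) * 'rV[R]_1 -> R) = cst 0.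
  by elim: us => [//|u us IH] /=; rewrite IH derive_cstE.
split.
  split; last by rewrite Ig; exact (@smooth_on_cst R _ _ _ 0).
  rewrite Rg; apply: (@smooth_on_comp_lin R _ _ _ (X `*` Y) _ fst g) => //.
  - by move=> z; exact: cvg_fst.
  - by move=> z [].
move=> K cK KXY vs [|w ws] /=.
  have cg : {within K, continuous (iter_derive vs g)}.
    apply: continuous_in_subspaceT => p /[!inE] /KXY Kp.
    by have [] := sg vs p Kp.
  have [A [_ AK]] := compact_bounded (continuous_compact cg cK).
  (* Without derivatives in [xi] the exponent in the bound is [0], so a bound on the compact [K] is
     all that is asked. With at least one, the derivatives vanish and the constant is [0]. *)
  exists (`|A| + 1) => p xi Kp.
  rewrite cats0 subr0 powRr0 mulr1 Rg Ig iter_derive_fst c0 normr0; split; last by rewrite addr_ge0.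
  by apply: AK; [rewrite (le_lt_trans (ler_norm _))// ltrDl|exists p].
exists 0 => p xi Kp; rewrite mul0r Rg Ig c0 normr0; split=> //.
by rewrite (iter_derive_fst0 g) normr0.
Qed.

Lemma grad_phase_x y (xi : 'rV[R]_1) x :
  grad (fun z => phase theta (z, y, xi)) x =
  (2 * xi 0 0) *: (x - dotp x (theta (angles y)) *: theta (angles y)).
Proof.
apply: grad_is_derive => v.
have := is_deriveZ (xi 0 0) (is_derive_cylinder_eq (y 0 0) (theta (angles y)) x v).
move/is_derive_eq; apply; rewrite dotpZl dotpDl dotpNl dotpZl (dotpC (theta _) v).
by rewrite /GRing.scale /=; ring.
Qed.

Lemma grad_phase_xi x y (xi : 'rV[R]_1) :
  (grad (fun z => phase theta (x, y, z)) xi = 0) <->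
  cylinder_eq (y 0 0) (theta (angles y)) x = 0.
Proof.
set c := cylinder_eq _ _ _.
have -> : grad (fun z => phase theta (x, y, z)) xi = const_mx c.
  apply: grad_is_derive => v; apply: is_derive_affine => t.
  by rewrite /phase /= -/c /dotp big_ord_recl big_ord0 !mxE addr0 /GRing.scale /=; ring.
split=> [/rowP/(_ 0)|->]; first by rewrite !mxE.
by apply/rowP => i; rewrite !mxE.
Qed.

Lemma grad_phase_y x (xi : 'rV[R]_1) y : Y y ->
  grad (fun z => phase theta (x, z, xi)) y =
  vec3 (- xi 0 0) (2 * - xi 0 0 * dotp x (dpar1 theta (angles y)) * dotp x (theta (angles y)))
    (2 * - xi 0 0 * dotp x (dpar2 theta (angles y)) * dotp x (theta (angles y))).
Proof.
move=> [_ Uy]; case: htheta => oU st _ _ _.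
have D v : is_derive y v (fun z => phase theta (x, z, xi))
    (xi 0 0 * (- (2 * dotp x (theta (angles y)) * dotp x ('D_(angles v) theta (angles y))) - v 0 0)).
  have d0 := derivableP (@smooth_on_derivable _ _ _ _ _ _ (angles v) st Uy).
  have d1 : is_derive y v (fun z => theta (angles z)) ('D_(angles v) theta (angles y)).
    exact: (is_derive_comp_lin angles_linear d0).
  have d2 : is_derive y v (fun z => dotp x (theta (angles z))) (dotp x ('D_(angles v) theta (angles y))).
    apply: (@is_derive_lin_comp R _ _ _ (dotp x)) => //.
    - by move=> t a b; rewrite dotpDr dotpZr.
    - rewrite (_ : dotp x = fun z => dotp z x); first exact: continuous_dotp.
      by apply/funext => z; rewrite dotpC.
  have d3 : is_derive y v (fun z : 'rV[R]_3 => z 0 0) (v 0 0).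
    by apply: is_derive_affine => t; rewrite !mxE.
  have := is_deriveZ (xi 0 0) (is_deriveB (is_deriveB (is_derive_cst (dotp x x) y v) (is_deriveX 2 d2)) d3).
  rewrite (_ : _ \*: _ = fun z => phase theta (x, z, xi)); last first.
    by apply/funext => z; rewrite phaseE.
  by move/is_derive_eq; apply; rewrite /GRing.scale /=; ring.
have [h0 h1 h2] := vec3E (- xi 0 0) (2 * - xi 0 0 * dotp x (dpar1 theta (angles y)) * dotp x (theta (angles y)))
    (2 * - xi 0 0 * dotp x (dpar2 theta (angles y)) * dotp x (theta (angles y))).
have a1 : angles (delta_mx 0 1) = vec2 1 0 by rewrite /angles !mxE.
have a2 : angles (delta_mx 0 2) = vec2 0 1 by rewrite /angles !mxE.
apply: rV3P; rewrite ?h0 ?h1 ?h2 mxE.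
- have d : is_derive y (delta_mx 0 0) (fun z => phase theta (x, z, xi)) (- xi 0 0).
    apply: is_derive_affine => t; rewrite !phaseE.
    have -> : angles (t *: delta_mx 0 0 + y) = angles y.
      rewrite angles_linear (_ : angles (delta_mx 0 0) = 0) ?scaler0 ?add0r//.
      by apply/rowP => -[[|[|//]] Hi]; rewrite !mxE /= ?mxE.
    by rewrite !mxE /GRing.scale /=; ring.
  exact: (@derive_val _ _ _ _ _ _ _ d).
- rewrite (@derive_val _ _ _ _ _ _ _ (D (delta_mx 0 1))) a1 /dpar1 mxE /=.
  by ring.
- rewrite (@derive_val _ _ _ _ _ _ _ (D (delta_mx 0 2))) a2 /dpar2 mxE /=.
  by ring.
Qed.

(** The correspondence is [sigma = - xi]: the phase contains [- xi * s], and [omega] is minus the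
    gradient in [x]. Neither covector can vanish, as [eta] has the component [sigma] dual to [s],
    and [x - dotp x t *: t] has squared norm [s > 0] on the cylinder. *)
Lemma canonical_relation_phase (eps1 eps2 : R) :
  cylinder_relation eps1 eps2 U theta =
  canonical_relation (shell (alpha_of eps1) (alpha_of eps2)) Y (phase theta).
Proof.
case: (htheta) => _ _ _ sph _.
have nz (s : R) x t : dotp t t = 1 -> cylinder_eq s t x = 0 -> 0 < s -> x - dotp x t *: t != 0.
  move=> tt; rewrite cylinder_eqE => /eqP; rewrite subr_eq0 -dotp_normal// => /eqP xs s0.
  apply/eqP => x0; move: s0; rewrite -xs x0 /dotp big1 ?ltxx// => i _.
  by rewrite mxE mul0r.
apply/seteqP; split=> p.
- move=> [s [al [be [sg [x [[Xx s01 sg0 Uab xs] ->]]]]]].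
  have [y0 y1 y2] := vec3E s al be.
  have ay : angles (vec3 s al be) = vec2 al be by rewrite /angles y1 y2.
  have Yy : Y (vec3 s al be) by split; rewrite ?y0 ?y1 ?y2.
  have tt := sphere2P (sph _ Uab).
  have s0 : 0 < s by case/andP: s01.
  exists x, (vec3 s al be), (const_mx (- sg)); rewrite grad_phase_x grad_phase_y// ay mxE opprK.
  split; split=> //.
  + by rewrite rV1_neq0 mxE oppr_eq0.
  + by apply/grad_phase_xi; rewrite ay y0.
  + by rewrite oppr_eq0 scaler_eq0 mulf_eq0 pnatr_eq0 oppr_eq0 (negPf sg0) /= (nz s _ _ tt xs s0).
  + apply/eqP => /rowP/(_ 0); have [-> _ _] := vec3E sg (2 * sg * dotp x (dpar1 theta (vec2 al be)) * dotp x (theta (vec2 al be)))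
      (2 * sg * dotp x (dpar2 theta (vec2 al be)) * dotp x (theta (vec2 al be))).
    by rewrite mxE => /eqP; rewrite (negPf sg0).
  + by rewrite mulrN scaleNr opprK.
- move=> [x [y [xi [[Xx Yy xi0 /grad_phase_xi xs] [_ _ ->]]]]].
  have [y01 Uy] := Yy.
  exists (y 0 0), (y 0 1), (y 0 2), (- xi 0 0), x.
  split; first by split=> //; rewrite oppr_eq0 -rV1_neq0.
  rewrite grad_phase_x grad_phase_y// mulrN scaleNr.
  congr (((_, _), (_, _))).
  by have [h0 h1 h2] := vec3E (y 0 0) (y 0 1) (y 0 2); apply: rV3P; rewrite ?h0 ?h1 ?h2.
Qed.

End phase_geometry.

Theorem theorem1 (R : realType) (eps1 eps2 : R)
    (heps1 : 0 < eps1) (heps12 : eps1 < eps2) (heps2 : eps2 < 1)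
    (sigma : R -> 'rV[R]_3 -> {measure set 'rV[R]_3 -> \bar R})
    (hsigma : forall (s : R) (theta : 'rV[R]_3), 0 < s < 1 -> sphere2 theta ->
       is_surface_measure [set x | cylinder_eq s theta x = 0] (sigma s theta))
    (U : set 'rV[R]_2) (theta : 'rV[R]_2 -> 'rV[R]_3)
    (htheta : local_parameterization sphere2 U theta) :
  is_FIO (shell (alpha_of eps1) (alpha_of eps2)) (coord_domain U)
    (cylinder_transform_coord sigma eps1 eps2 theta)
    (-1)
    (cylinder_relation eps1 eps2 U theta).
Proof.
exists 1%N, 0, (phase theta), (@amplitude R); split; first by split=> //; field.
have oX := @shell_open R (alpha_of eps1) (alpha_of eps2).
split.
- exact: phase_function_phase.
- exact: (symbol_amplitude htheta oX).
- exact: cylinder_transform_oscillatory.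
- exact: canonical_relation_phase.
Qed.
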